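(* Let $f\in L_2(\Omega)$ be given. Consider the nodal-continuous primal hybrid formulation: find $u\in H^{2,\mathcal N}_0(\mathcal T)$ and $\boldsymbol\eta\in H^{-3/2,-1/2}_{J0}(\mathcal S)$ such that \[ (\mathcal C D^2u,D^2\delta u)_{\mathcal T}+\langle\boldsymbol\eta,\delta u\rangle_{\mathcal S}=(f,\delta u),\qquad \langle\boldsymbol{\delta\eta},u\rangle_{\mathcal S}=0 \] holds for any $\delta u\in H^{2,\mathcal N}_0(\mathcal T)$ and $\boldsymbol{\delta\eta}\in H^{-3/2,-1/2}_{J0}(\mathcal S)$. This problem is well posed (it has exactly one solution, depending continuously on $f$). Its solution $(u,\boldsymbol\eta)$ satisfies \[ \|u\|_{2,\mathcal T}+\|\boldsymbol\eta\|_{-3/2,-1/2,J0,\mathcal S}\le C\|f\| \] with a constant $C$ that is independent of $f$ and $\mathcal T$. Furthermore, $u\in H^2_0(\Omega)$, $\boldsymbol\eta=\gamma_{\mathrm{dDiv},J0}(\mathcal C D^2u)$, and $u$, $\boldsymbol M:=\mathcal C D^2u$ solve the Kirchhoff–Love problem \[ \operatorname{div}\operatorname{\mathbf{div}}\boldsymbol M=f,\quad \boldsymbol M=\mathcal C D^2u\ \text{ in }\Omega,\qquad u=\partial_nu=0\ \text{ on }\Gamma. \]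
   Context: $\Omega\subset\mathbb R^2$ is a bounded, simply connected Lipschitz polygon with boundary $\Gamma=\partial\Omega$; $\partial_n$ is the exterior normal derivative. $\mathbb S$ is the space of symmetric $2\times2$ real matrices; $\mathcal C$ is a symmetric, (uniformly) positive definite $L_\infty$ tensor field on $\Omega$, acting pointwise as a linear map $\mathbb S\to\mathbb S$. $D^2$ is the Hessian and $\operatorname{\mathbf{div}}$ the row-wise divergence of tensors. $(\cdot,\cdot)$, $\|\cdot\|$ are the $L_2(\Omega)$ inner product and norm. $\|v\|_{2,T}^2:=\|v\|_{L_2(T)}^2+\|D^2v\|_{L_2(T)}^2$, and $H(\mathrm{dDiv},\Omega;\mathbb S):=\{\boldsymbol M\in L_2(\Omega;\mathbb S):\operatorname{div}\operatorname{\mathbf{div}}\boldsymbol M\in L_2(\Omega)\}$ with $\|\boldsymbol M\|_{\mathrm{dDiv}}^2:=\|\boldsymbol M\|^2+\|\operatorname{div}\operatorname{\mathbf{div}}\boldsymbol M\|^2$. $H^2_0(\Omega)$ is the subspace of $H^2(\Omega)$ with vanishing trace and normal derivative on $\Gamma$. $\mathcal T$ is a regular (conforming) mesh of shape-regular triangles $T$ covering $\Omega$, with skeleton $\mathcal S=\bigcup_{T\in\mathcal T}\partial T$; $\mathcal N(\Omega)$ and $\mathcal N(\Gamma)$ are the mesh vertices interior to $\Omega$ and on $\Gamma$, respectively. $(\cdot,\cdot)_{\mathcal T}$ is the sum of elementwise $L_2$ inner products, with differential operators taken elementwise. $H^2(\mathcal T):=\prod_{T\in\mathcal T}H^2(T)$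 (piecewise functions), $\|v\|_{2,\mathcal T}^2=\sum_T\|v\|_{2,T}^2$, and $H^{2,\mathcal N}_0(\mathcal T):=\{v\in H^2(\mathcal T): v\text{ is continuous at every }x\in\mathcal N(\Omega)\text{ and vanishes at every }x\in\mathcal N(\Gamma)\}$ (i.e., the values $v|_T(x)$ from all elements $T$ with vertex $x$ coincide, resp. vanish). Trace operator $\gamma_{\mathrm{dDiv},J0}:H(\mathrm{dDiv},\Omega;\mathbb S)\to H^{2,\mathcal N}_0(\mathcal T)^*$, $\langle\gamma_{\mathrm{dDiv},J0}(\boldsymbol M),v\rangle_{\mathcal S}:=(\operatorname{div}\operatorname{\mathbf{div}}\boldsymbol M,v)-(\boldsymbol M,D^2v)_{\mathcal T}$. Trace space $H^{-3/2,-1/2}_{J0}(\mathcal S):=\gamma_{\mathrm{dDiv},J0}(H(\mathrm{dDiv},\Omega;\mathbb S))$ with norm $\|\boldsymbol\eta\|_{-3/2,-1/2,J0,\mathcal S}:=\inf\{\|\boldsymbol M\|_{\mathrm{dDiv}}:\gamma_{\mathrm{dDiv},J0}(\boldsymbol M)=\boldsymbol\eta\}$; $\langle\boldsymbol\eta,v\rangle_{\mathcal S}$ is the action of the functional $\boldsymbol\eta$ on $v\in H^{2,\mathcal N}_0(\mathcal T)$. *)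

(* Defs.v *)
From HB Require Import structures.
From mathcomp Require Import all_boot all_order all_algebra.
From mathcomp Require Import all_classical all_reals all_analysis.
Import Order.TTheory GRing.Theory Num.Theory numFieldNormedType.Exports.

Set Implicit Arguments.
Unset Strict Implicit.
Unset Printing Implicit Defensive.

Local Open Scope classical_set_scope.
Local Open Scope ring_scope.

(* MathComp-Analysis, over an arbitrary R : realType; points of the plane are
   pairs in R * R, and coordinates are indexed by 'I_2. *)

Definition mu2 (R : realType) : set (R * R) -> \bar R :=
  (@lebesgue_measure R \x @lebesgue_measure R)%E.
Arguments mu2 R : clear implicits.

Section plane.
Variable R : realType.
Local Notation plane := (R * R)%type.
Implicit Types (U Om : set plane) (x y a b n : plane).

Definition coord (i : 'I_2) x : R := if i == ord0 then x.1 else x.2.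

Definition basis2 (i : 'I_2) : plane := ((i == ord0)%:R, (i != ord0)%:R).

Definition dotp x y : R := \sum_(i < 2) coord i x * coord i y.

(* The library's norm on a product is the max norm; geometry uses this one. *)
Definition enorm x : R := Num.sqrt (dotp x x).

Definition segpt a b (t : R) : plane := a + t *: (b - a).

Definition segment a b : set plane := segpt a b @` `[0, 1].

Definition boundary U : set plane := closure U `\` U°.

(* In local orthonormal coordinates (e, e'), Om is the subgraph of a Lipschitz
   function near each boundary point. *)
Definition lipschitz_boundary Om : Prop :=
  forall x, boundary Om x ->
  exists (e e' : plane) (r h k : R) (g : R -> R),
    [/\ [/\ dotp e e = 1, dotp e' e' = 1 & dotp e e' = 0],
        0 < r, 0 < h,
        (forall s t, `|g s - g t| <= k * `|s - t|)
      & forall s t, `|s| < r -> `|t| < h ->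
          (Om (x + s *: e + t *: e') <-> t < g s)].

Definition polygonal_boundary Om : Prop :=
  exists s : seq (plane * plane),
    boundary Om = [set x | exists2 p, p \in s & segment p.1 p.2 x].

Definition lipschitz_polygon Om : Prop :=
  [/\ Om !=set0, open Om, connected Om, bounded_set Om
    & lipschitz_boundary Om /\ polygonal_boundary Om].

Definition path_in Om (c : R -> plane) : Prop :=
  {within `[0, 1], continuous c} /\ c @` `[0, 1] `<=` Om.

Definition simply_connected Om : Prop :=
  (forall x y, Om x -> Om y -> exists c, [/\ path_in Om c, c 0 = x & c 1 = y]) /\
  (forall c, path_in Om c -> c 0 = c 1 ->
   exists H : R * R -> plane,
     [/\ {within `[0, 1] `*` `[0, 1], continuous H},
         H @` (`[0, 1] `*` `[0, 1]) `<=` Om,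
         (forall t, t \in `[0, 1] -> H (0, t) = c t),
         (forall t, t \in `[0, 1] -> H (1, t) = c 0)
       & forall s, s \in `[0, 1] -> H (s, 0) = c 0 /\ H (s, 1) = c 0]).

(* Functions stand for their classes modulo equality a.e. *)

Definition L2 U (f : plane -> R) : Prop := f \_ U \in Lfun (mu2 R) 2%:E.

Definition ip U (f g : plane -> R) : R := \int[mu2 R]_(x in U) (f x * g x).

Definition L2norm U f : R := Num.sqrt (ip U f f).

Definition eq_ae U (f g : plane -> R) : Prop :=
  {ae mu2 R, forall x, U x -> f x = g x}.

Definition frob (A B : 'M[R]_2) : R := \sum_i \sum_j A i j * B i j.

Definition tip U (M N : plane -> 'M[R]_2) : R :=
  \int[mu2 R]_(x in U) frob (M x) (N x).

Definition symm (A : 'M[R]_2) : Prop := A^T = A.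

Definition L2sym U (M : plane -> 'M[R]_2) : Prop :=
  (forall i j, L2 U (fun x => M x i j)) /\
  {ae mu2 R, forall x, U x -> symm (M x)}.

Definition pderiv (i : 'I_2) (f : plane -> R) : plane -> R :=
  fun x => 'D_(basis2 i) f x.

Definition pderivs (s : seq 'I_2) f := foldr pderiv f s.

Definition smooth (f : plane -> R) : Prop :=
  forall s, continuous (pderivs s f) /\
    forall i x, derivable (pderivs s f) x (basis2 i).

Definition test U (phi : plane -> R) : Prop :=
  [/\ smooth phi, compact (closure [set x | phi x != 0])
    & closure [set x | phi x != 0] `<=` U].

(* Distributions are only ever evaluated at test functions. *)
Definition distr := (plane -> R) -> R.

Definition regular U (u : plane -> R) : distr := fun phi => ip U u phi.

Definition dpart (i : 'I_2) (t : distr) : distr := fun phi => - t (pderiv i phi).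

Definition distr_div (q : 'I_2 -> distr) : distr :=
  fun phi => \sum_(i < 2) dpart i (q i) phi.

Definition distr_rowdiv (M : 'I_2 -> 'I_2 -> distr) : 'I_2 -> distr :=
  fun i => distr_div (M i).

Definition is_L2rep U (t : distr) (g : plane -> R) : Prop :=
  L2 U g /\ forall phi, test U phi -> t phi = regular U g phi.

Definition in_L2 U (t : distr) : Prop := exists g, is_L2rep U t g.

Definition L2rep U (t : distr) : plane -> R := xget (cst 0) (is_L2rep U t).

Definition weakD U i (u : plane -> R) : plane -> R :=
  L2rep U (dpart i (regular U u)).

Definition hess U (u : plane -> R) : plane -> 'M[R]_2 :=
  fun x => \matrix_(i, j) L2rep U (dpart i (dpart j (regular U u))) x.

Definition H1 U (u : plane -> R) : Prop :=
  L2 U u /\ forall i, in_L2 U (dpart i (regular U u)).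

Definition H2 U (u : plane -> R) : Prop :=
  H1 U u /\ forall i j, in_L2 U (dpart i (dpart j (regular U u))).

Definition div_div U (M : plane -> 'M[R]_2) : distr :=
  distr_div (distr_rowdiv (fun i j => regular U (fun x => M x i j))).

Definition divDiv U (M : plane -> 'M[R]_2) : plane -> R :=
  L2rep U (div_div U M).

Definition HdDiv U (M : plane -> 'M[R]_2) : Prop :=
  L2sym U M /\ in_L2 U (div_div U M).

Definition dDiv_norm U M : R :=
  Num.sqrt (tip U M M + ip U (divDiv U M) (divDiv U M)).

(* As the boundary is a finite union of segments, convergence in L2 of the
   boundary is convergence in L2 along each nondegenerate segment. *)
Definition bsegment Om a b : Prop := a != b /\ segment a b `<=` boundary Om.

(* g is the trace of v : the limit in L2 of the boundary of the restrictions of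
   smooth functions that tend to v in H1. *)
Definition is_trace Om (v g : plane -> R) : Prop :=
  [/\ H1 Om v,
      (forall a b, bsegment Om a b ->
         (g \o segpt a b) \_ `[0, 1] \in Lfun (@lebesgue_measure R) 2%:E)
    & exists phi : nat -> plane -> R,
      [/\ forall m, smooth (phi m),
          L2norm Om (fun x => phi m x - v x) @[m --> \oo] --> 0,
          (forall i, L2norm Om (fun x => pderiv i (phi m) x - weakD Om i v x)
             @[m --> \oo] --> 0)
        & forall a b, bsegment Om a b ->
          (\int[@lebesgue_measure R]_(t in `[0, 1])
             (phi m (segpt a b t) - g (segpt a b t)) ^+ 2)
             @[m --> \oo] --> 0]].

(* At a boundary point that is not a corner, a polygon is locally a half-plane;
   corners have no normal. *)
Definition ext_normal Om x n : Prop :=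
  enorm n = 1 /\
  exists2 r : R, 0 < r &
    forall y, enorm (y - x) < r -> (Om y <-> dotp (y - x) n < 0).

Definition is_normal_derivative Om (v g : plane -> R) : Prop :=
  exists w : 'I_2 -> plane -> R,
    (forall i, is_trace Om (weakD Om i v) (w i)) /\
    forall a b, bsegment Om a b ->
      {ae @lebesgue_measure R, forall t, t \in `[0, 1] ->
         forall n, ext_normal Om (segpt a b t) n ->
         \sum_(i < 2) coord i n * w i (segpt a b t) = g (segpt a b t)}.

Definition H20 Om (u : plane -> R) : Prop :=
  [/\ H2 Om u, is_trace Om u (cst 0) & is_normal_derivative Om u (cst 0)].

(* Only the restriction of Ct x to symmetric matrices is meaningful. *)
Definition tensor_field Om (Ct : plane -> {linear 'M[R]_2 -> 'M[R]_2}) : Prop :=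
  [/\ {ae mu2 R, forall x, Om x -> forall A, symm A -> symm (Ct x A)},
      {ae mu2 R, forall x, Om x -> forall A B, symm A -> symm B ->
         frob (Ct x A) B = frob A (Ct x B)},
      (exists2 al : R, 0 < al &
         {ae mu2 R, forall x, Om x -> forall A, symm A ->
            al * frob A A <= frob (Ct x A) A}),
      (forall A i j, symm A -> measurable_fun Om (fun x => Ct x A i j))
    & exists k : R, {ae mu2 R, forall x, Om x -> forall A, symm A ->
         frob (Ct x A) (Ct x A) <= k * frob A A}].

Definition tapply (Ct : plane -> {linear 'M[R]_2 -> 'M[R]_2})
  (M : plane -> 'M[R]_2) : plane -> 'M[R]_2 := fun x => Ct x (M x).

(* A triangle is given by its three vertices. *)
Definition triangle := 'I_3 -> plane.

Definition nondegenerate (T : triangle) : Prop :=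
  forall l : 'I_3 -> R, \sum_k l k = 0 -> \sum_k l k *: T k = 0 ->
    forall k, l k = 0.

Definition ctri (T : triangle) : set plane :=
  [set x | exists l : 'I_3 -> R,
     [/\ forall k, 0 <= l k, \sum_k l k = 1 & x = \sum_k l k *: T k]].

Definition otri (T : triangle) : set plane :=
  [set x | exists l : 'I_3 -> R,
     [/\ forall k, 0 < l k, \sum_k l k = 1 & x = \sum_k l k *: T k]].

(* diam T <= sigma * (radius of the largest disc in T) *)
Definition shape_regular (sigma : R) (T : triangle) : Prop :=
  exists (c : plane) (r : R),
    [/\ 0 < r, [set x | enorm (x - c) <= r] `<=` ctri T
      & forall x y, ctri T x -> ctri T y -> enorm (x - y) <= sigma * r].

Definition regular_mesh Om (N : nat) (T : 'I_N -> triangle) : Prop :=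
  [/\ forall i, nondegenerate (T i),
      closure Om = \bigcup_i ctri (T i)
    & forall i j, i != j ->
      let I := ctri (T i) `&` ctri (T j) in
      [\/ I = set0,
          exists k l, T i k = T j l /\ I = [set T i k]
        | exists k k' l l', [/\ k != k', T i k = T j l, T i k' = T j l'
            & I = segment (T i k) (T i k')]]].

(* The continuous representative of v on the closed triangle takes the value c
   at x. *)
Definition point_value (T : triangle) (v : plane -> R) x (c : R) : Prop :=
  exists w : plane -> R,
    [/\ {within ctri T, continuous w}, eq_ae (otri T) v w & w x = c].

Section mesh.
Variables (Om : set plane) (N : nat) (T : 'I_N -> triangle).

Definition pwfun := 'I_N -> plane -> R.

Definition H2N0 (v : pwfun) : Prop :=
  [/\ forall i, H2 (otri (T i)) (v i),
      (forall x, Om x -> exists c, forall i k, T i k = x ->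
         point_value (T i) (v i) x c)
    & forall x, boundary Om x -> forall i k, T i k = x ->
         point_value (T i) (v i) x 0].

Definition pw_ip (f : plane -> R) (v : pwfun) : R :=
  \sum_i ip (otri (T i)) f (v i).

Definition pw_hess (v : pwfun) : 'I_N -> plane -> 'M[R]_2 :=
  fun i => hess (otri (T i)) (v i).

Definition pw_tip (M M' : 'I_N -> plane -> 'M[R]_2) : R :=
  \sum_i tip (otri (T i)) (M i) (M' i).

Definition norm2T (v : pwfun) : R :=
  Num.sqrt (\sum_i ip (otri (T i)) (v i) (v i) +
            pw_tip (pw_hess v) (pw_hess v)).

Definition eq_pw (u v : pwfun) : Prop :=
  forall i, eq_ae (otri (T i)) (u i) (v i).

(* Functionals on H2N0, whose values elsewhere are irrelevant. *)
Definition functional := pwfun -> R.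

Definition eq_fctl (eta eta' : functional) : Prop :=
  forall v, H2N0 v -> eta v = eta' v.

Definition gamma_dDiv (M : plane -> 'M[R]_2) : functional :=
  fun v => pw_ip (divDiv Om M) v - pw_tip (fun=> M) (pw_hess v).

Definition trace_space (eta : functional) : Prop :=
  exists2 M, HdDiv Om M & eq_fctl (gamma_dDiv M) eta.

Definition trace_norm (eta : functional) : R :=
  inf [set dDiv_norm Om M | M in
         [set M | HdDiv Om M /\ eq_fctl (gamma_dDiv M) eta]].

Definition hybrid_solution (Ct : plane -> {linear 'M[R]_2 -> 'M[R]_2})
    (f : plane -> R) (u : pwfun) (eta : functional) : Prop :=
  [/\ H2N0 u, trace_space eta,
      (forall du, H2N0 du ->
         pw_tip (fun i => tapply Ct (pw_hess u i)) (pw_hess du) + eta du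
         = pw_ip f du)
    & forall deta, trace_space deta -> deta u = 0].

End mesh.

Definition kirchhoff_love Om (Ct : plane -> {linear 'M[R]_2 -> 'M[R]_2})
    (f u : plane -> R) (M : plane -> 'M[R]_2) : Prop :=
  [/\ H2 Om u, HdDiv Om M, eq_ae Om (divDiv Om M) f,
      {ae mu2 R, forall x, Om x -> M x = tapply Ct (hess Om u) x}
    & is_trace Om u (cst 0) /\ is_normal_derivative Om u (cst 0)].

End plane.

(* Main.v *)
Require Import Defs.
From HB Require Import structures.
From mathcomp Require Import all_boot all_order all_algebra.
From mathcomp Require Import all_classical all_reals all_analysis.
From mathcomp Require Import measurable_realfun ring lra.
Import Order.TTheory GRing.Theory Num.Theory numFieldNormedType.Exports.
Local Open Scope classical_set_scope.
Local Open Scope ring_scope.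
Set Implicit Arguments.
Unset Strict Implicit.
Unset Printing Implicit Defensive.

(* The energy of the plate is minimized over test functions. By coercivity of C
   the Hessians of a minimizing sequence form a Cauchy sequence in L2, and since
   phi(x)^2 <= |Om| ||d_1 d_2 phi||^2 for a test function phi, the sequence tends
   uniformly to a continuous w that vanishes off Om; w solves the plate problem and
   its normal traces vanish because those of the test functions do. Green's formula
   passes to the limit, so that w is orthogonal to all traces, and
   (w, gamma(C D^2 w)) is a solution of the hybrid problem whose bound only involves
   Om and C. For uniqueness, a solution d of the problem with f = 0 is tested with
   itself: as the traces vanish on d, D^2 d = 0 on each triangle. Solving the plate
   problem with right-hand side d gives M with div div M = d, and the trace of M
   tested with d is then ||d||^2, so d = 0. *)

(** * Square integrable functions and completeness of L2 *)

(** All estimates are made on [Om], for one conforming candidate, before a mesh is chosen;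
    uniqueness then carries them over to whatever solution the mesh admits, which is how the
    constant comes to depend on [Om] and [Ct] alone. The candidate is kept as an H^2 limit of test
    functions: for these, null traces, Green's formula and the Poincare inequality are elementary,
    and all three survive L2 limits. The mixed derivative is singled out because its L1 norm bounds
    point values in the plane; this one estimate yields the Poincare inequality and also the
    continuous representative that the nodal conditions ask for. What remains of a homogeneous
    solution after D^2 d = 0 is piecewise affine; duality detects it through the traces, in place of
    a chase through the mesh. The geometric obstacle is that a mesh covers the closure of [Om] only:
    that its open triangles lie in [Om] is a consequence of the Lipschitz boundary. *)

Section square_integrable.
Context d (T : measurableType d) (R : realType).
Variable mu : {measure set T -> \bar R}.
Variables (D : set T) (mD : measurable D).
Implicit Types f g h : T -> R.

Definition rintegrable f := mu.-integrable D (EFin \o f).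

Lemma rintegrable_measurable f : rintegrable f -> measurable_fun D f.
Proof. by move=> /measurable_int /measurable_EFinP. Qed.

Lemma rintegrableD f g : rintegrable f -> rintegrable g ->
  rintegrable (fun x => f x + g x).
Proof.
by move=> fi gi; rewrite /rintegrable (_ : _ \o _ = (EFin \o f) \+ (EFin \o g))%E;
  [exact: integrableD|apply/funext].
Qed.

Lemma rintegrableZ c f : rintegrable f -> rintegrable (fun x => c * f x).
Proof. by move=> fi; exact: (@integrableZl _ _ _ _ _ mD c _ fi). Qed.

Lemma le_rintegrable f g : measurable_fun D f -> rintegrable g ->
  (forall x, D x -> `|f x| <= g x) -> rintegrable f.
Proof.
move=> mf gi fg; apply: (le_integrable mD _ _ gi); first exact/measurable_EFinP.
by move=> x Dx /=; rewrite lee_fin (le_trans (fg _ Dx))// ler_norm.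
Qed.

Lemma ae_eq_Rintegral f g : measurable_fun D f -> measurable_fun D g ->
  {ae mu, forall x, D x -> f x = g x} ->
  \int[mu]_(x in D) f x = \int[mu]_(x in D) g x.
Proof.
move=> mf mg fg; rewrite /Rintegral; congr fine; apply: ae_eq_integral => //.
- exact/measurable_EFinP.
- exact/measurable_EFinP.
- by apply: filterS fg => x /[apply] ->.
Qed.

(** Replacing [g] by the maximum of [f] and [g], which equals [g] almost everywhere, makes the
    inequality hold at every point. *)
Lemma ae_le_Rintegral f g : rintegrable f -> rintegrable g ->
  {ae mu, forall x, D x -> f x <= g x} ->
  \int[mu]_(x in D) f x <= \int[mu]_(x in D) g x.
Proof.
move=> fi gi fg.
have mf := rintegrable_measurable fi; have mg := rintegrable_measurable gi.
have mM : measurable_fun D (fun x => Num.max (f x) (g x)) by exact: measurable_maxr.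
rewrite (@ae_eq_Rintegral g (fun x => Num.max (f x) (g x)))//; last first.
  by apply: filterS fg => x fg Dx; rewrite max_r ?fg.
apply: le_Rintegral => //; last by move=> x _; rewrite le_max lexx.
apply: (@le_rintegrable _ (fun x => `|f x| + `|g x|)) => //.
  by apply: rintegrableD; exact: integrable_norm.
move=> x _; rewrite /Num.max; case: ifP => _; first by rewrite lerDr.
by rewrite lerDl.
Qed.

(** Measurability of [f] is a separate clause because it does not follow from that of its square. *)
Definition square_integrable f :=
  measurable_fun D f /\ rintegrable (fun x => f x ^+ 2).

Definition dot f g := \int[mu]_(x in D) (f x * g x).

Lemma square_integrable_mul f g : square_integrable f -> square_integrable g ->
  rintegrable (fun x => f x * g x).
Proof.
move=> [mf fi] [mg gi].
apply: (@le_rintegrable _ (fun x => f x ^+ 2 + g x ^+ 2)).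
- exact: measurable_funM.
- exact: rintegrableD.
- by move=> x _; have := sqr_ge0 (f x); have := sqr_ge0 (g x);
    have := sqr_ge0 (f x - g x); have := sqr_ge0 (f x + g x); rewrite ler_norml; nra.
Qed.

Lemma square_integrableD f g : square_integrable f -> square_integrable g ->
  square_integrable (fun x => f x + g x).
Proof.
move=> sf sg; split; first by apply: measurable_funD; [case: sf|case: sg].
have := rintegrableD (rintegrableD (proj2 sf) (proj2 sg))
  (rintegrableZ 2 (square_integrable_mul sf sg)).
by apply: eq_integrable => // x _ /=; congr EFin; ring.
Qed.

Lemma square_integrableZ c f : square_integrable f ->
  square_integrable (fun x => c * f x).
Proof.
move=> [mf fi]; split; first by exact: measurable_funM.
have := rintegrableZ (c ^+ 2) fi.
by apply: eq_integrable => // x _ /=; congr EFin; ring.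
Qed.

Lemma square_integrableB f g : square_integrable f -> square_integrable g ->
  square_integrable (fun x => f x - g x).
Proof.
move=> sf /(square_integrableZ (-1)) sg.
have [m i] := square_integrableD sf sg.
split; first by apply: eq_measurable_fun m => x _; rewrite mulN1r.
by apply: eq_integrable i => // x _ /=; rewrite mulN1r.
Qed.

Lemma square_integrable_ext f g : {in D, f =1 g} -> square_integrable f ->
  square_integrable g.
Proof.
move=> fg [mf fi]; split; first exact: eq_measurable_fun mf.
by apply: eq_integrable fi => // x Dx /=; rewrite fg.
Qed.

Lemma square_integrable0 : square_integrable (fun=> 0).
Proof.
split; first exact: measurable_cst.
rewrite /rintegrable (_ : _ \o _ = cst 0%E); first exact: integrable0.
by apply/funext => x /=; rewrite expr0n.
Qed.

Lemma square_integrable_sum I (s : seq I) (F : I -> T -> R) :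
  (forall i, square_integrable (F i)) ->
  square_integrable (fun x => \sum_(i <- s) F i x).
Proof.
move=> sF; elim: s => [|i s IH].
  by apply: square_integrable_ext square_integrable0 => x _; rewrite big_nil.
apply: square_integrable_ext (square_integrableD (sF i) IH) => x _.
by rewrite big_cons.
Qed.

Lemma dotC f g : dot f g = dot g f.
Proof. by apply: eq_Rintegral => x _; rewrite mulrC. Qed.

Lemma dotDl f g h : square_integrable f -> square_integrable g ->
  square_integrable h -> dot (fun x => f x + g x) h = dot f h + dot g h.
Proof.
move=> sf sg sh; rewrite /dot -RintegralD//; try exact: square_integrable_mul.
by apply: eq_Rintegral => x _; rewrite mulrDl.
Qed.

Lemma dotBl f g h : square_integrable f -> square_integrable g ->
  square_integrable h -> dot (fun x => f x - g x) h = dot f h - dot g h.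
Proof.
move=> sf sg sh; rewrite /dot -RintegralB//; try exact: square_integrable_mul.
by apply: eq_Rintegral => x _; rewrite mulrBl.
Qed.

Lemma dotZl c f h : square_integrable f -> square_integrable h ->
  dot (fun x => c * f x) h = c * dot f h.
Proof.
move=> sf sh; rewrite /dot -RintegralZl//; last exact: square_integrable_mul.
by apply: eq_Rintegral => x _; rewrite mulrA.
Qed.

Lemma dot_ge0 f : 0 <= dot f f.
Proof. by apply: Rintegral_ge0 => x _; rewrite -expr2 sqr_ge0. Qed.

Lemma eq_dot f g f' g' : {in D, f =1 f'} -> {in D, g =1 g'} ->
  dot f g = dot f' g'.
Proof. by move=> ff gg; apply: eq_Rintegral => x Dx; rewrite ff ?gg. Qed.

Lemma ae_eq_dot f g f' g' : measurable_fun D f -> measurable_fun D g ->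
  measurable_fun D f' -> measurable_fun D g' ->
  {ae mu, forall x, D x -> f x = f' x} -> {ae mu, forall x, D x -> g x = g' x} ->
  dot f g = dot f' g'.
Proof.
move=> mf mg mf' mg' ff gg; apply: ae_eq_Rintegral; try exact: measurable_funM.
by apply: filterS2 ff gg => x ff gg Dx; rewrite ff ?gg.
Qed.

(** The quadratic form (c f + e g, c f + e g) is nonnegative; c = - (f, g) and e = (f, f) give the
    claim without a division. These values say nothing if (f, f) = 0, but then the form is affine in
    c, so its slope must vanish. *)
Lemma cauchy_schwarz f g : square_integrable f -> square_integrable g ->
  dot f g ^+ 2 <= dot f f * dot g g.
Proof.
move=> sf sg.
have quad c e : 0 <= c ^+ 2 * dot f f + 2 * c * e * dot f g + e ^+ 2 * dot g g.
  have scf := square_integrableZ c sf; have seg := square_integrableZ e sg.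
  have := dot_ge0 (fun x => c * f x + e * g x).
  rewrite dotDl//; last exact: square_integrableD.
  rewrite ![dot _ (fun x => _ + _)]dotC !dotDl//.
  rewrite !dotZl// ![dot _ (fun x => _ * _)]dotC !dotZl// (dotC g f).
  by move=> H; apply: le_trans H _; rewrite le_eqVlt; apply/orP; left; apply/eqP; ring.
have f0 := dot_ge0 f; have g0 := dot_ge0 g.
have [fe|fne] := eqVneq (dot f f) 0.
  have [->|fgne] := eqVneq (dot f g) 0; first by rewrite expr0n mulr_ge0.
  have := quad (- (dot g g + 1) / (2 * dot f g)) 1.
  rewrite fe mulr0 add0r (_ : 2 * _ * 1 * _ = - (dot g g + 1)); last by field.
  by rewrite expr1n mul1r => H; exfalso; lra.
have := quad (- dot f g) (dot f f).
have fpos : 0 < dot f f by rewrite lt_def fne.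
have -> : (- dot f g) ^+ 2 * dot f f + 2 * - dot f g * dot f f * dot f g
   + dot f f ^+ 2 * dot g g = dot f f * (dot f f * dot g g - dot f g ^+ 2) by ring.
by rewrite pmulr_rge0// subr_ge0.
Qed.

Lemma dot_sqrB f g : square_integrable f -> square_integrable g ->
  dot (fun x => f x - g x) (fun x => f x - g x) = dot f f - 2 * dot f g + dot g g.
Proof.
move=> sf sg; have sfg := square_integrableB sf sg.
by rewrite dotBl// (dotC f) (dotC g) !dotBl// (dotC g f); ring.
Qed.

Lemma dot_eq0 f : square_integrable f -> dot f f = 0 ->
  {ae mu, forall x, D x -> f x = 0}.
Proof.
move=> [mf fi] f0.
have mf2 : measurable_fun D (EFin \o (fun x => f x ^+ 2)).
  by have /integrableP[] := fi.
have /(ae_eq_integral_abs mu mD mf2) : (\int[mu]_(x in D) `|(EFin \o (fun x => f x ^+ 2)%R) x| = 0)%E.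
  rewrite -[RHS](_ : (dot f f)%:E = _); last by rewrite f0.
  rewrite /dot /Rintegral fineK; last first.
    by apply: (@integrable_fin_num _ _ _ mu _ mD _ _); apply: square_integrable_mul.
  by apply: eq_integral => x _ /=; rewrite ger0_norm ?sqr_ge0// expr2.
by apply: filterS => x H Dx; move: (H Dx) => /= [] /eqP; rewrite sqrf_eq0 => /eqP.
Qed.

End square_integrable.

(** * Real sequences tending to zero *)

Section real_sequences.
Context (R : realType).
Implicit Types u v : nat -> R.

Lemma cvg0P u : u @ \oo --> (0 : R) <->
  forall e : R, 0 < e -> exists N, forall n, (N <= n)%N -> `|u n| < e.
Proof.
split=> [/cvgr0Pnorm_lt u0 e e0|H].
  by have [N _ HN] := u0 e e0; exists N => n Nn; exact: HN.
by apply/cvgr0Pnorm_lt => e /H[N HN]; exists N => // n /=; exact: HN.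
Qed.

Lemma cvg0_le u v : (forall n, `|u n| <= v n) -> v @ \oo --> (0 : R) ->
  u @ \oo --> (0 : R).
Proof.
move=> uv /cvg0P v0; apply/cvg0P => e /v0[N HN]; exists N => n /HN.
by apply: le_lt_trans; rewrite (le_trans (uv n))// ler_norm.
Qed.

Lemma cvg0_sqr u : (fun n => u n ^+ 2) @ \oo --> (0 : R) -> u @ \oo --> (0 : R).
Proof.
move=> /cvg0P u0; apply/cvg0P => e e0; have [N HN] := u0 _ (exprn_gt0 2 e0).
exists N => n /HN; rewrite normrX ltr_pXn2r ?nnegrE//; exact: ltW.
Qed.

Lemma cvg0_mul c u : u @ \oo --> (0 : R) -> (fun n => c * u n) @ \oo --> (0 : R).
Proof. by move=> u0; rewrite -(mulr0 c); apply: cvgM => //; exact: cvg_cst. Qed.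

Lemma cvg_sub0 u l : (fun n => u n - l) @ \oo --> (0 : R) -> u @ \oo --> l.
Proof.
move=> ul; rewrite -[l]add0r (_ : u = fun n => (u n - l) + l).
  by apply: cvgD => //; exact: cvg_cst.
by apply/funext => n; rewrite subrK.
Qed.

End real_sequences.

Section complete.
Context d (T : measurableType d) (R : realType).
Variable mu : {measure set T -> \bar R}.
Variables (D : set T) (mD : measurable D).
Implicit Types f g h : T -> R.
Local Notation sqi := (square_integrable mu D).
Local Notation dot := (dot mu D).

Definition cvgL2 (f_ : nat -> T -> R) f :=
  (fun n => dot (fun x => f_ n x - f x) (fun x => f_ n x - f x)) @ \oo --> (0 : R).

Lemma cvgL2_dot (f_ : nat -> T -> R) f g : (forall n, sqi (f_ n)) -> sqi f ->
  sqi g -> cvgL2 f_ f -> (fun n => dot (f_ n) g) @ \oo --> dot f g.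
Proof.
move=> sf_ sf sg cf; apply: cvg_sub0; apply: cvg0_sqr.
apply: (@cvg0_le _ _ (fun n => dot g g *
   dot (fun x => f_ n x - f x) (fun x => f_ n x - f x))).
  move=> n; rewrite -dotBl// ger0_norm ?sqr_ge0// mulrC.
  by apply: cauchy_schwarz => //; exact: square_integrableB.
exact: cvg0_mul.
Qed.

Lemma abs_square_integrable f : sqi f -> sqi (fun x => `|f x|).
Proof.
move=> [mf fi]; split; first exact: measurableT_comp.
by apply: eq_integrable fi => // x _ /=; rewrite real_normK ?num_real.
Qed.

Hypothesis D_fin : (mu D < +oo)%E.

Lemma cst_square_integrable c : sqi (fun=> c).
Proof.
split; first exact: measurable_cst.
apply/integrableP; split; first exact/measurable_EFinP/measurable_cst.
by rewrite integral_cst// lte_mul_pinfty.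
Qed.

(* The increments of the sequence are summable in L1, hence almost everywhere. *)
Lemma fast_cauchy_ae (g : nat -> T -> R) : (forall n, sqi (g n)) ->
  (forall n, dot (g n) (g n) <= ((2 ^ n.+1)%:R^-1) ^+ 2) ->
  {ae mu, forall x, D x -> cvgn (series (g ^~ x))}.
Proof.
move=> sg gle.
(* The L1 norm of [g n] is at most [c] times its L2 norm, by Cauchy--Schwarz against the constant
   1. *)
pose c := Num.sqrt (fine (mu D)).
have mabs n : measurable_fun D (fun x => `|g n x|%:E).
  by apply/measurable_EFinP; case: (abs_square_integrable (sg n)).
have gL1 n : (\int[mu]_(x in D) `|g n x|%:E <= (c / (2 ^ (n + 1))%:R)%:E)%E.
  have sa := abs_square_integrable (sg n).
  have s1 := cst_square_integrable 1.
  have i1 : rintegrable mu D (fun x => `|g n x|).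
    apply: eq_integrable (square_integrable_mul mD sa s1) => // x _ /=.
    by rewrite mulr1.
  rewrite -(fineK (integrable_fin_num mD i1)) lee_fin -[leLHS]/(\int[mu]_(x in D) `|g n x|).
  have -> : \int[mu]_(x in D) `|g n x| = dot (fun x => `|g n x|) (fun=> 1).
    by apply: eq_Rintegral => x _; rewrite mulr1.
  rewrite -(@ler_pXn2r _ 2)// ?nnegrE; last first.
  - by rewrite divr_ge0// sqrtr_ge0.
  - by apply: Rintegral_ge0 => x _; rewrite mulr1.
  apply: (le_trans (cauchy_schwarz mD sa s1)).
  rewrite exprMn sqr_sqrtr ?fine_ge0// mulrC.
  have -> : dot (fun=> 1) (fun=> 1) = fine (mu D).
    rewrite -[RHS]mul1r -Rintegral_cst//.
    by apply: eq_Rintegral => x _; rewrite mul1r.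
  apply: ler_wpM2l; first by rewrite fine_ge0.
  rewrite addn1; apply: le_trans (gle n).
  by rewrite le_eqVlt; apply/orP; left; apply/eqP/eq_Rintegral => x _; rewrite -normrM -!expr2 ger0_norm// sqr_ge0.
have Sint : mu.-integrable D (fun x => \sum_(n <oo) `|g n x|%:E)%E.
  apply/integrableP; split.
    by apply: ge0_emeasurable_sum => // n x _ _.
  under eq_integral => x _ do rewrite gee0_abs ?nneseries_ge0//.
  rewrite integral_nneseries//.
  apply: (@le_lt_trans _ _ (\sum_(n <oo) (c / (2 ^ (n + 1))%:R)%:E)%E).
    apply: lee_nneseries => [n _ _|n _]; last exact: gL1.
    by apply: integral_ge0 => x _; rewrite lee_fin.
  by rewrite (cvg_lim _ (@cvg_geometric_eseries_half _ c 0))// ltry.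
have := integrable_ae mD Sint; apply: filterS => x /[apply] Sx.
apply: normed_cvg; apply: nondecreasing_is_cvgn.
  by apply: nondecreasing_series => n _ _; exact: normr_ge0.
exists (fine (\sum_(n <oo) `|g n x|%:E)%E) => _ [n _ <-].
rewrite -lee_fin fineK// /series/= -sumEFin.
exact: nneseries_lim_ge.
Qed.

(** Riesz--Fischer. A fast subsequence converges almost everywhere to some [f]; Fatou's lemma along
    it, with n fixed, bounds f_n - f by the Cauchy modulus and thereby also shows that [f] is square
    integrable. *)
Lemma L2_complete (f_ : nat -> T -> R) : (forall n, sqi (f_ n)) ->
  (forall e : R, 0 < e -> exists N, forall m n, (N <= m)%N -> (N <= n)%N ->
     dot (fun x => f_ m x - f_ n x) (fun x => f_ m x - f_ n x) < e) ->
  exists2 f, sqi f & cvgL2 f_ f.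
Proof.
move=> sf_ cauchy.
(* The square appears because [dot] is the squared norm. *)
pose del k : R := ((2 ^ k.+1)%:R^-1) ^+ 2.
have del_gt0 k : 0 < del k by rewrite exprn_gt0// invr_gt0 ltr0n expn_gt0.
have [N HN] := choice (fun k => cauchy _ (del_gt0 k)).
(* Summing makes [s] monotone and puts it above [N k]; the successors put it above [k] as well. *)
pose s k := (\sum_(j < k.+1) (N j).+1)%N.
have sN k : (N k <= s k)%N by rewrite /s big_ord_recr/= (leq_trans _ (leq_addl _ _)).
have sS k : (s k <= s k.+1)%N by rewrite [leqRHS]/s big_ord_recr/= leq_addr.
have smono : {homo s : m n / (m <= n)%N} by exact: homo_leq leqnn leq_trans sS.
have ks k : (k <= s k)%N.
  by elim: k => // k IH; rewrite /s big_ord_recr/= (leq_ltn_trans IH)// -[ltnLHS]addn0 ltn_add2l.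
pose g k x := f_ (s k.+1) x - f_ (s k) x.
have sg k : sqi (g k) by exact: square_integrableB.
have gle k : dot (g k) (g k) <= del k.
  by apply/ltW/HN => //; exact: leq_trans (sN k) (sS k).
have ae_cvg := fast_cauchy_ae sg gle.
pose F k x := (f_ (s k) x)%:E.
have mF k : measurable_fun D (F k) by apply/measurable_EFinP; case: (sf_ (s k)).
(* The upper limit is measurable on all of [D], including the points where the subsequence diverges;
   [fine] sends infinite values to 0. *)
pose f x := fine (limn_esup (F ^~ x)).
have mf : measurable_fun D f.
  apply: (measurableT_comp (fine_measurable measurableT)).
  exact: measurable_fun_limn_esup.
have fsub : {ae mu, forall x, D x -> (fun k => f_ (s k) x) @ \oo --> f x}.
  apply: filterS ae_cvg => x /[apply] /cvg_ex[l gl].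
  have cl : (fun k => f_ (s k) x) @ \oo --> (f_ (s 0) x + l).
    rewrite (_ : (fun k => _) = (fun k => f_ (s 0) x + series (g ^~ x) k)).
      by apply: cvgD => //; exact: cvg_cst.
    apply/funext => k; rewrite (eq_sum_telescope (fun k => f_ (s k) x) k).
    by congr (_ + _).
  suff -> : f x = f_ (s 0) x + l by [].
  rewrite /f; have /cvg_limn_einf_sup[_ ->] : F ^~ x @ \oo --> (f_ (s 0) x + l)%:E.
    by apply: cvg_EFin => //; exact: nearW.
  by [].
have fatou_f e : 0 < e -> exists2 M, forall n, (M <= n)%N -> sqi (fun x => f_ n x - f x) &
    forall n, (M <= n)%N -> dot (fun x => f_ n x - f x) (fun x => f_ n x - f x) <= e.
  move=> e0; have [M HM] := cauchy _ e0.
  have key n : (M <= n)%N ->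
      (\int[mu]_(x in D) ((f_ n x - f x) ^+ 2)%:E <= e%:E)%E.
    move=> Mn; pose G k x := ((f_ n x - f_ (s k) x) ^+ 2)%:E.
    have mG k : measurable_fun D (G k).
      apply/measurable_EFinP; apply: measurable_funX.
      by apply: measurable_funB; [case: (sf_ n)|case: (sf_ (s k))].
    have -> : (\int[mu]_(x in D) ((f_ n x - f x) ^+ 2)%:E
        = \int[mu]_(x in D) limn_einf (G ^~ x))%E.
      apply: ae_eq_integral => //.
      - apply/measurable_EFinP; apply: measurable_funX.
        by apply: measurable_funB => //; case: (sf_ n).
      - rewrite (_ : (fun _ => _) = (fun x => - limn_esup (fun k => - G k x))%E)//.
        apply: measurableT_comp => //; apply: measurable_fun_limn_esup => k.
        by apply: measurableT_comp.
      - apply: filterS fsub => x /[apply] cx; apply/esym.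
        have /cvg_limn_einf_sup[-> _]// : G ^~ x @ \oo --> ((f_ n x - f x) ^+ 2)%:E.
        apply: cvg_EFin; first exact: nearW.
        rewrite expr2 (_ : _ \o _ = fun k => (f_ n x - f_ (s k) x) * (f_ n x - f_ (s k) x)).
          by apply: cvgM; (apply: cvgB; [exact: cvg_cst|exact: cx]).
        by apply/funext => k /=; rewrite expr2.
    apply: le_trans (fatou mu mD mG _) _.
      by move=> k x _; rewrite lee_fin sqr_ge0.
    (* Each tail infimum is at most its term of index [maxn M k], for which both functions are in
       the Cauchy range. *)
    rewrite limn_einf_lim; apply: lime_le; first exact: is_cvg_einfs.
    exists 0%N => // k _; apply: (@le_trans _ _ (\int[mu]_(x in D) G (maxn M k) x)%E).
      by apply: ereal_inf_lbound; exists (maxn M k) => //=; rewrite leq_maxr.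
    have sk : (M <= s (maxn M k))%N by rewrite (leq_trans _ (ks _))// leq_maxl.
    have i2 := square_integrable_mul mD (square_integrableB mD (sf_ n) (sf_ (s (maxn M k))))
       (square_integrableB mD (sf_ n) (sf_ (s (maxn M k)))).
    rewrite (_ : (\int[mu]_(x in D) _)%E = (\int[mu]_(x in D) ((f_ n x - f_ (s (maxn M k)) x)
       * (f_ n x - f_ (s (maxn M k)) x))%:E)%E); last first.
      by apply: eq_integral => x _; rewrite /G expr2.
    by rewrite -(fineK (integrable_fin_num mD i2)) lee_fin ltW// HM.
  have sq n : (M <= n)%N -> sqi (fun x => f_ n x - f x).
    move=> Mn; have mfn : measurable_fun D (fun x => f_ n x - f x).
      by apply: measurable_funB => //; case: (sf_ n).
    split=> //; apply/integrableP; split.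
      by apply/measurable_EFinP; exact: measurable_funX.
    apply: (@le_lt_trans _ _ e%:E); last exact: ltry.
    apply: le_trans (key n Mn).
    rewrite le_eqVlt; apply/orP; left; apply/eqP; apply: eq_integral => x _ /=.
    by rewrite ger0_norm ?sqr_ge0.
  exists M => // n Mn; rewrite -lee_fin.
  have sq1 := sq n Mn.
  have ii : rintegrable mu D (fun x => (f_ n x - f x) * (f_ n x - f x)).
    exact: (square_integrable_mul mD sq1 sq1).
  rewrite /dot /Rintegral fineK; last exact: (integrable_fin_num mD ii).
  by under eq_integral do rewrite -expr2; exact: key.
have [M HM _] := fatou_f 1 ltr01.
exists f.
  apply: (square_integrable_ext mD _ (square_integrableB mD (sf_ M) (HM M (leqnn M)))) => x _.
  by rewrite subKr.
apply/cvg0P => e e0; have [K _ HK] := fatou_f (e / 2) (divr_gt0 e0 (ltr0Sn _ 1)).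
exists K => n /HK le2; rewrite ger0_norm ?dot_ge0// (le_lt_trans le2)//.
by rewrite ltr_pdivrMr// ltr_pMr// ltr1n.
Qed.
End complete.

(** * Smooth functions in the plane *)

Section plane_measurability.
Variable R : realType.
Local Notation plane := (R * R)%type.
Local Notation mplane := (measurableTypeR R * measurableTypeR R)%type.
Local Notation leb := (@lebesgue_measure R).
Local Notation rint := (@rintegrable _ mplane R (mu2 R)).

Lemma open_rectangle (U : set plane) (x : plane) : open U -> U x ->
  exists2 r : R, 0 < r & forall y, `|y.1 - x.1| < r -> `|y.2 - x.2| < r -> U y.
Proof.
move=> oU Ux; have /nbhs_ballP[r /= r0 rU] := open_nbhs_nbhs (conj oU Ux).
by exists r => // y y1 y2; apply: rU; split; rewrite /ball/= distrC.
Qed.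

(** The sigma-algebra is the product one, so an open set is exhibited as a countable union of
    rational boxes; boxes that leave [U] are replaced by the empty set. *)
Lemma open_measurable_plane (U : set plane) : open U -> measurable (U : set mplane).
Proof.
move=> oU; pose box (a b c e : rat) : set mplane :=
  `]ratr a : R, ratr b[%classic `*` `]ratr c : R, ratr e[%classic.
pose B a b c e : set mplane := if `[< box a b c e `<=` U >] then box a b c e else set0.
have -> : U = \bigcup_a \bigcup_b \bigcup_c \bigcup_e B a b c e.
  apply/seteqP; split => [x Ux|x [a _ [b _ [c _ [e _]]]]]; last first.
    by rewrite /B; case: asboolP => // + bx; apply.
  have [r r0 rU] := open_rectangle oU Ux.
  have [a] := @rat_in_itvoo _ (x.1 - r) x.1 ltac:(lra).
  have [b] := @rat_in_itvoo _ x.1 (x.1 + r) ltac:(lra).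
  have [c] := @rat_in_itvoo _ (x.2 - r) x.2 ltac:(lra).
  have [e] := @rat_in_itvoo _ x.2 (x.2 + r) ltac:(lra).
  rewrite !in_itv/= => /andP[e1 e2] /andP[c1 c2] /andP[b1 b2] /andP[a1 a2].
  exists a => //; exists b => //; exists c => //; exists e => //.
  rewrite /B; case: asboolP => [_|[]].
    by split; rewrite /= in_itv/=; apply/andP; split.
  move=> y [/=]; rewrite !in_itv/= => /andP[? ?] /andP[? ?].
  by apply: rU; rewrite ltr_norml; apply/andP; split; lra.
do 4!(apply: bigcupT_measurable_rat => ?).
by rewrite /B; case: ifP => // _; apply: measurableX; exact: measurable_itv.
Qed.

Lemma closed_measurable_plane (A : set plane) : closed A -> measurable (A : set mplane).
Proof. by move/closed_openC/open_measurable_plane/measurableC; rewrite setCK. Qed.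

Lemma continuous_measurable_plane (f : plane -> R) (D : set plane) : continuous f ->
  measurable (D : set mplane) -> measurable_fun (D : set mplane) f.
Proof.
move=> /continuousP cf mD; apply: (@measurable_funS _ _ mplane _ setT) => //.
apply: (measurability _ (RGenOpens.measurableE R)).
move=> _ [_ [a [b ->] <-]]; rewrite setTI; apply: open_measurable_plane.
exact/cf/interval_open.
Qed.

Lemma bounded_plane_lty (D : set plane) (L : R) : measurable (D : set mplane) ->
  (forall x, D x -> `|x| < L) -> (mu2 R D < +oo)%E.
Proof.
move=> mD DL; apply: (@le_lt_trans _ _ (mu2 R ((`]-L, L[%classic : set R) `*` `]-L, L[%classic))).
  apply: (le_measure [the {measure set mplane -> \bar R} of mu2 R]); rewrite ?inE//.
    by apply: measurableX; exact: measurable_itv.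
  move=> x /DL; rewrite prod_normE gt_max !ltr_norml => /andP[x1 x2].
  by split; rewrite /= in_itv/=.
have lm : (leb [set` `](- L)%R, L[%R] < +oo)%E.
  by rewrite lebesgue_measure_itv/=; case: ifP => _; rewrite // -EFinB ltry.
rewrite /mu2 product_measure1E; try exact: measurable_itv.
by apply: lte_mul_pinfty => //; rewrite ge0_fin_numE.
Qed.

Lemma continuous_fst_slice (f : plane -> R) b : continuous f ->
  continuous (fun s => f (s, b)).
Proof.
move=> cf s; have cs : (t, b) @[t --> s] --> (s, b).
  exact: (cvg_pair cvg_id (cvg_cst _)).
exact: (cvg_comp _ _ cs (cf (s, b))).
Qed.

Lemma continuous_snd_slice (f : plane -> R) a : continuous f ->
  continuous (fun t => f (a, t)).
Proof.
move=> cf s; have cs : (a, t) @[t --> s] --> (a, s).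
  exact: (cvg_pair (cvg_cst _) cvg_id).
exact: (cvg_comp _ _ cs (cf (a, s))).
Qed.

Lemma continuous_vanishing_bounded (f : plane -> R) L : continuous f ->
  (forall x, L <= `|x| -> f x = 0) -> exists M, forall x, `|f x| <= M.
Proof.
move=> cf f0; pose K : set plane := `[-L, L] `*` `[-L, L].
have cK : compact K by apply: compact_setX; exact: segment_compact.
have [K0|K0] := pselect (K !=set0); last first.
  exists 0 => x; rewrite f0 ?normr0// leNgt; apply/negP => xL; apply: K0; exists x.
  by move: xL; rewrite prod_normE gt_max !ltr_norml => /andP[/andP[? ?] /andP[? ?]];
    split; rewrite /= in_itv/=; apply/andP; split; exact: ltW.
have cnf : continuous (fun x => `|f x|).
  by move=> x; apply: continuous_comp; [exact: cf|exact: norm_continuous].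
have [c _ cmax] := compact_EVT_max K0 cK (continuous_subspaceT cnf).
exists (`|f c|) => x; have [/f0->|xL] := leP L `|x|; first by rewrite normr0.
apply: cmax; rewrite inE.
by move: xL; rewrite prod_normE gt_max !ltr_norml => /andP[/andP[? ?] /andP[? ?]];
    split; rewrite /= in_itv/=; apply/andP; split; exact: ltW.
Qed.

Lemma continuous_vanishing_integrable (f : plane -> R) L : continuous f ->
  (forall x, L <= `|x| -> f x = 0) ->
  rint setT f.
Proof.
move=> cf f0; have [M HM] := continuous_vanishing_bounded cf f0.
have oB : open [set x : plane | `|x| < L].
  have /continuousP cn := @norm_continuous _ (R * R)%type.
  exact: (cn _ (@open_lt R L)).
have mB := open_measurable_plane oB.
have Bfin : (mu2 R [set x : plane | (`|x| < L)%R] < +oo)%E.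
  by apply: (@bounded_plane_lty _ L mB).
have iB : rint setT (cst M \_ [set x : plane | `|x| < L]).
  rewrite /rintegrable -restrict_EFin; apply/(integrable_mkcond _ mB).
  apply/integrableP; split; first exact/measurable_EFinP/measurable_cst.
  rewrite (eq_integral (cst `|M|%:E))// integral_cst//.
  exact: (lte_mul_pinfty _ _ Bfin).
apply: (le_rintegrable measurableT _ iB).
  exact: continuous_measurable_plane.
move=> x _; rewrite patchE; case: ifPn => [_|]; first exact: HM.
by rewrite notin_setE/= => /negP; rewrite -leNgt => /f0 ->; rewrite normr0.
Qed.

End plane_measurability.

(** * Partial derivatives, stability of smoothness, and equality of mixed derivatives *)

Section directional_derivatives.
Variable R : realType.
Local Notation plane := (R * R)%type.
Implicit Types (f g : plane -> R) (v x : plane) (O : set plane).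

Lemma line_is_derive f v x t : derivable f (t *: v + x) v ->
  is_derive t 1 (fun s : R => f (s *: v + x)) ('D_v f (t *: v + x)).
Proof.
have E : (fun h : R => h^-1 *: (f ((h *: (1 : R) + t) *: v + x) - f (t *: v + x))) =
         (fun h : R => h^-1 *: (f (h *: v + (t *: v + x)) - f (t *: v + x))).
  by apply/funext => h; rewrite addrA -scalerDl [h *: 1]mulr1.
by move=> df; split; rewrite /derivable /derive /= E.
Qed.

Lemma basis2_0 : basis2 R ord0 = (1, 0).
Proof. by rewrite /basis2 eqxx. Qed.

Lemma basis2_1 : basis2 R (inord 1) = (0, 1).
Proof. by rewrite /basis2 -val_eqE/= inordK. Qed.

Lemma fst_slice_is_derive f a b : derivable f (a, b) (basis2 R ord0) ->
  is_derive a 1 (fun s => f (s, b)) (pderiv ord0 f (a, b)).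
Proof.
have E s : (s, b) = s *: basis2 R ord0 + (0, b).
  by rewrite basis2_0; apply/pair_equal_spec; split; rewrite /= /GRing.scale/=; ring.
rewrite /pderiv E => /line_is_derive; congr is_derive; apply/funext => s.
by rewrite -E.
Qed.

Lemma snd_slice_is_derive f a b : derivable f (a, b) (basis2 R (inord 1)) ->
  is_derive b 1 (fun s => f (a, s)) (pderiv (inord 1) f (a, b)).
Proof.
have E s : (a, s) = s *: basis2 R (inord 1) + (a, 0).
  by rewrite basis2_1; apply/pair_equal_spec; split; rewrite /= /GRing.scale/=; ring.
rewrite /pderiv E => /line_is_derive; congr is_derive; apply/funext => s.
by rewrite -E.
Qed.

Lemma derive_open_eq0 f O v x : open O -> (forall y, O y -> f y = 0) -> O x ->
  'D_v f x = 0.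
Proof.
move=> oO f0 Ox; rewrite -[RHS](derive_cst (0 : R) x v).
apply: near_eq_derive; have := open_nbhs_nbhs (conj oO Ox).
by apply: filterS => y /f0.
Qed.

Lemma pderivs_open_eq0 f O s : open O -> (forall y, O y -> f y = 0) ->
  forall x, O x -> pderivs s f x = 0.
Proof.
move=> oO f0; elim: s => [|i s IH] x Ox /=; first exact: f0.
exact: derive_open_eq0 oO IH Ox.
Qed.

Lemma smooth_pderivs f s : smooth f -> smooth (pderivs s f).
Proof. by move=> sf r; rewrite /pderivs -foldr_cat; exact: sf. Qed.

Lemma smooth_continuous f : smooth f -> continuous f.
Proof. by move=> /(_ [::]) []. Qed.

Lemma smooth_derivable f i x : smooth f -> derivable f x (basis2 R i).
Proof. by move=> /(_ [::]) []. Qed.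

Lemma smooth_pderiv f i : smooth f -> smooth (pderiv i f).
Proof. exact: (@smooth_pderivs f [:: i]). Qed.

Lemma ord2_cases (i : 'I_2) : i = ord0 \/ i = inord 1.
Proof.
by case: i => [[|[|//]] ?]; [left|right]; apply: val_inj; rewrite //= inordK.
Qed.

Lemma pderivM f g i x : derivable f x (basis2 R i) -> derivable g x (basis2 R i) ->
  pderiv i (fun y => f y * g y) x = pderiv i f x * g x + f x * pderiv i g x.
Proof.
by move=> df dg; rewrite /pderiv; apply: etrans (deriveM df dg) _; rewrite /GRing.scale/=; ring.
Qed.

Lemma pderivD f g i x : derivable f x (basis2 R i) -> derivable g x (basis2 R i) ->
  pderiv i (fun y => f y + g y) x = pderiv i f x + pderiv i g x.
Proof. by move=> df dg; exact: deriveD. Qed.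

Lemma pderivZ f c i x : derivable f x (basis2 R i) ->
  pderiv i (fun y => c * f y) x = c * pderiv i f x.
Proof. by move=> df; exact: (deriveZ c df). Qed.

Lemma pderivsD f g s : smooth f -> smooth g ->
  pderivs s (fun y => f y + g y) = (fun y => pderivs s f y + pderivs s g y).
Proof.
move=> sf sg; elim: s => //= i s ->; apply/funext => x.
by rewrite pderivD//; [exact: (sf s).2|exact: (sg s).2].
Qed.

Lemma pderivsZ f c s : smooth f ->
  pderivs s (fun y => c * f y) = (fun y => c * pderivs s f y).
Proof.
move=> sf; elim: s => //= i s ->; apply/funext => x.
by rewrite pderivZ//; exact: (sf s).2.
Qed.

Lemma smoothD f g : smooth f -> smooth g -> smooth (fun y => f y + g y).
Proof.
move=> sf sg s; rewrite pderivsD//; split=> [x|i x].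
  by apply: continuousD; [exact: (sf s).1|exact: (sg s).1].
by apply: derivableD; [exact: (sf s).2|exact: (sg s).2].
Qed.

Lemma smoothZ f c : smooth f -> smooth (fun y => c * f y).
Proof.
move=> sf s; rewrite pderivsZ//; split=> [x|i x].
  by apply: continuousM; [exact: cvg_cst|exact: (sf s).1].
by apply: derivableZ; exact: (sf s).2.
Qed.

(** Smoothness is the greatest class of continuous functions that have partial derivatives in the
    class. Exhibiting such a class replaces a formula for iterated derivatives. *)
Lemma smooth_coind (P : (plane -> R) -> Prop) :
  (forall f, P f -> [/\ continuous f, forall i x, derivable f x (basis2 R i)
     & forall i, P (pderiv i f)]) ->
  forall f, P f -> smooth f.
Proof.
move=> HP f Pf s.
suff /HP[] : P (pderivs s f) by [].
by elim: s => //= i s /HP[].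
Qed.

(** The derivative of a product is a sum of products, so a class of products is stable under
    differentiation only together with sums. *)
Inductive product_closure : (plane -> R) -> Prop :=
| PC_smooth f : smooth f -> product_closure f
| PC_add f g : product_closure f -> product_closure g ->
    product_closure (fun y => f y + g y)
| PC_mul f g : product_closure f -> product_closure g ->
    product_closure (fun y => f y * g y).

Lemma smoothM f g : smooth f -> smooth g -> smooth (fun y => f y * g y).
Proof.
move=> sf sg; apply: (@smooth_coind product_closure); last first.
  by apply: PC_mul; exact: PC_smooth.
move=> {sf sg}h; elim=> {f g h} [f sf|f g _ [cf df pf] _ [cg dg pg]|f g Pf [cf df pf] Pg [cg dg pg]].
- split=> [|i x|i]; [exact: smooth_continuous|exact: smooth_derivable|].
  exact/PC_smooth/smooth_pderiv.
- split=> [x|i x|i].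
  + by apply: continuousD; [exact: cf|exact: cg].
  + by apply: derivableD.
  + rewrite (_ : pderiv i _ = fun y => pderiv i f y + pderiv i g y); first exact: PC_add.
    by apply/funext => x; rewrite pderivD.
- split=> [x|i x|i].
  + by apply: continuousM; [exact: cf|exact: cg].
  + by apply: derivableM.
  + rewrite (_ : pderiv i _ = fun y => pderiv i f y * g y + f y * pderiv i g y).
      by apply: PC_add; exact: PC_mul.
    by apply/funext => x; rewrite pderivM.
Qed.

Lemma smooth_cst c : smooth (fun=> c : R).
Proof.
suff H s : exists c', pderivs s (fun=> c : R) = cst c'.
  move=> s; have [c' ->] := H s.
  by split=> [x|i x]; [exact: cvg_cst|exact: derivable_cst].
elim: s => [|i s [c' E]]; first by exists c.
by exists 0; apply/funext => x /=; rewrite E /pderiv derive_cst.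
Qed.

Lemma mean_value_fst f a b h : continuous f ->
  (forall x, derivable f x (basis2 R ord0)) -> 0 < h ->
  exists2 c, a < c < a + h & f (a + h, b) - f (a, b) = pderiv ord0 f (c, b) * h.
Proof.
move=> cf df h0; have aah : a < a + h by rewrite ltrDl.
have := @MVT _ (fun s => f (s, b)) (fun s => pderiv ord0 f (s, b)) _ _ aah.
case=> [s _||c]; first exact/fst_slice_is_derive.
- exact/continuous_subspaceT/continuous_fst_slice.
- by rewrite in_itv/= => cab ->; exists c => //; rewrite addrAC subrr add0r.
Qed.

Lemma mean_value_snd f a b h : continuous f ->
  (forall x, derivable f x (basis2 R (inord 1))) -> 0 < h ->
  exists2 c, b < c < b + h & f (a, b + h) - f (a, b) = pderiv (inord 1) f (a, c) * h.
Proof.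
move=> cf df h0; have aah : b < b + h by rewrite ltrDl.
have := @MVT _ (fun s => f (a, s)) (fun s => pderiv (inord 1) f (a, s)) _ _ aah.
case=> [s _||c]; first exact/snd_slice_is_derive.
- exact/continuous_subspaceT/continuous_snd_slice.
- by rewrite in_itv/= => cab ->; exists c => //; rewrite addrAC subrr add0r.
Qed.

Lemma pderivs_translate v f s :
  pderivs s (fun x => f (x + v)) = fun x => pderivs s f (x + v).
Proof.
elim: s => //= i s ->; apply/funext => x; rewrite /pderiv /derive.
by under eq_fun do rewrite /= -addrA.
Qed.

Lemma smooth_translate f v : smooth f -> smooth (fun x => f (x + v)).
Proof.
move=> sf s; rewrite pderivs_translate; split=> [x|i x].
  have /= := (sf s).1 (x + v); apply: cvg_comp.
  by apply: cvgD; [exact: cvg_id|exact: cvg_cst].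
have := (sf s).2 i (x + v); rewrite /derivable.
by under eq_fun do rewrite /= addrA.
Qed.

Lemma continuous_close f x e : continuous f -> 0 < e ->
  exists2 r, 0 < r & forall y, `|y.1 - x.1| < r -> `|y.2 - x.2| < r ->
    `|f y - f x| < e.
Proof.
move=> cf e0; have := cf x; move=> /cvgrPdist_lt/(_ e e0)/nbhs_ballP[r /= r0 H].
by exists r => // y y1 y2; rewrite distrC; apply: H; split; rewrite /ball/= distrC.
Qed.

Lemma continuous_eq_of_near (A B : plane -> R) a b : continuous A -> continuous B ->
  (forall h : R, 0 < h -> exists p q : plane,
    [/\ `|p.1 - a| < h /\ `|p.2 - b| < h, `|q.1 - a| < h /\ `|q.2 - b| < h & A p = B q]) ->
  A (a, b) = B (a, b).
Proof.
move=> cA cB key; apply/eqP; rewrite -subr_eq0; apply/negPn/negP => AB.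
have e0 : 0 < `|A (a, b) - B (a, b)| / 2 by rewrite divr_gt0// normr_gt0.
have [r1 r10 H1] := continuous_close (a, b) cA e0.
have [r2 r20 H2] := continuous_close (a, b) cB e0.
have m0 : 0 < Num.min r1 r2 by rewrite lt_min r10.
have [p [q []]] := key _ m0; rewrite !lt_min.
move=> [/andP[p1 _] /andP[p2 _]] [/andP[_ q1] /andP[_ q2]] E.
have := H1 p p1 p2; have := H2 q q1 q2; rewrite -E => Bq Ap.
have := ler_normB (A p - B (a, b)) (A p - A (a, b)).
rewrite (_ : A p - B (a, b) - (A p - A (a, b)) = A (a, b) - B (a, b)); last by ring.
by move=> H; move: (le_lt_trans H (ltrD Bq Ap)); rewrite -splitr ltxx.
Qed.

Lemma ltr_dist_right (z y h : R) : z < y -> y < z + h -> `|y - z| < h.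
Proof. by move=> zy yzh; rewrite ltr_norml; apply/andP; split; lra. Qed.

Lemma pderiv_difference f i x v : smooth f ->
  pderiv i (fun x => f (x + v) + (-1) * f x) x =
  pderiv i f (x + v) + (-1) * pderiv i f x.
Proof.
move=> sf; have sv := smooth_translate v sf.
rewrite (pderivD (smooth_derivable sv) (smooth_derivable (smoothZ (-1) sf))).
rewrite (pderivZ (-1) (smooth_derivable sf)).
congr (_ + _); exact: (congr1 (fun g => g x) (pderivs_translate v f [:: i])).
Qed.

(* Both mixed derivatives are limits of the same second difference quotient. *)
Lemma clairaut f x : smooth f ->
  pderiv ord0 (pderiv (inord 1) f) x = pderiv (inord 1) (pderiv ord0 f) x.
Proof.
case: x => a b sf; apply: continuous_eq_of_near.
- exact: (smooth_continuous (smooth_pderiv _ (smooth_pderiv _ sf))).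
- exact: (smooth_continuous (smooth_pderiv _ (smooth_pderiv _ sf))).
move=> h h0.
(* The increment of [g1] in the first variable and that of [g2] in the second are the same second
   difference of [f]; two mean value theorems turn each into h^2 times a mixed derivative at a
   nearby point. *)
pose g1 x := f (x + (0, h)) + (-1) * f x.
pose g2 x := f (x + (h, 0)) + (-1) * f x.
have s1 : smooth g1 by exact: (smoothD (smooth_translate _ sf) (smoothZ _ sf)).
have s2 : smooth g2 by exact: (smoothD (smooth_translate _ sf) (smoothZ _ sf)).
have sp i := smooth_pderiv i sf.
have [c1 /andP[ac1 c1a] e1] := mean_value_fst a b (smooth_continuous s1)
  (fun y => smooth_derivable s1) h0.
have [c2 /andP[bc2 c2b] e2] := mean_value_snd c1 b (smooth_continuous (sp ord0))
  (fun y => smooth_derivable (sp ord0)) h0.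
have [d1 /andP[bd1 d1b] e3] := mean_value_snd a b (smooth_continuous s2)
  (fun y => smooth_derivable s2) h0.
have [d2 /andP[ad2 d2a] e4] := mean_value_fst a d1 (smooth_continuous (sp (inord 1)))
  (fun y => smooth_derivable (sp (inord 1))) h0.
exists (d2, d1), (c1, c2); split; [by split; exact: ltr_dist_right|
  by split; exact: ltr_dist_right|].
move: e1 e3; rewrite (pderiv_difference _ _ _ sf) (pderiv_difference _ _ _ sf).
have E1 u w : (u, w) + (0, h) = (u, w + h) :> plane.
  by apply/pair_equal_spec; split=> //=; exact: addr0.
have E2 u w : (u, w) + (h, 0) = (u + h, w) :> plane.
  by apply/pair_equal_spec; split=> //=; exact: addr0.
rewrite /g1 /g2 !E1 !E2; move: e2 e4.
move: (pderiv (inord 1) _ (c1, c2)) (pderiv ord0 _ (d2, d1)) => B A.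
move: (pderiv _ _ _) (pderiv _ _ _) (pderiv _ _ _) (pderiv _ _ _) => p1 p2 p3 p4.
move: (f _) (f _) (f _) (f _) => f1 f2 f3 f4 e2 e4 e1 e3.
have h2 : h * h != 0 by rewrite mulf_neq0// gt_eqF.
apply: (mulIf h2); rewrite !mulrA -e2 -e4.
lra.
Qed.

End directional_derivatives.

(** * Integration by parts and Sobolev estimates for test functions *)

Section compactly_supported_calculus.
Variable R : realType.
Local Notation plane := (R * R)%type.
Local Notation mplane := (measurableTypeR R * measurableTypeR R)%type.
Local Notation leb := (@lebesgue_measure R).
Local Notation muP := (mu2 R : {measure set mplane -> \bar R}).
Local Notation rint := (@rintegrable _ mplane R (mu2 R)).
Local Notation sqi := (@square_integrable _ mplane R (mu2 R)).
Local Notation dt := (@dot _ mplane R (mu2 R)).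
Implicit Types (f g : plane -> R) (L : R).

Lemma ftc_interval (F F' : R -> R) a b : continuous F' ->
  (forall s : R, is_derive s 1 F (F' s)) -> a < b ->
  (\int[leb]_(s in [set` `[a, b]%R]) (F' s)%:E = (F b)%:E - (F a)%:E)%E.
Proof.
move=> cF' dF ab.
have cF : continuous F.
  move=> s; apply: differentiable_continuous; apply/derivable1_diffP.
  by have [] := dF s.
apply: continuous_FTC2 => //; first exact: continuous_subspaceT.
- split=> [x _||]; first by have [] := dF x.
  + exact/cvg_at_right_filter/cF.
  + exact/cvg_at_left_filter/cF.
- by move=> x _; rewrite derive1E; have [] := dF x.
Qed.

Lemma integral_derivative_eq0 (F F' : R -> R) L : continuous F' ->
  (forall s : R, is_derive s 1 F (F' s)) -> (forall s, L <= `|s| -> F s = 0) ->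
  (forall s, L <= `|s| -> F' s = 0) ->
  (\int[leb]_s (F' s)%:E = 0)%E.
Proof.
move=> cF' dF F0 F'0; pose M := `|L| + 1.
have LM : L <= M by rewrite /M (le_trans (ler_norm L))// lerDl.
have M0 : 0 < M by rewrite ltr_wpDl.
transitivity (\int[leb]_(s in [set` `[(- M)%R, M]%R]) (F' s)%:E)%E.
  rewrite [RHS]integral_mkcond; apply: eq_integral => s _; rewrite patchE.
  case: ifPn => //; rewrite notin_setE/= in_itv/= -ler_norml => /negP.
  by rewrite -ltNge => /ltW Ms; rewrite F'0// (le_trans LM).
rewrite (ftc_interval cF' dF); last by rewrite gtrN.
by rewrite !F0 ?normrN ?(gtr0_norm M0)// subee.
Qed.

Lemma abs_le_integral_derivative (F F' : R -> R) L a : continuous F' ->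
  (forall s : R, is_derive s 1 F (F' s)) -> (forall s, L <= `|s| -> F s = 0) ->
  (`|F a|%:E <= \int[leb]_s `|F' s|%:E)%E.
Proof.
(* The left end [- M] lies below [a] and at a place where [F] vanishes. *)
move=> cF' dF F0; pose M := `|L| + `|a| + 1.
have La := normr_ge0 L; have na := normr_ge0 a.
have LM : L <= `|- M|.
  by rewrite normrN /M ger0_norm ?addr_ge0//; have := ler_norm L; lra.
have Ma : - M < a by have := ler_norm (- a); rewrite normrN /M; lra.
have mF' : measurable_fun setT F' by exact: continuous_measurable_fun.
have -> : (`|F a|%:E = `|\int[leb]_(s in [set` `[(- M)%R, a]%R]) (F' s)%:E|)%E.
  by rewrite (ftc_interval cF' dF)// (F0 (- M))// sube0.
have mI : measurable `[- M, a]%classic by exact: measurable_itv.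
apply: (@le_trans _ _ (\int[leb]_(s in [set` `[(- M)%R, a]%R]) `|F' s|%:E)%E).
  apply: le_abse_integral => //; apply/measurable_EFinP.
  exact: measurable_funS mF'.
apply: ge0_subset_integral => //.
by apply/measurable_EFinP; exact: measurableT_comp.
Qed.

(** By Fubini, integrating first in the direction of the derivative. *)
Lemma integral_pderiv_eq0 f L i : continuous f ->
  (forall x, derivable f x (basis2 R i)) -> continuous (pderiv i f) ->
  (forall x, L <= `|x| -> f x = 0) -> (forall x, L <= `|x| -> pderiv i f x = 0) ->
  \int[muP]_(x in (setT : set mplane)) pderiv i f x = 0.
Proof.
move=> cf df cdf f0 df0.
have ir := continuous_vanishing_integrable cdf df0.
rewrite /Rintegral (_ : integral _ _ _ = 0%E)//.
rewrite /rintegrable /mu2 in ir.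
have [i0|i1] := ord2_cases i.
- rewrite -[LHS](integral21_prod_meas1 ir); apply: integral0_eq => b _.
  apply: (@integral_derivative_eq0 (fun s => f (s, b)) _ L).
  + exact: continuous_fst_slice.
  + by move=> s; move: df; rewrite i0 => df; exact: fst_slice_is_derive.
  + by move=> s Ls; apply: f0; rewrite prod_normE le_max Ls.
  + by move=> s Ls; apply: df0; rewrite prod_normE le_max Ls.
- rewrite -[LHS](integral12_prod_meas1 ir); apply: integral0_eq => a _.
  apply: (@integral_derivative_eq0 (fun s => f (a, s)) _ L).
  + exact: continuous_snd_slice.
  + by move=> s; move: df; rewrite i1 => df; exact: snd_slice_is_derive.
  + by move=> s Ls; apply: f0; rewrite prod_normE le_max Ls orbT.
  + by move=> s Ls; apply: df0; rewrite prod_normE le_max Ls orbT.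
Qed.

(** The fundamental theorem of calculus, twice: |f(a, b)| is at most the integral of |d_1 f(s, b)|
    over s, and each of these values is at most the integral of |d_2 d_1 f(s, t)| over t. Tonelli
    joins the two integrals. *)
Lemma sobolev_mixed f L x : smooth f -> (forall x, L <= `|x| -> f x = 0) ->
  (forall x, L <= `|x| -> pderiv ord0 f x = 0) ->
  (`|f x|%:E <= \int[muP]_(y in (setT : set mplane)) `|pderiv (inord 1) (pderiv ord0 f) y|%:E)%E.
Proof.
case: x => a b sf f0 df0.
set g := pderiv ord0 f; have sg : smooth g by exact: smooth_pderiv.
have cg := smooth_continuous sg.
have sh := smooth_pderiv (inord 1) sg; have ch := smooth_continuous sh.
have mh : measurable_fun (setT : set mplane) (fun y => `|pderiv (inord 1) g y|%:E).
  apply/measurable_EFinP; apply: measurableT_comp => //.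
  exact: continuous_measurable_plane.
have -> : (\int[muP]_(y in (setT : set mplane)) `|pderiv (inord 1) g y|%:E =
    \int[leb]_s fubini_F leb (fun y : mplane => `|pderiv (inord 1) g y|%:E) s)%E.
  pose G (y : mplane) := (`|pderiv (inord 1) g y|%:E)%E.
  have G0 y : (0 <= G y)%E by rewrite lee_fin.
  exact: (@fubini_tonelli1 _ _ _ _ R leb leb G mh G0).
apply: (@le_trans _ _ (\int[leb]_s `|g (s, b)|%:E)%E).
  apply: (@abs_le_integral_derivative (fun s => f (s, b)) (fun s => g (s, b)) L).
  - exact: continuous_fst_slice.
  - by move=> s; apply: fst_slice_is_derive; exact: smooth_derivable.
  - by move=> s Ls; apply: f0; rewrite prod_normE le_max Ls.
apply: ge0_le_integral => //.
- apply/measurable_EFinP; apply: measurableT_comp => //.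
  by apply: continuous_measurable_fun; exact: continuous_fst_slice.
- exact: measurable_fun_fubini_tonelli_F.
- move=> s _.
  apply: (@abs_le_integral_derivative (fun t => g (s, t)) (fun t => pderiv (inord 1) g (s, t)) L).
  + exact: continuous_snd_slice.
  + by move=> t; apply: snd_slice_is_derive; exact: smooth_derivable.
  + by move=> t Lt; apply: df0; rewrite prod_normE le_max Lt orbT.
Qed.

Implicit Types (U V : set plane) (phi psi : plane -> R) (s : seq 'I_2).

Lemma test_smooth U phi : test U phi -> smooth phi.
Proof. by case. Qed.

Lemma test_support_eq0 U phi s x : test U phi ->
  ~ closure [set y | phi y != 0] x -> pderivs s phi x = 0.
Proof.
move=> _; apply: (@pderivs_open_eq0 _ _ (~` closure [set y | phi y != 0])).
  by apply: closed_openC; exact: closed_closure.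
move=> y /= ny; apply/eqP/negPn/negP => py; apply: ny.
exact: subset_closure.
Qed.

Lemma test_eq0 U phi s x : test U phi -> ~ U x -> pderivs s phi x = 0.
Proof. by move=> tp Ux; apply: (test_support_eq0 _ tp) => /(let: And3 _ _ H := tp in H x). Qed.

Lemma test_off U phi x : test U phi -> ~ U x -> phi x = 0.
Proof. exact: (@test_eq0 U phi [::]). Qed.

Lemma test_bounded U phi : test U phi ->
  exists L, forall s x, L <= `|x| -> pderivs s phi x = 0.
Proof.
move=> tp; have [_ cp _] := tp.
have [M [_ HM]] := compact_bounded cp.
exists (`|M| + 2) => s x Lx; apply: (test_support_eq0 _ tp) => cx.
have /= := HM (`|M| + 1) ltac:(by have := ler_norm M; lra) x cx.
by move=> /(le_trans Lx); rewrite lerD2l; lra.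
Qed.

(** One criterion for derivatives and multiples alike: off the support of [phi] all its derivatives
    vanish, hence so does [psi], and the support can only shrink. *)
Lemma test_sub_support U phi psi : test U phi -> smooth psi ->
  (forall x, phi x = 0 -> (forall s, pderivs s phi x = 0) -> psi x = 0) -> test U psi.
Proof.
move=> tp sp H; have [_ cp pU] := tp.
have sub : closure [set x | psi x != 0] `<=` closure [set x | phi x != 0].
  rewrite [X in _ `<=` X](closure_id _).1; last exact: closed_closure.
  apply: closureS => x /= /eqP px; apply: contrapT => nx; apply: px.
  apply: H => [|s]; first exact: (test_support_eq0 [::] tp nx).
  exact: (test_support_eq0 s tp nx).
split=> // [|x /sub /pU//].
by apply: subclosed_compact cp sub; exact: closed_closure.
Qed.

Lemma test_pderiv U phi i : test U phi -> test U (pderiv i phi).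
Proof.
move=> tp; apply: (test_sub_support tp); first exact/smooth_pderiv/(test_smooth tp).
by move=> x _ /(_ [:: i]).
Qed.

Lemma testZ U phi c : test U phi -> test U (fun x => c * phi x).
Proof.
move=> tp; apply: (test_sub_support tp); first exact/smoothZ/(test_smooth tp).
by move=> x -> _; rewrite mulr0.
Qed.

Lemma testD U phi psi : test U phi -> test U psi -> test U (fun x => phi x + psi x).
Proof.
move=> [sp cp pU] [sq cq qU].
have sub : closure [set x | phi x + psi x != 0] `<=`
    closure [set x | phi x != 0] `|` closure [set x | psi x != 0].
  rewrite -closureU; apply: closureS => x /= H; apply/orP; apply: contraNT H.
  by rewrite negb_or !negbK => /andP[/eqP-> /eqP->]; rewrite addr0.
split; [exact: smoothD| |by move=> x /sub[/pU|/qU]].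
apply: subclosed_compact sub; first exact: closed_closure.
exact: compactU.
Qed.

Lemma test0 U : test U (fun=> 0).
Proof.
have E : [set x : plane | (0 : R) != 0] = set0 by apply/seteqP; split=> x //=; rewrite eqxx.
split; [exact: smooth_cst|rewrite E closure0; exact: compact0|by rewrite E closure0].
Qed.

Lemma smooth_measurable U f : measurable (U : set mplane) -> smooth f ->
  measurable_fun (U : set mplane) f.
Proof. by move=> mU sf; apply: continuous_measurable_plane => //; exact: smooth_continuous. Qed.

Lemma test_integrable U V phi f : measurable (V : set mplane) -> test U phi ->
  continuous f -> rint V (fun x => f x * phi x).
Proof.
move=> mV tp cf; have [L HL] := test_bounded tp; have HL0 : forall x, L <= `|x| -> phi x = 0 := HL [::].
apply: (integrableS measurableT mV (@subsetT _ _)).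
apply: (@continuous_vanishing_integrable _ _ L).
  by move=> x; apply: continuousM; [exact: cf|exact: (smooth_continuous (test_smooth tp))].
by move=> x Lx; rewrite (HL0 x Lx) mulr0.
Qed.

Lemma test_square_integrable U V phi : measurable (V : set mplane) ->
  test U phi -> sqi V phi.
Proof.
move=> mV tp; split; first exact: smooth_measurable (test_smooth tp).
have := test_integrable mV tp (smooth_continuous (test_smooth tp)).
by apply: eq_integrable => // x _ /=; rewrite expr2.
Qed.

Lemma dot_setT U f g : (forall x, ~ U x -> f x * g x = 0) -> dt U f g = dt setT f g.
Proof.
move=> fg; rewrite /dot Rintegral_mkcond; apply: eq_Rintegral => x _.
by rewrite patchE; case: ifPn => //; rewrite notin_setE => /fg ->.
Qed.

(** The product [phi * f] has bounded support, so its derivative integrates to zero over the plane;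
    both integrands vanish off [U], whatever its boundary looks like. *)
Lemma integration_by_parts_plane U phi f i : test U phi -> smooth f ->
  dt U phi (pderiv i f) = - dt U (pderiv i phi) f.
Proof.
move=> tp sf; have [L HL] := test_bounded tp; have sp := test_smooth tp.
have HL0 : forall x, L <= `|x| -> phi x = 0 := HL [::].
rewrite !dot_setT; last first.
- by move=> x Ux; rewrite (test_off tp Ux) mul0r.
- by move=> x Ux; rewrite (test_off (test_pderiv i tp) Ux) mul0r.
have := @integral_pderiv_eq0 (fun x => phi x * f x) L i.
have sm := smoothM sp sf.
have E : pderiv i (fun x => phi x * f x) = fun x => pderiv i phi x * f x + phi x * pderiv i f x.
  by apply/funext => x; rewrite pderivM//; exact: smooth_derivable.
move=> /(_ (smooth_continuous sm)); rewrite E => H.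
apply/eqP; rewrite -subr_eq0 opprK addrC; apply/eqP.
rewrite /dot -RintegralD//.
- apply: H; first by move=> x; exact: smooth_derivable.
  + by rewrite -E; exact: (smooth_continuous (smooth_pderiv i sm)).
  + by move=> x Lx; rewrite (HL0 _ Lx) mul0r.
  + by move=> x Lx; rewrite (HL0 _ Lx) (HL [:: i] _ Lx : pderiv i phi x = 0) !mul0r addr0.
- have := test_integrable measurableT (test_pderiv i tp) (smooth_continuous sf).
  by apply: eq_integrable => // x _ /=; rewrite mulrC.
- have := test_integrable measurableT tp (smooth_continuous (smooth_pderiv i sf)).
  by apply: eq_integrable => // x _ /=; rewrite mulrC.
Qed.

Section bounded_domain.
Variables (Om : set plane) (oOm : open Om) (Om_fin : (mu2 R Om < +oo)%E).
Let mOm : measurable (Om : set mplane) := open_measurable_plane oOm.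

(** [sobolev_mixed] followed by Cauchy--Schwarz against 1 on [Om], which costs the factor |Om|. *)
Lemma test_sup_bound phi x : test Om phi ->
  phi x ^+ 2 <= fine (mu2 R Om) * dt Om (pderiv (inord 1) (pderiv ord0 phi))
                                       (pderiv (inord 1) (pderiv ord0 phi)).
Proof.
move=> tp; have [L HL] := test_bounded tp; have sp := test_smooth tp.
have HL0 : forall x, L <= `|x| -> phi x = 0 := HL [::].
set g := pderiv (inord 1) (pderiv ord0 phi).
have tg : test Om g by exact/test_pderiv/test_pderiv.
have sg : sqi Om g by exact: test_square_integrable tg.
have sa := abs_square_integrable mOm sg.
have s1 := cst_square_integrable mOm Om_fin 1.
have i1 : rint Om (fun y => `|g y|).
  by apply: eq_integrable (square_integrable_mul mOm sa s1) => // y _ /=; rewrite mulr1.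
have le1 : `|phi x| <= dt Om (fun y => `|g y|) (fun=> 1).
  rewrite -lee_fin; apply: (le_trans (sobolev_mixed x sp (HL [::]) (HL [:: ord0]))).
  rewrite (_ : dt _ _ _ = \int[muP]_(y in (Om : set mplane)) `|g y|); last first.
    by apply: eq_Rintegral => y _; rewrite mulr1.
  rewrite /Rintegral (fineK (integrable_fin_num mOm i1)) [leRHS]integral_mkcond.
  rewrite le_eqVlt; apply/orP; left; apply/eqP/eq_integral => y _.
  rewrite patchE; case: ifPn => //; rewrite notin_setE => Oy; have g0 := test_off tg Oy.
  by move: g0; rewrite /g => ->; rewrite normr0.
have := le_trans _ (cauchy_schwarz mOm sa s1).
move=> /(_ (phi x ^+ 2)); rewrite -(real_normK (num_real (phi x))).
rewrite ler_pXn2r ?nnegrE// => [/(_ le1)|]; last first.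
  by apply: Rintegral_ge0 => y _; rewrite mulr1.
rewrite mulrC; have -> : dt Om (fun=> 1) (fun=> 1) = fine (mu2 R Om).
  by rewrite -[RHS]mul1r -Rintegral_cst//; apply: eq_Rintegral => y _; rewrite mul1r.
suff -> : dt Om (fun y => `|g y|) (fun y => `|g y|) = dt Om g g by [].
by apply: eq_Rintegral => y _; rewrite -normrM -!expr2 ger0_norm ?sqr_ge0.
Qed.

(** The pointwise bound is integrated over [Om], whence a second factor |Om|. *)
Lemma test_poincare phi : test Om phi ->
  dt Om phi phi <= fine (mu2 R Om) ^+ 2 * dt Om (pderiv (inord 1) (pderiv ord0 phi))
                                       (pderiv (inord 1) (pderiv ord0 phi)).
Proof.
move=> tp; set c := dt _ (pderiv _ _) _.
have sp : sqi Om phi by exact: test_square_integrable tp.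
have ic := cst_square_integrable mOm Om_fin (Num.sqrt (fine (mu2 R Om) * c)).
apply: (@le_trans _ _ (\int[muP]_(x in (Om : set mplane)) (fine (mu2 R Om) * c))).
  apply: le_Rintegral => //.
  - exact: (square_integrable_mul mOm sp sp).
  - apply: eq_integrable ic.2 => // x _ /=; rewrite sqr_sqrtr//.
    by rewrite mulr_ge0 ?dot_ge0// fine_ge0.
  - by move=> x _; rewrite -expr2; exact: test_sup_bound.
by rewrite Rintegral_cst// expr2 mulrAC.
Qed.

(** Interpolation: integration by parts gives ||d_i phi||^2 = - (phi, d_i d_i phi). It makes
    gradients converge once functions and second derivatives do. *)
Lemma test_gradient_bound phi i : test Om phi ->
  dt Om (pderiv i phi) (pderiv i phi) ^+ 2 <=
  dt Om phi phi * dt Om (pderiv i (pderiv i phi)) (pderiv i (pderiv i phi)).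
Proof.
move=> tp; have tp1 := test_pderiv i tp; have tp2 := test_pderiv i tp1.
rewrite -sqrrN -(integration_by_parts_plane i tp (test_smooth tp1)).
by apply: cauchy_schwarz => //;
  [exact: (test_square_integrable mOm tp)|exact: (test_square_integrable mOm tp2)].
Qed.

End bounded_domain.
End compactly_supported_calculus.

(** * Bump functions and the fundamental lemma of the calculus of variations *)

Section smooth_cutoff.
Variable R : realType.
Local Notation plane := (R * R)%type.
Local Notation coord := (@Defs.coord R).
Implicit Types (p : {poly R}) (n : nat).

(** The functions p(1/x) exp(-1/x), extended by zero. They form a class stable under
    differentiation, and p = 1 is the classical flat function. *)
Definition flat p (x : R) : R := if 0 < x then p.[x^-1] * expR (- x^-1) else 0.

(** For a positive exponent m, exp(y) = exp(y/m)^m and exp(z) >= 1 + z give y^m <= m^m exp(y). *)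
Lemma exp_dominates_pow n : exists C : R, forall y, 0 <= y -> y ^+ n * expR (- y) <= C.
Proof.
case: n => [|n]; [exists 1 => y y0|exists (n.+1%:R ^+ n.+1) => y y0].
  by rewrite expr0 mul1r -expR0 ler_expR oppr_le0.
rewrite expRN ler_pdivrMr ?expR_gt0//.
have n0 : n.+1%:R != 0 :> R by rewrite pnatr_eq0.
have -> : expR y = expR (y / n.+1%:R) ^+ n.+1.
  by rewrite -expRM_natl; congr expR; field.
have m0 : 0 <= n.+1%:R * expR (y / n.+1%:R) by rewrite mulr_ge0// expR_ge0.
rewrite -exprMn; apply: lerXn2r; [by rewrite nnegrE|by rewrite nnegrE|].
rewrite mulrC -ler_pdivrMr ?ltr0n// (le_trans _ (expR_ge1Dx _))// lerDr//.
Qed.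

Lemma exp_dominates_poly p n :
  exists C : R, forall y, 0 <= y -> `|p.[y]| * y ^+ n * expR (- y) <= C.
Proof.
elim/poly_ind: p n => [|p c IH] n.
  by exists 0 => y _; rewrite horner0 normr0 !mul0r.
have [C1 H1] := IH n.+1; have [C2 H2] := exp_dominates_pow n.
exists (C1 + `|c| * C2) => y y0; rewrite hornerMXaddC.
have en := expR_ge0 (- y); have yn := exprn_ge0 n y0.
apply: (@le_trans _ _ ((`|p.[y]| * y + `|c|) * y ^+ n * expR (- y))).
  do 2!apply: ler_wpM2r => //.
  by rewrite (le_trans (ler_normD _ _))// normrM (ger0_norm y0).
rewrite mulrDl mulrDl; apply: lerD; first by rewrite -(mulrA `|_|) -exprS; exact: H1.
by rewrite -mulrA ler_wpM2l//; exact: H2.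
Qed.

(** Boundedness of p(y) y^2 exp(-y) at y = 1/x. The quadratic decay is what makes the derivative at
    0 vanish in [flat_is_derive]. *)
Lemma flat_le_sqr p : exists C : R, forall x, `|flat p x| <= C * x ^+ 2.
Proof.
have [C HC] := exp_dominates_poly p 2.
have C0 : 0 <= C by have := HC 0 (lexx 0); rewrite expr0n/= mulr0 mul0r.
exists C => x; rewrite /flat; case: ifPn => x0; last first.
  by rewrite normr0 mulr_ge0// sqr_ge0.
rewrite normrM (ger0_norm (expR_ge0 _)).
have := HC x^-1; rewrite invr_ge0 (ltW x0) => /(_ isT).
have x2 : 0 < x ^+ 2 by rewrite exprn_gt0.
move=> H; rewrite -ler_pdivrMr//; apply: le_trans H.
by rewrite exprVn mulrAC.
Qed.

(** With y = 1/x, the chain rule gives y^2 (p(y) - p'(y)) exp(-y) for x > 0; at 0 the difference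
    quotient is O(x). *)
Lemma flat_is_derive p (x : R) :
  is_derive x 1 (flat p) (flat ('X^2 * (p - p^`())) x).
Proof.
have [x0|x0|->] := ltgtP x 0.
- have E : flat ('X^2 * (p - p^`())) x = 0 by rewrite /flat ltNge (ltW x0).
  rewrite E; have d0 : is_derive x (1 : R) (cst (0 : R)) 0 by exact: is_derive_cst.
  apply: near_eq_is_derive d0.
  near=> y; rewrite /flat ltNge (_ : y <= 0)//.
  by apply: ltW; near: y; exact: lt_nbhsl.
- have xn0 : x != 0 by rewrite gt_eqF.
  suff dy : is_derive x 1 (fun y : R => p.[y^-1] * expR (- y^-1)) (flat ('X^2 * (p - p^`())) x).
  + apply: near_eq_is_derive dy; near=> y; rewrite /flat (_ : 0 < y)//.
    by near: y; exact: lt_nbhsr.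
  + have dinv : is_derive x 1 (fun y : R => y^-1) (- x ^- 2).
      by have := @is_deriveV R id x 1 1 xn0 (is_derive_id _ _); rewrite /GRing.scale/= mulr1.
    have dp : is_derive x 1 (fun y : R => p.[y^-1]) (p^`().[x^-1] * - x ^- 2).
      exact: (@is_derive1_comp _ (horner p) (fun y => y^-1)).
    have dn : is_derive x 1 (fun y : R => - y^-1) (x ^- 2).
      by have := is_deriveN dinv; rewrite opprK.
    have de : is_derive x 1 (fun y : R => expR (- y^-1)) (expR (- x^-1) * x ^- 2).
      exact: (@is_derive1_comp _ expR (fun y => - y^-1)).
    apply: (is_derive_eq (is_deriveM dp de)).
    rewrite -[LHS]/(p.[x^-1] * (expR (- x^-1) * x ^- 2) + expR (- x^-1) * (p^`().[x^-1] * - x ^- 2)).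
    rewrite /flat x0 hornerM hornerD hornerN hornerXn exprVn.
    move: p.[x^-1] p^`().[x^-1] (expR _) (x ^- 2) => P Q E X; ring.
- rewrite /flat ltxx; have [C HC] := flat_le_sqr p.
  have E0 : flat p 0 = 0 by rewrite /flat ltxx.
  have cv : h^-1 *: (flat p (h *: (1 : R) + 0) - flat p 0) @[h --> 0^'] --> (0 : R).
    apply/cvgr0Pnorm_lt => e e0; near=> h.
    have hn0 : h != 0 by near: h; exact: nbhs_dnbhs_neq.
    rewrite E0 subr0 addr0 [h *: 1]mulr1 normrM normfV.
    rewrite mulrC ltr_pdivrMr ?normr_gt0// (le_lt_trans (HC h))//.
    rewrite -(real_normK (num_real h)) expr2 mulrA ltr_pM2r ?normr_gt0//.
    have C1 : 0 < `|C| + 1 by rewrite ltr_wpDl.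
    rewrite (le_lt_trans (ler_wpM2r (normr_ge0 h) (_ : C <= `|C| + 1)))//.
      by rewrite (le_trans (ler_norm C))// lerDl.
    rewrite mulrC -ltr_pdivlMr//; near: h.
    by apply: dnbhs0_lt; rewrite divr_gt0.
  by split; [apply/cvg_ex; exists 0|exact/cvg_lim].
Unshelve. all: by end_near.
Qed.

Lemma flat_continuous p : continuous (flat p).
Proof.
move=> x; apply: differentiable_continuous; apply/derivable1_diffP.
by have [] := flat_is_derive p x.
Qed.

Lemma coord0E : coord ord0 = fst.
Proof. by apply/funext => x; rewrite /Defs.coord eqxx. Qed.

Lemma coord1E : coord (inord 1) = snd.
Proof. by apply/funext => x; rewrite /Defs.coord -val_eqE/= inordK. Qed.

Lemma coord_continuous (i : 'I_2) : continuous (coord i).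
Proof.
by have [->|->] := ord2_cases i; rewrite (coord0E, coord1E) => x; [exact: cvg_fst|exact: cvg_snd].
Qed.

Lemma coordD i (x y : plane) : coord i (x + y) = coord i x + coord i y.
Proof. by rewrite /Defs.coord; case: ifP. Qed.

Lemma coordZ i c (x : plane) : coord i (c *: x) = c * coord i x.
Proof. by rewrite /Defs.coord; case: ifP. Qed.

Lemma coord_basis2 i j : coord i (basis2 R j) = (i == j)%:R.
Proof.
by have [->|->] := ord2_cases i; have [->|->] := ord2_cases j;
  rewrite ?basis2_0 ?basis2_1 ?coord0E ?coord1E/= -?val_eqE/= ?inordK.
Qed.

Lemma is_derive_line (f : plane -> R) x v d :
  is_derive (0 : R) 1 (fun h : R => f (h *: v + x)) d -> is_derive x v f d.
Proof.
have E : (fun h : R => h^-1 *: (f ((h *: (1 : R) + 0) *: v + x) - f (0 *: v + x))) =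
         (fun h : R => h^-1 *: (f (h *: v + x) - f x)).
  by apply/funext => h; rewrite scale0r add0r addr0 [h *: 1]mulr1.
by move=> []; rewrite /derivable /derive E => d1 d2; split.
Qed.

Lemma flat_coord_is_derive p al i b x j :
  is_derive x (basis2 R j) (fun y => flat p (al * coord i y + b))
    (al * (i == j)%:R * flat ('X^2 * (p - p^`())) (al * coord i x + b)).
Proof.
apply: is_derive_line.
have E h : al * coord i (h *: basis2 R j + x) + b
    = (al * (i == j)%:R) * h + (al * coord i x + b).
  by rewrite coordD coordZ coord_basis2; ring.
under eq_fun do rewrite E.
set k := al * (i == j)%:R; set c := al * coord i x + b.
have dl : is_derive (0 : R) 1 (fun h : R => k * h + c) k.
  have := is_deriveD (is_deriveZ k (is_derive_id (0 : R) 1)) (is_derive_cst c (0:R) 1).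
  by rewrite addr0 [k *: 1]mulr1.
have := @is_derive1_comp _ (flat p) (fun h => k * h + c) 0 _ _ (flat_is_derive p _) dl.
by rewrite mulr0 add0r mulrC.
Qed.

(** Differentiation changes only the factor and the polynomial, so the class of all multiples of
    such functions is stable under it. *)
Lemma smooth_flat_coord p al i b : smooth (fun x => flat p (al * coord i x + b)).
Proof.
apply: (@smooth_coind _ (fun f => exists c q, f = fun x => c * flat q (al * coord i x + b)));
  last by exists 1, p; apply/funext => x; rewrite mul1r.
move=> _ [c [q ->]].
have der j x := is_deriveZ c (flat_coord_is_derive q al i b x j).
split=> [x|j x|j].
- have cl : (fun y : plane => al * coord i y + b) @ x --> al * coord i x + b.
    by apply: cvgD; [apply: cvgM; [exact: cvg_cst|exact: coord_continuous]|exact: cvg_cst].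
  apply: cvgM; first exact: cvg_cst.
  exact: (cvg_comp _ _ cl (@flat_continuous q _)).
- by have [] := der j x.
- exists (c * (al * (i == j)%:R)), ('X^2 * (q - q^`())).
  apply/funext => x; rewrite /pderiv; have [_ ->] := der j x.
  exact: mulrA.
Qed.

(** For t > 0 this is exp(-1/((n+1) t)), which increases to 1 with n. It never equals 1, but it
    tends to the indicator of t > 0, and that is enough for dominated convergence. *)
Definition cutoff n (t : R) := flat 1 (n.+1%:R * t).

Lemma cutoff_ge0 n t : 0 <= cutoff n t.
Proof. by rewrite /cutoff /flat; case: ifP => // _; rewrite hornerC mul1r expR_ge0. Qed.

Lemma cutoff_le1 n t : cutoff n t <= 1.
Proof.
rewrite /cutoff /flat; case: ifP => // t0; rewrite hornerC mul1r -[leRHS]expR0 ler_expR.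
by rewrite oppr_le0 invr_ge0; exact: ltW.
Qed.

Lemma cutoff_eq0 n t : t <= 0 -> cutoff n t = 0.
Proof. by move=> t0; rewrite /cutoff /flat ltNge mulr_ge0_le0. Qed.

Lemma cutoff_cvg1 t : 0 < t -> cutoff n t @[n --> \oo] --> (1 : R).
Proof.
move=> t0.
have E : (fun n => cutoff n t) = fun n => expR (- (t^-1 * harmonic n)).
  apply/funext => n; rewrite /cutoff /flat mulr_gt0// hornerC mul1r invfM mulrC.
  by rewrite /harmonic.
rewrite E -[1]expR0; apply: continuous_cvg; first exact: continuous_expR.
rewrite -oppr0; apply: cvgN; rewrite -(mulr0 t^-1); apply: cvgM; first exact: cvg_cst.
exact: cvg_harmonic.
Qed.

(** Positive exactly on the open rectangle, and tending to its indicator. *)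
Definition bump n a b c e (x : plane) :=
  cutoff n (x.1 - a) * cutoff n (b - x.1) * (cutoff n (x.2 - c) * cutoff n (e - x.2)).

Lemma smooth_bump n a b c e : smooth (bump n a b c e).
Proof.
have s1 i u : smooth (fun x => cutoff n (coord i x - u)).
  have := smooth_flat_coord 1 n.+1%:R i (- (n.+1%:R * u)).
  by congr smooth; apply/funext => x; rewrite /cutoff mulrBr.
have s2 i u : smooth (fun x => cutoff n (u - coord i x)).
  have := smooth_flat_coord 1 (- n.+1%:R) i (n.+1%:R * u).
  by congr smooth; apply/funext => x; rewrite /cutoff mulrBr addrC mulNr.
have := (smoothM (smoothM (s1 ord0 a) (s2 ord0 b))
                (smoothM (s1 (inord 1) c) (s2 (inord 1) e))).
by rewrite coord0E coord1E.
Qed.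

Lemma bump_neq0 n a b c e x : bump n a b c e x != 0 ->
  [/\ a < x.1, x.1 < b, c < x.2 & x.2 < e].
Proof.
rewrite /bump !mulf_eq0 !negb_or => /andP[/andP[h1 h2] /andP[h3 h4]].
have H t : cutoff n t != 0 -> 0 < t.
  by rewrite ltNge; apply: contraNN => /cutoff_eq0 ->.
by split; rewrite -subr_gt0; exact: (H _).
Qed.

Lemma bump_ge0_le1 n a b c e x : 0 <= bump n a b c e x <= 1.
Proof.
rewrite /bump; apply/andP; split; first by rewrite !mulr_ge0// cutoff_ge0.
by do !(apply: mulr_ile1; rewrite ?mulr_ge0 ?cutoff_ge0 ?cutoff_le1//).
Qed.

Lemma bump_cvg1 a b c e x : a < x.1 -> x.1 < b -> c < x.2 -> x.2 < e ->
  bump n a b c e x @[n --> \oo] --> (1 : R).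
Proof.
move=> h1 h2 h3 h4; rewrite -[1]mulr1 -{1}[1]mulr1 -{3}[1]mulr1.
by apply: cvgM; apply: cvgM; apply: cutoff_cvg1; rewrite subr_gt0.
Qed.

Lemma bump_test (U : set plane) n a b c e :
  (forall x : plane, a <= x.1 <= b -> c <= x.2 <= e -> U x) -> test U (bump n a b c e).
Proof.
move=> KU; pose K : set plane := `[a, b] `*` `[c, e].
have cK : compact K by apply: compact_setX; exact: segment_compact.
have clK : closed K.
  apply: compact_closed cK; exact: norm_hausdorff.
have sK : closure [set x | bump n a b c e x != 0] `<=` K.
  rewrite [X in _ `<=` X](closure_id _).1//; apply: closureS => x /bump_neq0[? ? ? ?].
  by split; rewrite /= in_itv/=; apply/andP; split; exact: ltW.
split; first exact: smooth_bump.
  by apply: subclosed_compact cK sK; exact: closed_closure.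
by move=> x /sK[]; rewrite /= !in_itv/= => ? ?; exact: KU.
Qed.

End smooth_cutoff.

(** * The fundamental lemma of the calculus of variations *)

Section fundamental_lemma.
Variable R : realType.
Local Notation plane := (R * R)%type.
Local Notation mplane := (measurableTypeR R * measurableTypeR R)%type.
Local Notation muP := (mu2 R : {measure set mplane -> \bar R}).
Local Notation rint := (@rintegrable _ mplane R (mu2 R)).
Local Notation sqi := (@square_integrable _ mplane R (mu2 R)).
Local Notation dt := (@dot _ mplane R (mu2 R)).

Definition orect (a b c e : R) : set mplane := `]a, b[%classic `*` `]c, e[%classic.

Definition orects : set (set mplane) :=
  [set A | exists a b c e, A = orect a b c e].

Lemma measurable_orect a b c e : measurable (orect a b c e).
Proof. by apply: measurableX; exact: measurable_itv. Qed.

Lemma orectP a b c e (x : R * R) :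
  orect a b c e x <-> [/\ a < x.1, x.1 < b, c < x.2 & x.2 < e].
Proof.
rewrite /orect /setX/= !in_itv/=.
by split => [[/andP[? ?] /andP[? ?]]//|[? ? ? ?]]; split; apply/andP.
Qed.

Lemma orectI a b c e a' b' c' e' : orect a b c e `&` orect a' b' c' e' =
  orect (Num.max a a') (Num.min b b') (Num.max c c') (Num.min e e').
Proof.
apply/seteqP; split => [x [/orectP[? ? ? ?] /orectP[? ? ? ?]]|x /orectP].
  by apply/orectP; rewrite !gt_max !lt_min; split; apply/andP.
rewrite !gt_max !lt_min => -[/andP[? ?] /andP[? ?] /andP[? ?] /andP[? ?]].
by split; apply/orectP.
Qed.

(** Makes the open rectangles, which are stable under intersection, a pi-system for Dynkin
    induction. A strip is a countable union of rectangles, so both coordinates are measurable for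
    the generated sigma-algebra. *)
Lemma orects_generate : @measurable _ mplane = <<s orects >>.
Proof.
apply/seteqP; split; last first.
  apply: smallest_sub; first exact: sigma_algebra_measurable.
  by move=> _ [a [b [c [e ->]]]]; exact: measurable_orect.
pose G := g_sigma_algebraType orects.
have arch (z : R) : exists n : nat, - n%:R < z < n%:R.
  exists (Num.truncn `|z|).+1; rewrite -ltr_norml.
  by have /andP[] := truncn_itv (normr_ge0 z).
have mfst : measurable_fun (setT : set G) (fst : G -> R).
  apply: (measurability _ (RGenOpens.measurableE R)) => _ [_ [a [b ->] <-]].
  rewrite setTI; have -> : fst @^-1` `]a, b[%classic =
      \bigcup_n orect a b (- n%:R) n%:R :> set (R * R).
    apply/seteqP; split => [x /= xab|x [n _ []//]].
    by have [n nx] := arch x.2; exists n => //; split => //=; rewrite in_itv.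
  apply: bigcupT_measurable => n; apply: sub_sigma_algebra.
  by exists a, b, (- n%:R), n%:R.
have msnd : measurable_fun (setT : set G) (snd : G -> R).
  apply: (measurability _ (RGenOpens.measurableE R)) => _ [_ [a [b ->] <-]].
  rewrite setTI; have -> : snd @^-1` `]a, b[%classic =
      \bigcup_n orect (- n%:R) n%:R a b :> set (R * R).
    apply/seteqP; split => [x /= xab|x [n _ []//]].
    by have [n nx] := arch x.1; exists n => //; split => //=; rewrite in_itv.
  apply: bigcupT_measurable => n; apply: sub_sigma_algebra.
  by exists (- n%:R), n%:R, a, b.
rewrite measurable_prod_measurableType; apply: smallest_sub.
  exact: smallest_sigma_algebra.
move=> _ [A mA [B mB <-]].
rewrite (_ : A `*` B = (fst @^-1` A) `&` (snd @^-1` B))//.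
have := mfst measurableT A mA; have := msnd measurableT B mB.
by rewrite !setTI => m1 m2; exact: (@measurableI _ G _ _ m2 m1).
Qed.

(** The sets E such that [g] has zero integral over Q and E together form a Dynkin class that
    contains the rectangles. Hence [g] integrates to zero on every measurable part of Q. *)
Lemma integral_orects_eq0 a b c e (g : mplane -> R) : rint (orect a b c e) g ->
  (forall a' b' c' e', a <= a' -> b' <= b -> c <= c' -> e' <= e ->
     (\int[muP]_(x in orect a' b' c' e') (g x)%:E = 0)%E) ->
  {ae muP, forall x, orect a b c e x -> g x = 0}.
Proof.
set Q := orect a b c e => ig g0.
have mQ : measurable Q by exact: measurable_orect.
pose P (E : set mplane) := (\int[muP]_(x in Q `&` E) (g x)%:E = 0)%E.
have HP E : measurable E -> P E.
  move=> mE; have : <<s orects >> E by rewrite -orects_generate.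
  apply: (@dynkin_induction _ _ orects P).
  - exact: orects_generate.
  - move=> _ _ [a1 [b1 [c1 [e1 ->]]]] [a2 [b2 [c2 [e2 ->]]]].
    by rewrite orectI; do 4!eexists.
  - by rewrite /P setIT; exact: g0.
  - move=> _ [a1 [b1 [c1 [e1 ->]]]]; rewrite /P orectI.
    by apply: g0; rewrite ?le_max ?ge_min ?lexx.
  - move=> S mS PS; rewrite /P -setDE.
    have mQS : measurable (Q `&` S) by exact: measurableI.
    have mQD : measurable (Q `\` S) by exact: measurableD.
    have QE : (Q `&` S) `|` (Q `\` S) = Q by exact: setUIDK.
    have := @integral_setU _ _ _ muP (Q `&` S) (Q `\` S) (EFin \o g) mQS mQD.
    rewrite QE PS add0e => <-; last 2 first.
    + exact: measurable_int ig.
    + by apply/disj_setPS => x [[_ ?] []].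
    + by apply: g0.
  - move=> F mF tF PF; rewrite /P setI_bigcupr integral_bigcup.
    + by apply: eseries0 => n _ _; exact: PF.
    + exact: trivIset_setIl.
    + by move=> k; exact: measurableI.
    + apply: integrableS ig => //; last by rewrite -setI_bigcupr; exact: subIsetl.
      by apply: bigcupT_measurable => k; exact: measurableI.
have := @integral_ae_eq _ _ _ muP Q mQ (cst 0%E) (EFin \o g) ig (measurable_cst _).
case=> [E EQ mE|].
  by rewrite integral_cst// mul0e -(setIidr EQ); exact: HP.
by move=> N [mN N0 sub]; exists N; split => // x /= Hx; apply: sub => /= H; apply: Hx => /H[].
Qed.

(** Dominated convergence along the bumps of the rectangle. The closed rectangle has to lie in [U]
    for the bumps to be test functions of [U]. *)
Lemma integral_orect_test_eq0 (U : set plane) (g : plane -> R) a b c e :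
  rint (orect a b c e) g -> (forall phi, test U phi -> dt U g phi = 0) ->
  (forall x : plane, a <= x.1 <= b -> c <= x.2 <= e -> U x) ->
  (\int[muP]_(x in orect a b c e) (g x)%:E = 0)%E.
Proof.
set Q := orect a b c e => ig g0 KU.
have mQ : measurable Q by exact: measurable_orect.
have mg := rintegrable_measurable ig.
have QU : Q `<=` U by move=> x /orectP[? ? ? ?]; apply: KU; apply/andP; split; exact: ltW.
pose phi n := bump n a b c e.
have tphi n : test U (phi n) by exact: bump_test.
have mphi n : measurable_fun Q (phi n).
  by apply: smooth_measurable => //; exact: smooth_bump.
pose F n (x : mplane) := (g x * phi n x)%:E.
have ign n : rint Q (fun x => g x * phi n x).
  apply: (le_rintegrable mQ _ (integrable_norm ig)).
    exact: measurable_funM.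
  move=> x _; rewrite normrM; apply: ler_piMr => //.
  by have /andP[? ?] := bump_ge0_le1 n a b c e x; rewrite ger0_norm.
have F0 n : (\int[muP]_(x in Q) F n x = 0)%E.
  rewrite -(fineK (integrable_fin_num mQ (ign n))).
  have := g0 _ (tphi n); rewrite /dot Rintegral_mkcond => H.
  congr EFin; rewrite -[RHS]H -[LHS]/(\int[muP]_(x in Q) (g x * phi n x)).
  rewrite [LHS]Rintegral_mkcond; apply: eq_Rintegral => x _; rewrite !patchE.
  case: ifPn => [|]; rewrite (inE, notin_setE) => Qx.
    by rewrite mem_set//; exact: QU.
  case: ifP => // _; have [->|/bump_neq0 H'] := eqVneq (phi n x) 0.
    by rewrite mulr0.
  by exfalso; apply: Qx; exact/orectP.
have := @dominated_convergence _ _ _ muP Q mQ F (EFin \o g) (fun x => `|g x|%:E).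
case=> //.
- by move=> n; apply/measurable_EFinP; exact: measurable_funM.
- exact/measurable_EFinP.
- apply: aeW => x /orectP[? ? ? ?]; apply: cvg_EFin; first exact: nearW.
  rewrite -[X in _ --> X]mulr1; apply: cvgM; first exact: cvg_cst.
  exact: bump_cvg1.
- exact: integrable_norm ig.
- apply: aeW => x n _; rewrite lee_fin normrM; apply: ler_piMr => //.
  by have /andP[? ?] := bump_ge0_le1 n a b c e x; rewrite ger0_norm.
- move=> _ _ H.
  have : (fun n => \int[muP]_(x in Q) F n x)%E @ \oo --> 0%E.
    by under eq_fun do rewrite F0; exact: cvg_cst.
  by move=> /cvg_lim => <-//; apply/esym/cvg_lim.
Qed.

(** [g] vanishes almost everywhere on each rectangle whose closure lies in [U]; countably many
    rational ones cover [U], so that the exceptional null sets can be united. *)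
Lemma du_bois_reymond (U : set plane) (g : plane -> R) : open U -> sqi U g ->
  (forall phi, test U phi -> dt U g phi = 0) -> eq_ae U g (fun=> 0).
Proof.
move=> oU sg g0; have mU := open_measurable_plane oU.
pose crect (a b c e : R) : set plane := [set x | a <= x.1 <= b /\ c <= x.2 <= e].
have rect0 a b c e : crect a b c e `<=` U ->
    {ae muP, forall x, orect a b c e x -> g x = 0}.
  move=> KU.
  have mQ : measurable (orect a b c e) by exact: measurable_orect.
  have QK : orect a b c e `<=` crect a b c e.
    by move=> x /orectP[? ? ? ?]; split; apply/andP; split; exact: ltW.
  have QU : orect a b c e `<=` U by move=> x /QK /KU.
  have Qfin : (mu2 R (orect a b c e) < +oo)%E.
    apply: (@bounded_plane_lty _ _ (`|a| + `|b| + `|c| + `|e| + 1)) => // x /orectP[? ? ? ?].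
    rewrite prod_normE gt_max !ltr_norml.
    have := ler_norm a; have := ler_norm b; have := ler_norm c; have := ler_norm e.
    have := ler_norm (- a); have := ler_norm (- b); have := ler_norm (- c).
    have := ler_norm (- e); rewrite !normrN.
    have := normr_ge0 a; have := normr_ge0 b; have := normr_ge0 c; have := normr_ge0 e.
    by move=> *; apply/andP; split; apply/andP; split; lra.
  have sQ : sqi (orect a b c e) g.
    by split; [exact: measurable_funS sg.1|exact: integrableS sg.2].
  have ig : rint (orect a b c e) g.
    have := square_integrable_mul mQ sQ (cst_square_integrable mQ Qfin 1).
    by apply: eq_integrable => // x _ /=; rewrite mulr1.
  apply: integral_orects_eq0 => // a' b' c' e' aa bb cc ee.
  apply: (@integral_orect_test_eq0 U) => //.
  - apply: integrableS ig => //; first exact: measurable_orect.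
    move=> x /orectP[? ? ? ?]; apply/orectP; split.
    + exact: le_lt_trans aa _.
    + exact: lt_le_trans bb.
    + exact: le_lt_trans cc _.
    + exact: lt_le_trans ee.
  - move=> x /andP[h1 h2] /andP[h3 h4]; apply: KU; split; apply/andP; split.
    + exact: le_trans h1.
    + exact: le_trans h2 _.
    + exact: le_trans h3.
    + exact: le_trans h4 _.
(* Rational rectangles are enumerated by their codes; a number that is no code imposes no
   condition. *)
pose P (n : nat) (x : plane) := if @unpickle (rat * rat * (rat * rat))%type n is Some (a, b, (c, e))
  then crect (ratr a) (ratr b) (ratr c) (ratr e) `<=` U ->
       orect (ratr a) (ratr b) (ratr c) (ratr e) x -> g x = 0 else True.
have : {ae muP, forall x : mplane, forall n, P n x}.
  apply: ae_foralln => n; rewrite /P.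
  case: unpickle => [[[a b] [c e]]|]; last exact: aeW.
  have [KU|KU] := pselect (crect (ratr a) (ratr b) (ratr c) (ratr e) `<=` U).
    by apply: filterS (rect0 _ _ _ _ KU) => x.
  exact: aeW.
move=> HP0; suff : {ae muP, forall x : mplane, U x -> g x = 0} by [].
apply: filterS HP0 => x HP Ux.
have [r r0 rU] := open_rectangle oU Ux.
have [a] := @rat_in_itvoo _ (x.1 - r) x.1 ltac:(lra).
have [b] := @rat_in_itvoo _ x.1 (x.1 + r) ltac:(lra).
have [c] := @rat_in_itvoo _ (x.2 - r) x.2 ltac:(lra).
have [e] := @rat_in_itvoo _ x.2 (x.2 + r) ltac:(lra).
rewrite !in_itv/= => /andP[e1 e2] /andP[c1 c2] /andP[b1 b2] /andP[a1 a2].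
have := HP (pickle ((a, b), (c, e))); rewrite /P pickleK; apply.
  move=> y [/andP[? ?] /andP[? ?]]; apply: rU; rewrite ltr_norml; apply/andP; split; lra.
by apply/orectP.
Qed.

End fundamental_lemma.

Lemma Lfun2P d (T : measurableType d) (R : realType) (mu : {measure set T -> \bar R})
  (f : T -> R) : f \in Lfun mu 2%:E <-> square_integrable mu setT f.
Proof.
split=> [fL|[mf fi]].
  split; last exact: Lfun2_integrable_sqr.
  by move: fL; rewrite inE => /andP[]; rewrite inE.
rewrite inE; apply/andP; split; first by rewrite inE.
rewrite inE /finite_norm unlock/= poweR_lty//.
have /integrableP[_] := fi; apply: le_lt_trans.
rewrite le_eqVlt; apply/orP; left; apply/eqP; apply: eq_integral => x _ /=.
by rewrite powR_mulrn// normrX.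
Qed.

(** * Weak derivatives and their limits *)

Section distributions.
Variable R : realType.
Local Notation plane := (R * R)%type.
Local Notation mplane := (measurableTypeR R * measurableTypeR R)%type.
Local Notation muP := (mu2 R : {measure set mplane -> \bar R}).
Local Notation rint := (@rintegrable _ mplane R (mu2 R)).
Local Notation sqi := (@square_integrable _ mplane R (mu2 R)).
Local Notation dt := (@dot _ mplane R (mu2 R)).
Implicit Types (U : set plane) (u g : plane -> R) (t : distr R).

Lemma L2P U u : measurable (U : set mplane) -> L2 U u <-> sqi U u.
Proof.
move=> mU; rewrite /L2.
have sqE : (fun x : mplane => (u \_ U) x ^+ 2) = (fun x => u x ^+ 2) \_ U.
  by apply/funext => x; rewrite !patchE; case: ifP => // _; rewrite expr0n.
have iE : (muP).-integrable setT (EFin \o (fun x : mplane => (u \_ U) x ^+ 2)) <->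
    rint U (fun x => u x ^+ 2).
  rewrite sqE -restrict_EFin; split=> H; last exact/(integrable_mkcond _ mU).
  exact/(integrable_mkcond _ mU).
have mE : measurable_fun (setT : set mplane) (u \_ U) <-> measurable_fun (U : set mplane) u.
  have := (measurable_restrictT u mU); tauto.
split=> [/Lfun2P[um ui]|[um ui]]; first by split; [exact/mE|exact/iE].
by apply/Lfun2P; split; [exact/mE|exact/iE].
Qed.

(** The two distributions have the same set of representatives, so the choice made by [xget] is the
    same function and equality holds at every point. *)
Lemma L2rep_ext U t t' : (forall phi, test U phi -> t phi = t' phi) ->
  L2rep U t = L2rep U t'.
Proof.
move=> tt; rewrite /L2rep; congr xget; apply/seteqP.
by split=> g [Lg Hg]; split=> // phi tp; rewrite -Hg// tt.
Qed.

Lemma L2rep_spec U t g : is_L2rep U t g -> is_L2rep U t (L2rep U t).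
Proof. by move=> tg; rewrite /L2rep; case: xgetP => // H; case: (H g). Qed.

Lemma is_L2rep_unique U t g g' : open U -> is_L2rep U t g -> is_L2rep U t g' ->
  eq_ae U g g'.
Proof.
move=> oU [Lg Hg] [Lg' Hg']; have mU := open_measurable_plane oU.
move: Lg Lg' => /(L2P _ mU) sg /(L2P _ mU) sg'.
have := du_bois_reymond oU (square_integrableB mU sg sg').
have key phi : test U phi -> dt U (fun x => g x - g' x) phi = 0.
  move=> tp; rewrite dotBl//; last exact: (test_square_integrable mU tp).
  have := Hg _ tp; rewrite Hg'// => H; apply/eqP; rewrite subr_eq0; apply/eqP.
  exact: esym H.
move=> /(_ key) H; suff : {ae muP, forall x : mplane, U x -> g x = g' x} by [].
have {}H : {ae muP, forall x : mplane, U x -> g x - g' x = 0} by [].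
by apply: filterS H => x /[apply] /eqP; rewrite subr_eq0 => /eqP.
Qed.

Lemma is_L2rep_ae U t g : open U -> is_L2rep U t g ->
  {ae muP, forall x : mplane, U x -> L2rep U t x = g x}.
Proof. by move=> oU tg; apply: (is_L2rep_unique oU _ tg); exact: L2rep_spec tg. Qed.

Lemma dpart2E U i j u phi :
  dpart i (dpart j (regular U u)) phi = dt U u (pderiv j (pderiv i phi)).
Proof. by rewrite /dpart opprK. Qed.

Lemma pderiv_comm (phi : plane -> R) i j : smooth phi ->
  pderiv i (pderiv j phi) = pderiv j (pderiv i phi).
Proof.
move=> sp; have [->|->] := ord2_cases i; have [->|->] := ord2_cases j.
- exact: erefl.
- by apply/funext => x; exact: clairaut.
- by apply/funext => x; apply/esym; exact: clairaut.
- exact: erefl.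
Qed.

(* The chosen representatives of the two mixed derivatives are the same function,
   so the Hessian is symmetric at every point. *)
Lemma hess_symm U u x : symm (hess U u x).
Proof.
have E i j : L2rep U (dpart i (dpart j (regular U u))) =
    L2rep U (dpart j (dpart i (regular U u))).
  apply: L2rep_ext => phi tp.
  by rewrite !dpart2E (pderiv_comm i j (test_smooth tp)).
apply/matrixP => i j; rewrite /hess mxE mxE mxE.
exact: (congr1 (fun f => f x) (E j i)).
Qed.

Lemma in_L2_hess U u : (forall i j, in_L2 U (dpart i (dpart j (regular U u)))) ->
  forall i j, is_L2rep U (dpart i (dpart j (regular U u))) (fun x => hess U u x i j).
Proof.
move=> H i j; have [g Hg] := H i j; under eq_fun do rewrite mxE.
exact: L2rep_spec Hg.
Qed.

Lemma cvgL2_subset (U V : set plane) (f_ : nat -> plane -> R) f :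
  measurable (U : set mplane) -> measurable (V : set mplane) -> U `<=` V ->
  (forall n, sqi V (f_ n)) -> sqi V f -> cvgL2 muP V f_ f -> cvgL2 muP U f_ f.
Proof.
move=> mU mV UV sf_ sf; apply: cvg0_le => n; rewrite ger0_norm ?dot_ge0//.
have sB := square_integrableB mV (sf_ n) sf.
have ig := square_integrable_mul mV sB sB.
have igU : rint U (fun x => (f_ n x - f x) * (f_ n x - f x)).
  exact: integrableS mV mU UV ig.
rewrite -lee_fin /dot /Rintegral.
rewrite (fineK (integrable_fin_num mU igU)) (fineK (integrable_fin_num mV ig)).
apply: ge0_subset_integral => //.
  by have /integrableP[] := ig.
by move=> x _; rewrite lee_fin -expr2 sqr_ge0.
Qed.

Lemma square_integrable_subset (U V : set plane) f :
  measurable (U : set mplane) -> measurable (V : set mplane) -> U `<=` V ->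
  sqi V f -> sqi U f.
Proof.
move=> mU mV UV [mf fi]; split; first exact: measurable_funS mf.
exact: integrableS fi.
Qed.

(** Integration by parts against a fixed test function of [U] passes to the limit. As the [f_ n] are
    only asked to be smooth, this also applies on a triangle to test functions of the whole
    domain. *)
Lemma weak_derivative_limit U (f_ : nat -> plane -> R) f g i :
  open U -> (forall n, smooth (f_ n)) -> (forall n, sqi U (f_ n)) -> sqi U f ->
  (forall n, sqi U (pderiv i (f_ n))) -> sqi U g ->
  cvgL2 muP U f_ f -> cvgL2 muP U (fun n => pderiv i (f_ n)) g ->
  is_L2rep U (dpart i (regular U f)) g.
Proof.
move=> oU sm sf_ sf sdf_ sg cf cg; have mU := open_measurable_plane oU.
split; first exact/(L2P _ mU).
move=> psi tp; have tq := test_pderiv i tp.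
have c1 := cvgL2_dot mU sf_ sf (test_square_integrable mU tq) cf.
have c2 := cvgL2_dot mU sdf_ sg (test_square_integrable mU tp) cg.
have E : (fun n => dt U (pderiv i (f_ n)) psi) = (fun n => - dt U (f_ n) (pderiv i psi)).
  apply/funext => n; rewrite dotC (integration_by_parts_plane i tp (sm n)).
  by rewrite dotC.
rewrite E in c2; apply/esym.
rewrite -[LHS]/(dt U g psi) -[RHS]/(- dt U f (pderiv i psi)).
by rewrite -(cvg_lim _ c2)// -(cvg_lim _ (cvgN c1)).
Qed.

Lemma weak_derivative2_limit U (f_ : nat -> plane -> R) f g i j :
  open U -> (forall n, smooth (f_ n)) -> (forall n, sqi U (f_ n)) -> sqi U f ->
  (forall n, sqi U (pderiv i (pderiv j (f_ n)))) -> sqi U g ->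
  cvgL2 muP U f_ f -> cvgL2 muP U (fun n => pderiv i (pderiv j (f_ n))) g ->
  is_L2rep U (dpart i (dpart j (regular U f))) g.
Proof.
move=> oU sm sf_ sf sdf_ sg cf cg; have mU := open_measurable_plane oU.
split; first exact/(L2P _ mU).
move=> psi tp; have tq := test_pderiv i tp; have tr := test_pderiv j tq.
have c1 := cvgL2_dot mU sf_ sf (test_square_integrable mU tr) cf.
have c2 := cvgL2_dot mU sdf_ sg (test_square_integrable mU tp) cg.
have E : (fun n => dt U (pderiv i (pderiv j (f_ n))) psi) =
    (fun n => dt U (f_ n) (pderiv j (pderiv i psi))).
  apply/funext => n; rewrite dotC (integration_by_parts_plane i tp (smooth_pderiv j (sm n))).
  rewrite (integration_by_parts_plane j tq (sm n)) opprK.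
  by rewrite dotC.
rewrite E in c2; apply/esym; rewrite dpart2E.
by rewrite -[LHS]/(dt U g psi) -(cvg_lim _ c2)// -(cvg_lim _ c1).
Qed.

End distributions.

(** * The plate problem in the closure of the test functions *)

Section quadratic_minimization.
Variables (R : realType) (T : Type) (P : (T -> R) -> Prop).
Variables (a : (T -> R) -> (T -> R) -> R) (l : (T -> R) -> R) (c : R).
Local Notation lin u k v := (fun x => u x + k * v x).
Hypothesis Pex : exists u, P u.
Hypothesis Plin : forall u k v, P u -> P v -> P (lin u k v).
Hypothesis a_lin : forall u k v w, P u -> P v -> P w ->
  a (lin u k v) w = a u w + k * a v w.
Hypothesis a_sym : forall u v, P u -> P v -> a u v = a v u.
Hypothesis a_ge0 : forall u, P u -> 0 <= a u u.
Hypothesis l_lin : forall u k v, P u -> P v -> l (lin u k v) = l u + k * l v.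
Hypothesis c_ge0 : 0 <= c.
Hypothesis l_bounded : forall u, P u -> l u ^+ 2 <= c * a u u.

Lemma discriminant_le (d b A : R) : (forall t, 0 <= d + 2 * t * b + t ^+ 2 * A) ->
  0 <= A -> b ^+ 2 <= d * A.
Proof.
move=> H A0; have [A1|An0] := eqVneq A 0.
  have [->|bn0] := eqVneq b 0; first by rewrite A1 expr0n mulr0.
  have := H (- (d + 1) / (2 * b)); rewrite A1.
  have -> : d + 2 * (- (d + 1) / (2 * b)) * b + (- (d + 1) / (2 * b)) ^+ 2 * 0 = - 1 by field.
  by rewrite ler0N1.
have Apos : 0 < A by rewrite lt_def An0.
have := H (- b / A).
have -> : d + 2 * (- b / A) * b + (- b / A) ^+ 2 * A = (d * A - b ^+ 2) / A by field.
by rewrite pmulr_lge0 ?invr_gt0// subr_ge0.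
Qed.

(** Twice the usual energy a(u, u)/2 - l(u); its Euler equation is a(u, v) = l(v). *)
Let J u := a u u - 2 * l u.

Lemma energy_lin u k v : P u -> P v ->
  J (lin u k v) = J u + 2 * k * (a u v - l v) + k ^+ 2 * a v v.
Proof.
move=> Pu Pv; have Pw := Plin k Pu Pv.
rewrite /J l_lin// a_lin// (a_sym Pu Pw) (a_sym Pv Pw) !a_lin//.
by rewrite (a_sym Pv Pu); ring.
Qed.

(** By [l_bounded] and the inequality of arithmetic and geometric means, 2 l(u) <= 2 sqrt(c a(u, u))
    <= c + a(u, u). *)
Lemma energy_ge u : P u -> - c <= J u.
Proof.
move=> Pu; have := l_bounded Pu; have := a_ge0 Pu; rewrite /J.
set A := a u u; set L := l u => A0 LA.
have : L <= (c + A) / 2.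
  rewrite leNgt; apply/negP => H.
  have h0 : 0 <= (c + A) / 2 by rewrite divr_ge0 ?addr_ge0.
  have : ((c + A) / 2) ^+ 2 < L ^+ 2 by rewrite ltr_pXn2r ?nnegrE// ltW// (le_lt_trans h0).
  have := sqr_ge0 (c - A); nra.
by move=> H; lra.
Qed.

(* A minimizing sequence of the energy is Cauchy and solves the Euler equation
   in the limit, without any completeness assumption. *)
Lemma minimizing_sequence : exists phi : nat -> T -> R,
  [/\ forall n, P (phi n),
      forall e : R, 0 < e -> exists N, forall m n, (N <= m)%N -> (N <= n)%N ->
        a (fun x => phi m x - phi n x) (fun x => phi m x - phi n x) < e
    & forall v, P v -> (fun n => a (phi n) v) @ \oo --> l v].
Proof.
pose E := [set J u | u in P].
have E0 : E !=set0 by have [u Pu] := Pex; exists (J u), u.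
have lE : lbound E (- c) by move=> _ [u Pu <-]; exact: energy_ge.
have iE : has_inf E by split=> //; exists (- c).
have J_inf u : P u -> inf E <= J u.
  by move=> Pu; apply: (inf_lbound (proj2 iE)); exists u.
have ex n : exists u, P u /\ J u < inf E + n.+1%:R^-1.
  have n0 : 0 < n.+1%:R^-1 :> R by rewrite invr_gt0 ltr0n.
  by have [_ [u Pu <-] Ju] := inf_adherent n0 iE; exists u.
have [phi Hphi] := choice ex.
have Pphi n : P (phi n) by case: (Hphi n).
have Jphi n : J (phi n) <= inf E + n.+1%:R^-1 by case: (Hphi n) => _ /ltW.
exists phi; split=> //.
(* The form at the difference will be bounded by twice the sum of the two excesses over the infimum,
   and this choice puts each excess below e/4. *)
- move=> e e0; pose N := (Num.truncn (4 / e)).+1.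
  have N_lt : 4 / e < N%:R by have /andP[] := truncn_itv (divr_ge0 (ler0n R 4) (ltW e0)).
  exists N => m n Nm Nn.
  have small k : (N <= k)%N -> k.+1%:R^-1 < e / 4.
    move=> Nk; rewrite -[ltRHS]invrK ltf_pV2 ?posrE ?ltr0n ?invr_gt0 ?divr_gt0//.
    rewrite invf_div (lt_le_trans N_lt)// ler_nat; exact: (leq_trans Nk).
  have Pm := Pphi m; have Pn := Pphi n.
  (* The energy at the midpoint is at least the infimum and equals the mean of the two energies
     minus a(d, d)/4, where d is the difference. *)
  have mid := J_inf _ (Plin (2^-1) Pm (Plin (-1) Pn Pm)).
  have Pd := Plin (-1) Pn Pm.
  have := energy_lin (2^-1) Pm Pd; have := energy_lin 1 Pm Pd.
  have -> : lin (phi m) 1 (lin (phi n) (-1) (phi m)) = phi n.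
    by apply/funext => x; ring.
  (* Linearity of [a] is available only for combinations [u + k * v], so the difference is written
     as the zero function [phi m - phi m] plus (-1) times combinations of that shape. *)
  have aE : a (fun x => phi m x - phi n x) (fun x => phi m x - phi n x) =
      a (lin (phi n) (-1) (phi m)) (lin (phi n) (-1) (phi m)).
    have Pmn : P (fun x => phi m x - phi n x).
      have := Plin (-1) Pm Pn; congr P; apply/funext => x; ring.
    have Ed : lin (phi n) (-1) (phi m) = lin (lin (phi m) (-1) (phi m)) (-1) (fun x => phi m x - phi n x).
      by apply/funext => x; ring.
    have Pz := Plin (-1) Pm Pm.
    have za w : P w -> a (lin (phi m) (-1) (phi m)) w = 0.
      by move=> Pw; rewrite a_lin//; ring.
    have PD := Plin (-1) Pz Pmn.
    rewrite Ed a_lin// za// (a_sym Pmn PD) a_lin// za//; ring.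
  rewrite aE; set A := a (lin _ _ _) _; set B := a (phi m) _ - _ => e1 e2.
  have := Jphi m; have := Jphi n; have := small m Nm; have := small n Nn.
  rewrite e2 in mid; move: e1 mid; move: (J (phi m)) (J (phi n)) => x y.
  rewrite expr1n => -> h1 h2 h3 h4 h5.
  have q2 : 2 * 2^-1 = 1 :> R by field.
  have q4 : 2^-1 ^+ 2 = 4^-1 :> R by field.
  move: h1; rewrite q2 q4 => h1.
  move: h1 h2 h3 h4 h5; clear.
  move: (n.+1%:R^-1) (m.+1%:R^-1) (inf E) => dn dm I0.
  move=> h1 h2 h3 h4 h5; have : A <= 2 * x - 2 * I0 + 2 * dn by lra.
  lra.
- move=> v Pv; apply: cvg_sub0; apply: cvg0_sqr.
  apply: (@cvg0_le _ _ (fun n => a v v * harmonic n)); last first.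
    exact/cvg0_mul/cvg_harmonic.
  (* The energy at [phi n + t v] stays above the infimum for every t, and [phi n] exceeds it by at
     most 1/(n+1); the discriminant of this quadratic in t bounds the squared residual by a(v,
     v)/(n+1). *)
  move=> n; rewrite ger0_norm ?sqr_ge0// mulrC; apply: discriminant_le; last exact: a_ge0.
  move=> t; have := J_inf _ (Plin t (Pphi n) Pv); rewrite energy_lin// => H.
  have := Jphi n; rewrite -lerBlDl => H'.
  rewrite /harmonic/= -addrA; apply: le_trans (lerD H' (lexx _)).
  by rewrite addrAC subr_ge0 addrA.
Qed.

End quadratic_minimization.

(** * Limits of test functions that are Cauchy in H^2 *)

Section approximation_by_tests.
Variable R : realType.
Local Notation plane := (R * R)%type.
Local Notation mplane := (measurableTypeR R * measurableTypeR R)%type.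
Local Notation muP := (mu2 R : {measure set mplane -> \bar R}).
Local Notation sqi := (@square_integrable _ mplane R (mu2 R)).
Local Notation dt := (@dot _ mplane R (mu2 R)).
Implicit Types (U : set plane) (u g : plane -> R).

Definition cauchyL2 U (f_ : nat -> plane -> R) := forall e : R, 0 < e ->
  exists N, forall m n, (N <= m)%N -> (N <= n)%N ->
  dt U (fun x => f_ m x - f_ n x) (fun x => f_ m x - f_ n x) < e.

Lemma cvgL2_ae U (f_ : nat -> plane -> R) f g : measurable (U : set mplane) ->
  (forall n, sqi U (f_ n)) -> sqi U f -> sqi U g ->
  {ae muP, forall x : mplane, U x -> f x = g x} ->
  cvgL2 muP U f_ f -> cvgL2 muP U f_ g.
Proof.
move=> mU sf_ sf sg fg; rewrite /cvgL2.
rewrite (_ : (fun n => _) = fun n => dt U (fun x => f_ n x - g x) (fun x => f_ n x - g x))//.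
apply/funext => n.
have [m1 _] := square_integrableB mU (sf_ n) sf.
have [m2 _] := square_integrableB mU (sf_ n) sg.
by apply: ae_eq_dot => //; apply: filterS fg => x H Ux; rewrite H.
Qed.

Lemma pderivs_sub s (f g : plane -> R) : smooth f -> smooth g ->
  pderivs s (fun x => f x - g x) = fun x => pderivs s f x - pderivs s g x.
Proof.
move=> sf sg; have E : (fun x => f x - g x) = fun x => f x + (-1) * g x.
  by apply/funext => x; rewrite mulN1r.
rewrite E (pderivsD s sf (smoothZ (-1) sg)).
by rewrite (pderivsZ (-1) s sg); apply/funext => x; rewrite mulN1r.
Qed.

Lemma test_sub U (f g : plane -> R) : test U f -> test U g ->
  test U (fun x => f x - g x).
Proof.
move=> tf /(@testZ _ _ _ (-1)) tg; have := testD tf tg.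
by congr test; apply/funext => x; rewrite mulN1r.
Qed.

Variables (Om : set plane) (oOm : open Om) (Om_fin : (mu2 R Om < +oo)%E).
Let mOm : measurable (Om : set mplane) := open_measurable_plane oOm.

(* This is how w in H^2_0 is used: as the H^2 limit of test functions, with its
   continuous representative extended by zero. *)
Definition H20_approx (phi : nat -> plane -> R) w :=
  [/\ forall n, test Om (phi n),
      continuous w /\ (forall x, ~ Om x -> w x = 0),
      sqi Om w /\ cvgL2 muP Om phi w,
      forall i, exists2 g, sqi Om g & cvgL2 muP Om (fun n => pderiv i (phi n)) g
    & forall i j, exists2 g, sqi Om g &
        cvgL2 muP Om (fun n => pderiv i (pderiv j (phi n))) g].

Lemma cauchy_tests_gradient (phi : nat -> plane -> R) i :
  (forall n, test Om (phi n)) -> cauchyL2 Om phi ->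
  cauchyL2 Om (fun n => pderiv i (pderiv i (phi n))) ->
  cauchyL2 Om (fun n => pderiv i (phi n)).
Proof.
move=> tp c0 c2 e e0; have [N0 H0] := c0 e e0; have [N2 H2] := c2 e e0.
exists (maxn N0 N2) => m n; rewrite !geq_max => /andP[m0 m2] /andP[n0 n2].
have tmn := test_sub (tp m) (tp n).
have sm k := test_smooth (tp k).
have := test_gradient_bound oOm i tmn.
have E1 : pderiv i (fun x => phi m x - phi n x) = fun x => pderiv i (phi m) x - pderiv i (phi n) x.
  exact: (pderivs_sub [:: i] (sm m) (sm n)).
have E2 : pderiv i (pderiv i (fun x => phi m x - phi n x)) =
    fun x => pderiv i (pderiv i (phi m)) x - pderiv i (pderiv i (phi n)) x.
  exact: (pderivs_sub [:: i; i] (sm m) (sm n)).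
rewrite E2 E1 => H.
rewrite -(@ltr_pXn2r _ 2)// ?nnegrE ?dot_ge0 ?(ltW e0)//.
apply: le_lt_trans H _; rewrite expr2.
by apply: ltr_pM; rewrite ?dot_ge0//; [exact: H0|exact: H2].
Qed.

(** The mixed derivative controls the sup norm of differences, so the sequence converges uniformly
    on the plane, and on [Om], of finite measure, also in L2 to the same [w]. Gradients and Hessians
    only get L2 limits here; these are identified as weak derivatives afterwards. *)
Lemma approx_of_cauchy (phi : nat -> plane -> R) : (forall n, test Om (phi n)) ->
  (forall i j, cauchyL2 Om (fun n => pderiv i (pderiv j (phi n)))) ->
  exists w, H20_approx phi w.
Proof.
move=> tp c2; have sm k := test_smooth (tp k).
pose M := fine (mu2 R Om); have M0 : 0 <= M by rewrite fine_ge0.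
have M1 : 0 < M + 1 by rewrite ltr_wpDl.
have ucauchy (e : R) : 0 < e -> exists N, forall m n, (N <= m)%N -> (N <= n)%N ->
    forall x, `|phi m x - phi n x| < e.
  (* [M + 1] stands in for the factor [M] of [test_sup_bound], which is only known to be
     nonnegative. *)
  move=> e0; have [|N HN] := c2 (inord 1) ord0 (e ^+ 2 / (M + 1)).
    by rewrite divr_gt0// exprn_gt0.
  exists N => m n Nm Nn x.
  have := test_sup_bound oOm Om_fin x (test_sub (tp m) (tp n)).
  have -> : pderiv (inord 1) (pderiv ord0 (fun x => phi m x - phi n x)) =
      fun x => pderiv (inord 1) (pderiv ord0 (phi m)) x - pderiv (inord 1) (pderiv ord0 (phi n)) x.
    exact: (pderivs_sub [:: inord 1; ord0] (sm m) (sm n)).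
  rewrite -/M; set A := dt _ _ _ => H.
  have A0 : 0 <= A by exact: dot_ge0.
  have AN : A * (M + 1) < e ^+ 2 by rewrite -ltr_pdivlMr//; exact: HN.
  rewrite -(@ltr_pXn2r _ 2)// ?nnegrE ?(ltW e0)// real_normK ?num_real//.
  by apply: le_lt_trans H _; nra.
have cphi x : cvgn (phi ^~ x).
  apply/cauchy_cvgP/cauchy_ballP => e e0; have [N HN] := ucauchy e e0.
  pose tail := [set phi n x | n in [set n | (N <= n)%N]].
  exists (tail, tail) => /=; first by split; exists N => // n Nn; exists n.
  by move=> _ [/= [m Nm <-] [n Nn <-]]; exact: HN.
pose w x := lim (phi ^~ x @ \oo).
have unif (e : R) : 0 < e -> exists N, forall n, (N <= n)%N -> forall x, `|phi n x - w x| <= e.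
  move=> e0; have [N HN] := ucauchy e e0; exists N => n Nn x.
  have cn : `|phi n x - phi m x| @[m --> \oo] --> `|phi n x - w x|.
    by apply: cvg_norm; apply: cvgB; [exact: cvg_cst|exact: cphi].
  rewrite -(cvg_lim _ cn)//; apply: limr_le; first by apply/cvg_ex; exists `|phi n x - w x|.
  by exists N => // m /= Nm; apply/ltW/HN.
have w0 x : ~ Om x -> w x = 0.
  move=> Ox; rewrite /w (_ : phi ^~ x = fun=> 0); first exact: lim_cst.
  by apply/funext => n; exact: (test_off (tp n) Ox).
have cw : continuous w.
  move=> x; apply/cvgrPdist_lt => e e0; have e3 : 0 < e / 4 by rewrite divr_gt0.
  have [N HN] := unif _ e3.
  have cN := smooth_continuous (sm N).
  have [r r0 Hr] := continuous_close x cN e3.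
  suff : nbhs x [set t | `|w x - w t| < e] by [].
  apply/nbhs_ballP; exists r => //= y [y1 y2].
  have := Hr y; rewrite /ball/= in y1 y2; rewrite distrC in y1; rewrite distrC in y2.
  move=> /(_ y1 y2) H1; have H2 := HN N (leqnn N) x; have H3 := HN N (leqnn N) y.
  have T1 := ler_distD (phi N x) (w x) (w y); have T2 := ler_distD (phi N y) (phi N x) (w y).
  apply: (le_lt_trans T1); rewrite distrC in H1; rewrite distrC in H2.
  apply: (le_lt_trans (lerD H2 T2)).
  apply: (@lt_le_trans _ _ (e / 4 + (e / 4 + (e / 4 + e / 4)))).
    by rewrite ltrD2l; apply: ltr_leD => //; rewrite (le_trans H3)// lerDl ltW.
  by rewrite le_eqVlt; apply/orP; left; apply/eqP; field.
have sp n : sqi Om (phi n) by exact: test_square_integrable (tp n).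
have sup_cvg (e : R) : 0 < e -> exists N, forall n, (N <= n)%N ->
    sqi Om (fun x => phi n x - w x) /\ dt Om (fun x => phi n x - w x) (fun x => phi n x - w x) < e.
  (* Chosen such that d^2 M = (e / 2) (M / (M + 1)) < e. *)
  move=> e0; pose d := Num.sqrt (e / (2 * (M + 1))).
  have d0 : 0 < d by rewrite sqrtr_gt0 divr_gt0// mulr_gt0.
  have [N HN] := unif d d0; exists N => n Nn.
  have md : measurable_fun (Om : set mplane) (fun x => phi n x - w x).
    apply: measurable_funB; first by case: (sp n).
    exact: continuous_measurable_plane.
  have [_ id] := cst_square_integrable mOm Om_fin d.
  have le2 x : `|phi n x - w x| ^+ 2 <= d ^+ 2.
    by rewrite lerXn2r ?nnegrE ?(ltW d0)//; exact: HN.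
  have sd : sqi Om (fun x => phi n x - w x).
    split=> //; apply: (le_rintegrable mOm _ id); first exact: measurable_funX.
    by move=> x _; rewrite normrX; exact: le2.
  split=> //; apply: (@le_lt_trans _ _ (\int[muP]_(x in (Om : set mplane)) (d ^+ 2))).
    apply: le_Rintegral => //; first exact: (square_integrable_mul mOm sd sd).
    by move=> x _; rewrite -expr2 -(real_normK (num_real (phi n x - w x))).
  rewrite Rintegral_cst// -/M sqr_sqrtr; last by rewrite divr_ge0// ?mulr_ge0// ltW.
  have : e / (2 * (M + 1)) * M = e / 2 * (M / (M + 1)) by field; rewrite gt_eqF.
  have : M / (M + 1) < 1 by rewrite ltr_pdivrMr// mul1r ltrDl.
  have : 0 <= M / (M + 1) by rewrite divr_ge0// ltW.
  move: (M / (M + 1)) => q q0 q1 ->; nra.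
have sw : sqi Om w.
  have [N HN] := sup_cvg 1 ltr01; have [s1 _] := HN N (leqnn N).
  apply: (square_integrable_ext mOm _ (square_integrableB mOm (sp N) s1)) => x _.
  by rewrite subKr.
have cL2 : cvgL2 muP Om phi w.
  apply/cvg0P => e e0; have [N HN] := sup_cvg e e0; exists N => n /HN[_].
  by rewrite ger0_norm// dot_ge0.
have cau : cauchyL2 Om phi.
  move=> e e0; have [|N HN] := c2 (inord 1) ord0 (e / (M ^+ 2 + 1)).
    by rewrite divr_gt0// ltr_wpDl// sqr_ge0.
  exists N => m n Nm Nn.
  have := test_poincare oOm Om_fin (test_sub (tp m) (tp n)).
  have -> : pderiv (inord 1) (pderiv ord0 (fun x => phi m x - phi n x)) =
      fun x => pderiv (inord 1) (pderiv ord0 (phi m)) x - pderiv (inord 1) (pderiv ord0 (phi n)) x.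
    exact: (pderivs_sub [:: inord 1; ord0] (sm m) (sm n)).
  rewrite -/M; have := HN m n Nm Nn; set A := dt _ (fun x => _ (_ _ (phi m)) x - _) _.
  have A0 : 0 <= A by exact: dot_ge0.
  rewrite ltr_pdivlMr ?ltr_wpDl ?sqr_ge0// => HA H; apply: le_lt_trans H _.
  by apply: le_lt_trans HA; rewrite mulrC ler_wpM2l// lerDl.
exists w; split=> //.
- move=> i; apply: (L2_complete mOm Om_fin).
    by move=> n; exact: (test_square_integrable mOm (test_pderiv i (tp n))).
  exact: cauchy_tests_gradient.
- move=> i j; apply: (L2_complete mOm Om_fin); last exact: c2.
  by move=> n; exact: (test_square_integrable mOm (test_pderiv i (test_pderiv j (tp n)))).
Qed.

End approximation_by_tests.

(** * Weak derivatives and traces of limits of test functions *)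

Section approx_consequences.
Variable R : realType.
Local Notation plane := (R * R)%type.
Local Notation mplane := (measurableTypeR R * measurableTypeR R)%type.
Local Notation muP := (mu2 R : {measure set mplane -> \bar R}).
Local Notation sqi := (@square_integrable _ mplane R (mu2 R)).
Implicit Types (U : set plane) (u g v w : plane -> R).
Variables (Om : set plane) (oOm : open Om).
Let mOm : measurable (Om : set mplane) := open_measurable_plane oOm.

Lemma ae_eq_matrix U (M N : plane -> 'M[R]_2) :
  (forall i j, {ae muP, forall x : mplane, U x -> M x i j = N x i j}) ->
  {ae muP, forall x : mplane, U x -> M x = N x}.
Proof.
move=> H.
have H2 i : {ae muP, forall x : mplane, U x -> forall j, M x i j = N x i j}.
  apply: filterS2 (H i ord0) (H i (inord 1)) => x H0 H1 Ux j.
  by have [->|->] := ord2_cases j; [exact: H0|exact: H1].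
apply: filterS2 (H2 ord0) (H2 (inord 1)) => x H0 H1 Ux; apply/matrixP => i j.
by have [->|->] := ord2_cases i; [exact: H0|exact: H1].
Qed.

Lemma cvgL2_L2norm U (f_ : nat -> plane -> R) f : cvgL2 muP U f_ f ->
  L2norm U (fun x => f_ n x - f x) @[n --> \oo] --> (0 : R).
Proof.
move=> cf; rewrite -(sqrtr0 R); apply: continuous_cvg; [exact: sqrt_continuous|exact: cf].
Qed.

Lemma boundary_notin x : boundary Om x -> ~ Om x.
Proof. by move=> [_ nO] Ox; apply: nO; have := oOm; rewrite openE; exact. Qed.

Lemma segpt_in_segment (a b : plane) (t : R) : t \in `[0, 1] -> segment a b (segpt a b t).
Proof. by move=> t01; exists t. Qed.

(* The approximating test functions vanish on the boundary, so that they
   witness a null trace. *)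
Lemma is_trace0 (phi : nat -> plane -> R) v : (forall n, test Om (phi n)) ->
  sqi Om v -> cvgL2 muP Om phi v ->
  (forall i, exists2 g, sqi Om g & cvgL2 muP Om (fun n => pderiv i (phi n)) g) ->
  is_trace Om v (cst 0).
Proof.
move=> tp sv cv dg.
have sp n := test_square_integrable mOm (tp n).
have sdp n i := test_square_integrable mOm (test_pderiv i (tp n)).
have rep i g : sqi Om g -> cvgL2 muP Om (fun n => pderiv i (phi n)) g ->
    is_L2rep Om (dpart i (regular Om v)) g.
  move=> sg cg; apply: (weak_derivative_limit oOm _ sp sv _ sg cv cg) => n.
    exact: test_smooth (tp n).
  exact: sdp.
split.
- split; first exact/(L2P _ mOm).
  by move=> i; have [g sg cg] := dg i; exists g; exact: rep.
- move=> a b _; rewrite (_ : _ \_ _ = fun=> 0).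
    by apply/Lfun2P; exact: square_integrable0.
  by apply/funext => t; rewrite patchE; case: ifP.
- exists phi; split.
  + by move=> m; exact: test_smooth (tp m).
  + exact: cvgL2_L2norm.
  + move=> i; apply: cvgL2_L2norm; have [g sg cg] := dg i.
    have rg := rep i g sg cg.
    have [Lw _] := L2rep_spec rg.
    apply: (cvgL2_ae mOm _ sg _ _ cg) => //; first exact/(L2P _ mOm).
    apply: filterS (is_L2rep_ae oOm rg) => x H Ox.
    by rewrite /weakD H.
  + move=> a b [_ ab]; rewrite (_ : (fun m => _) = fun=> 0); first exact: cvg_cst.
    apply/funext => m; rewrite (@eq_Rintegral _ _ _ _ _ (cst 0)).
      by rewrite Rintegral_cst ?mul0r//; exact: measurable_itv.
    move=> t; rewrite inE/= => t01; rewrite subr0.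
    have /ab /boundary_notin Ot := segpt_in_segment a b t01.
    by rewrite (test_off (tp m) Ot) expr0n.
Qed.

Variables (phi : nat -> plane -> R) (w : plane -> R) (Hw : H20_approx Om phi w).

Let tp n : test Om (phi n). Proof. by case: Hw. Qed.
Let sw : sqi Om w. Proof. by case: Hw => _ _ []. Qed.
Let cw : cvgL2 muP Om phi w. Proof. by case: Hw => _ _ []. Qed.

(** The L2 limit of the derivatives is taken on [Om] once, and its restriction is the weak
    derivative on any open part; [U] will be [Om] itself or an open triangle. *)
Lemma approx_gradient_rep U i : open U -> U `<=` Om ->
  [/\ sqi Om (weakD Om i w),
      cvgL2 muP Om (fun n => pderiv i (phi n)) (weakD Om i w)
    & is_L2rep U (dpart i (regular U w)) (weakD Om i w)].
Proof.
move=> oU UO; have mU := open_measurable_plane oU.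
have [_ _ _ /(_ i)[g sg cg] _] := Hw.
have rep V g' : open V -> V `<=` Om -> sqi Om g' ->
    cvgL2 muP Om (fun n => pderiv i (phi n)) g' -> is_L2rep V (dpart i (regular V w)) g'.
  move=> oV VO sg' cg'; have mV := open_measurable_plane oV.
  have S u := @square_integrable_subset _ _ _ u mV mOm VO.
  have sdp n := test_square_integrable mOm (test_pderiv i (tp n)).
  have sp n := test_square_integrable mOm (tp n).
  apply: (weak_derivative_limit oV) (cvgL2_subset mV mOm VO _ _ cw) (cvgL2_subset mV mOm VO _ _ cg') => //.
  - by move=> n; exact: test_smooth (tp n).
  - by move=> n; exact: S.
  - exact: S.
  - by move=> n; exact: S.
  - exact: S.
have r := rep _ _ oOm (fun x => id) sg cg.
have [/(L2P _ mOm) sD _] := L2rep_spec r.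
have cD : cvgL2 muP Om (fun n => pderiv i (phi n)) (weakD Om i w).
  apply: (cvgL2_ae mOm _ sg sD _ cg).
    by move=> n; exact: (test_square_integrable mOm (test_pderiv i (tp n))).
  by apply: filterS (is_L2rep_ae oOm r) => x H Ox; rewrite /weakD H.
by split=> //; exact: rep.
Qed.

Lemma approx_hessian_rep U i j : open U -> U `<=` Om ->
  [/\ sqi Om (fun x => hess Om w x i j),
      cvgL2 muP Om (fun n => pderiv i (pderiv j (phi n))) (fun x => hess Om w x i j)
    & is_L2rep U (dpart i (dpart j (regular U w))) (fun x => hess Om w x i j)].
Proof.
move=> oU UO; have mU := open_measurable_plane oU.
have [_ _ _ _ /(_ i j)[g sg cg]] := Hw.
have rep V g' : open V -> V `<=` Om -> sqi Om g' ->
    cvgL2 muP Om (fun n => pderiv i (pderiv j (phi n))) g' ->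
    is_L2rep V (dpart i (dpart j (regular V w))) g'.
  move=> oV VO sg' cg'; have mV := open_measurable_plane oV.
  have S u := @square_integrable_subset _ _ _ u mV mOm VO.
  have sdp n := test_square_integrable mOm (test_pderiv i (test_pderiv j (tp n))).
  have sp n := test_square_integrable mOm (tp n).
  apply: (weak_derivative2_limit oV) (cvgL2_subset mV mOm VO _ _ cw) (cvgL2_subset mV mOm VO _ _ cg') => //.
  - by move=> n; exact: test_smooth (tp n).
  - by move=> n; exact: S.
  - exact: S.
  - by move=> n; exact: S.
  - exact: S.
have r := rep _ _ oOm (fun x => id) sg cg.
have hE : (fun x => hess Om w x i j) = L2rep Om (dpart i (dpart j (regular Om w))).
  by apply/funext => x; rewrite mxE.
have [/(L2P _ mOm) sD _] := L2rep_spec r.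
have cD : cvgL2 muP Om (fun n => pderiv i (pderiv j (phi n))) (fun x => hess Om w x i j).
  rewrite hE; apply: (cvgL2_ae mOm _ sg sD _ cg).
    by move=> n; exact: (test_square_integrable mOm (test_pderiv i (test_pderiv j (tp n)))).
  by apply: filterS (is_L2rep_ae oOm r) => x H Ox; rewrite H.
rewrite -hE in sD.
by split=> //; exact: rep.
Qed.

Lemma approx_H2 U : open U -> U `<=` Om -> H2 U w.
Proof.
move=> oU UO; have mU := open_measurable_plane oU.
split; last first.
  by move=> i j; exists (fun x => hess Om w x i j); have [] := approx_hessian_rep i j oU UO.
split; last by move=> i; exists (weakD Om i w); have [] := approx_gradient_rep i oU UO.
by apply/(L2P _ mU); exact: (square_integrable_subset mU mOm UO).
Qed.

Lemma approx_hess_ae U : open U -> U `<=` Om ->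
  {ae muP, forall x : mplane, U x -> hess U w x = hess Om w x}.
Proof.
move=> oU UO.
apply: ae_eq_matrix => i j; have [_ _ r] := approx_hessian_rep i j oU UO.
by apply: filterS (is_L2rep_ae oU r) => x Hx Ux; rewrite [LHS]mxE Hx.
Qed.

(** Partial derivatives of test functions are test functions, so [is_trace0] applies to the gradient
    too, and null gradient traces make the normal derivative zero for any normal. *)
Lemma approx_H20 : H20 Om w.
Proof.
have id' : Om `<=` Om by [].
split; first exact: approx_H2.
  by apply: (is_trace0 tp) => // i; have [] := Hw.
exists (fun=> cst 0); split=> [i|a b _]; last first.
  by apply: aeW => t _ n _; rewrite big1// => i _; rewrite mulr0.
have [sg cg _] := approx_gradient_rep i oOm id'.
apply: (is_trace0 (fun n => test_pderiv i (tp n)) sg cg) => j.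
by exists (fun x => hess Om w x j i); have [] := approx_hessian_rep j i oOm id'.
Qed.

End approx_consequences.

(** * Square integrable tensor fields and the elasticity tensor *)

Section tensors.
Variable R : realType.
Local Notation plane := (R * R)%type.
Local Notation mplane := (measurableTypeR R * measurableTypeR R)%type.
Local Notation muP := (mu2 R : {measure set mplane -> \bar R}).
Local Notation rint := (@rintegrable _ mplane R (mu2 R)).
Local Notation sqi := (@square_integrable _ mplane R (mu2 R)).
Local Notation dt := (@dot _ mplane R (mu2 R)).
Implicit Types (U : set plane) (A B C : 'M[R]_2) (M N : plane -> 'M[R]_2).

Lemma sum_ord2 (F : 'I_2 -> R) : \sum_i F i = F ord0 + F (inord 1).
Proof.
rewrite big_ord_recl big_ord1; congr (_ + F _).
by apply: val_inj; rewrite /= inordK.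
Qed.

Lemma frobE A B : frob A B = A ord0 ord0 * B ord0 ord0 + A ord0 (inord 1) * B ord0 (inord 1) +
  (A (inord 1) ord0 * B (inord 1) ord0 + A (inord 1) (inord 1) * B (inord 1) (inord 1)).
Proof. by rewrite /frob !sum_ord2. Qed.

Lemma frobC A B : frob A B = frob B A.
Proof. by apply: eq_bigr => i _; apply: eq_bigr => j _; rewrite mulrC. Qed.

Lemma frob_linl A k B C : frob (A + k *: B) C = frob A C + k * frob B C.
Proof. by rewrite !frobE !mxE; ring. Qed.

Lemma frob_ge0 A : 0 <= frob A A.
Proof. by apply: sumr_ge0 => i _; apply: sumr_ge0 => j _; rewrite -expr2 sqr_ge0. Qed.

Lemma sqr_entry_le_frob A i j : A i j ^+ 2 <= frob A A.
Proof.
rewrite /frob (bigD1 i)//= (bigD1 j)//= -expr2 -addrA lerDl addr_ge0//.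
  by apply: sumr_ge0 => l _; rewrite -expr2 sqr_ge0.
by apply: sumr_ge0 => m _; apply: sumr_ge0 => l _; rewrite -expr2 sqr_ge0.
Qed.

Definition msqi U M := forall i j, sqi U (fun x => M x i j).

Lemma frob_integrable U M N : measurable (U : set mplane) -> msqi U M -> msqi U N ->
  rint U (fun x => frob (M x) (N x)).
Proof.
move=> mU sM sN; have P i j := square_integrable_mul mU (sM i j) (sN i j).
have := rintegrableD mU (rintegrableD mU (P ord0 ord0) (P ord0 (inord 1)))
  (rintegrableD mU (P (inord 1) ord0) (P (inord 1) (inord 1))).
by apply: eq_integrable => // x _ /=; rewrite frobE.
Qed.

Lemma tipE U M N : measurable (U : set mplane) -> msqi U M -> msqi U N ->
  tip U M N = \sum_i \sum_j dt U (fun x => M x i j) (fun x => N x i j).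
Proof.
move=> mU sM sN; have P i j := square_integrable_mul mU (sM i j) (sN i j).
have D i := rintegrableD mU (P i ord0) (P i (inord 1)).
rewrite !sum_ord2 /dot -(RintegralD mU (P _ _) (P _ _)) -(RintegralD mU (P _ _) (P _ _)).
rewrite -(RintegralD mU (D _) (D _)).
by apply: eq_Rintegral => x _; rewrite frobE.
Qed.

Lemma tipC U M N : tip U M N = tip U N M.
Proof. by apply: eq_Rintegral => x _; exact: frobC. Qed.

Lemma tip_ge0 U M : 0 <= tip U M M.
Proof. by apply: Rintegral_ge0 => x _; exact: frob_ge0. Qed.

Lemma msqi_lin U M k N : measurable (U : set mplane) -> msqi U M -> msqi U N ->
  msqi U (fun x => M x + k *: N x).
Proof.
move=> mU sM sN i j.
apply: (square_integrable_ext mU _ (square_integrableD mU (sM i j)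
  (square_integrableZ mU k (sN i j)))) => x _.
by rewrite !mxE.
Qed.

Lemma tip_linl U M k N P : measurable (U : set mplane) ->
  msqi U M -> msqi U N -> msqi U P ->
  tip U (fun x => M x + k *: N x) P = tip U M P + k * tip U N P.
Proof.
move=> mU sM sN sP; have iM := frob_integrable mU sM sP.
have iN := frob_integrable mU sN sP.
rewrite /tip -RintegralZl// -RintegralD//; last exact: rintegrableZ.
by apply: eq_Rintegral => x _; exact: frob_linl.
Qed.

Lemma dot_entry_le_tip U M i j : measurable (U : set mplane) -> msqi U M ->
  dt U (fun x => M x i j) (fun x => M x i j) <= tip U M M.
Proof.
move=> mU sM; apply: le_Rintegral => //.
- exact: (square_integrable_mul mU (sM i j) (sM i j)).
- exact: frob_integrable.
- by move=> x _; rewrite -expr2; exact: sqr_entry_le_frob.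
Qed.

Lemma ae_eq_tip U M N M' N' : measurable (U : set mplane) ->
  msqi U M -> msqi U N -> msqi U M' -> msqi U N' ->
  {ae muP, forall x : mplane, U x -> M x = M' x} ->
  {ae muP, forall x : mplane, U x -> N x = N' x} -> tip U M N = tip U M' N'.
Proof.
move=> mU sM sN sM' sN' MM NN; apply: ae_eq_Rintegral => //.
- exact: rintegrable_measurable (frob_integrable mU sM sN).
- exact: rintegrable_measurable (frob_integrable mU sM' sN').
- by apply: filterS2 MM NN => x MM NN Ux; rewrite MM ?NN.
Qed.

Lemma tip_eq0 U M : measurable (U : set mplane) -> msqi U M -> tip U M M <= 0 ->
  {ae muP, forall x : mplane, U x -> M x = 0}.
Proof.
move=> mU sM M0.
have H i j : {ae muP, forall x : mplane, U x -> M x i j = 0}.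
  apply: (dot_eq0 mU (sM i j)); apply/le_anti; rewrite dot_ge0 andbT.
  exact: le_trans (dot_entry_le_tip i j mU sM) M0.
have H2 i : {ae muP, forall x : mplane, U x -> forall j, M x i j = 0}.
  apply: filterS2 (H i ord0) (H i (inord 1)) => x H0 H1 Ux j.
  by have [->|->] := ord2_cases j; [exact: H0|exact: H1].
apply: filterS2 (H2 ord0) (H2 (inord 1)) => x H0 H1 Ux; apply/matrixP => i j.
by rewrite mxE; have [->|->] := ord2_cases i; [exact: H0|exact: H1].
Qed.

(** As the bound holds only almost everywhere, integrability passes through the minimum of f^2 and
    |g|, which is dominated at every point and equals f^2 almost everywhere. *)
Lemma square_integrable_ae_le U (f g : plane -> R) : measurable (U : set mplane) ->
  measurable_fun (U : set mplane) f -> rint U g ->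
  {ae muP, forall x : mplane, U x -> f x ^+ 2 <= g x} -> sqi U f.
Proof.
move=> mU mf ig fg; split=> //; have mg := rintegrable_measurable ig.
have mf2 : measurable_fun (U : set mplane) (fun x => f x ^+ 2) by exact: measurable_funX.
have im : rint U (fun x => Num.min (f x ^+ 2) `|g x|).
  apply: (le_rintegrable mU _ (integrable_norm ig)).
    by apply: measurable_minr => //; exact: measurableT_comp.
  move=> x _; rewrite ger0_norm ?le_min ?sqr_ge0 ?normr_ge0//.
  by rewrite ge_min lexx orbT.
apply/integrableP; split; first exact/measurable_EFinP.
have /integrableP[mm] := im; apply: le_lt_trans; apply: ae_ge0_le_integral => //.
- by apply: measurableT_comp => //; exact/measurable_EFinP.
- by apply: measurableT_comp.
- apply: filterS fg => x /[apply] H /=; rewrite lee_fin min_l//.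
  exact: le_trans H (ler_norm _).
Qed.

(** A [tensor_field] is measurable when applied to a constant symmetric matrix; expansion in a basis
    of the symmetric matrices extends this to variable ones. *)
Lemma symm_decomposition A : symm A -> A = A ord0 ord0 *: delta_mx ord0 ord0 +
  A (inord 1) (inord 1) *: delta_mx (inord 1) (inord 1) +
  A ord0 (inord 1) *: (delta_mx ord0 (inord 1) + delta_mx (inord 1) ord0).
Proof.
move=> sA; have A01 : A (inord 1) ord0 = A ord0 (inord 1) by rewrite -{1}sA mxE.
have n01 : (ord0 == inord 1 :> 'I_2) = false by rewrite -val_eqE/= inordK.
have n10 : (inord 1 == ord0 :> 'I_2) = false by rewrite eq_sym.
by apply/matrixP => i j; have [->|->] := ord2_cases i; have [->|->] := ord2_cases j;
  rewrite !mxE ?eqxx ?n01 ?n10/= ?A01; ring.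
Qed.

Lemma linear_comb3 (f : {linear 'M[R]_2 -> 'M[R]_2}) (a b c : R) A B C :
  f (a *: A + b *: B + c *: C) = a *: f A + b *: f B + c *: f C.
Proof. by rewrite !linearD !linearZ. Qed.

Section tensor_field.
Variables (Om : set plane) (Ct : plane -> {linear 'M[R]_2 -> 'M[R]_2}).
Hypothesis Ct_ok : tensor_field Om Ct.

Lemma tapply_square_integrable U M : measurable (U : set mplane) -> U `<=` Om ->
  (forall x, symm (M x)) -> msqi U M -> measurable (Om : set mplane) -> msqi U (tapply Ct M).
Proof.
move=> mU UO sM iM mOm i j; have [_ _ _ mC [k Hk]] := Ct_ok.
have mCU A : symm A -> measurable_fun (U : set mplane) (fun x => Ct x A i j).
  by move=> sA; apply: (measurable_funS mOm UO); exact: mC.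
have mM i' j' : measurable_fun (U : set mplane) (fun x => M x i' j') by case: (iM i' j').
apply: (@square_integrable_ae_le _ _ (fun x => k * frob (M x) (M x))) => //.
- have sd l : symm (delta_mx l l : 'M[R]_2).
    by apply/matrixP => a b; rewrite !mxE andbC.
  have so : symm (delta_mx ord0 (inord 1) + delta_mx (inord 1) ord0 : 'M[R]_2).
    by apply/matrixP => a b; rewrite !mxE addrC (andbC (b == inord 1)) (andbC (b == ord0)).
  apply: (@eq_measurable_fun _ _ mplane _ _ (fun x => M x ord0 ord0 * Ct x (delta_mx ord0 ord0) i j +
    M x (inord 1) (inord 1) * Ct x (delta_mx (inord 1) (inord 1)) i j +
    M x ord0 (inord 1) * Ct x (delta_mx ord0 (inord 1) + delta_mx (inord 1) ord0) i j)).
    move=> x _; rewrite /tapply [in RHS](symm_decomposition (sM x)).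
    by rewrite linear_comb3 !mxE.
  apply: measurable_funD; first apply: measurable_funD; apply: measurable_funM => //; exact: mCU.
- by apply: rintegrableZ => //; exact: frob_integrable.
- have {}Hk : {ae muP, forall x : mplane, Om x -> forall A, symm A ->
    frob (Ct x A) (Ct x A) <= k * frob A A} by [].
  apply: filterS Hk => x Hk Ux; apply: le_trans (sqr_entry_le_frob _ _ _) _.
  exact: Hk (UO _ Ux) _ (sM x).
Qed.

Lemma tapply_symm M : (forall x, symm (M x)) ->
  {ae muP, forall x : mplane, Om x -> symm (tapply Ct M x)}.
Proof.
move=> sM; have [H _ _ _ _] := Ct_ok.
have {}H : {ae muP, forall x : mplane, Om x -> forall A, symm A -> symm (Ct x A)} by [].
by apply: filterS H => x H Ox; exact: H.
Qed.

Lemma tip_tapplyC U M N : measurable (Om : set mplane) -> measurable (U : set mplane) ->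
  U `<=` Om -> (forall x, symm (M x)) -> (forall x, symm (N x)) ->
  msqi U M -> msqi U N -> tip U (tapply Ct M) N = tip U M (tapply Ct N).
Proof.
move=> mOm mU UO sM sN iM iN; have [_ H _ _ _] := Ct_ok.
have cM := tapply_square_integrable mU UO sM iM mOm.
have cN := tapply_square_integrable mU UO sN iN mOm.
apply: ae_eq_Rintegral => //.
- exact: rintegrable_measurable (frob_integrable mU cM iN).
- exact: rintegrable_measurable (frob_integrable mU iM cN).
- have {}H : {ae muP, forall x : mplane, Om x -> forall A B, symm A -> symm B ->
     frob (Ct x A) B = frob A (Ct x B)} by [].
  by apply: filterS H => x H Ux; exact: (H (UO _ Ux) _ _ (sM x) (sN x)).
Qed.

(** The constant precedes the set [U], so that the same one serves on [Om] and on the triangles of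
    every mesh. *)
Lemma tip_tapply_coercive : exists2 al : R, 0 < al & forall U M,
  measurable (Om : set mplane) -> measurable (U : set mplane) ->
  U `<=` Om -> (forall x, symm (M x)) -> msqi U M ->
  al * tip U M M <= tip U (tapply Ct M) M.
Proof.
have [_ _ [al al0 H] _ _] := Ct_ok; exists al => // U M mOm mU UO sM iM.
have cM := tapply_square_integrable mU UO sM iM mOm.
have ii := frob_integrable mU iM iM.
rewrite /tip -RintegralZl//; apply: ae_le_Rintegral => //.
- exact: rintegrableZ.
- exact: frob_integrable.
- have {}H : {ae muP, forall x : mplane, Om x -> forall A, symm A ->
     al * frob A A <= frob (Ct x A) A} by [].
  by apply: filterS H => x H Ux; exact: (H (UO _ Ux) _ (sM x)).
Qed.

Lemma tip_tapply_bounded : exists2 k : R, 0 <= k & forall U M,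
  measurable (Om : set mplane) -> measurable (U : set mplane) ->
  U `<=` Om -> (forall x, symm (M x)) -> msqi U M ->
  tip U (tapply Ct M) (tapply Ct M) <= k * tip U M M.
Proof.
have [_ _ _ _ [k H]] := Ct_ok; exists `|k| => // U M mOm mU UO sM iM.
have cM := tapply_square_integrable mU UO sM iM mOm.
have ii := frob_integrable mU iM iM.
rewrite /tip -RintegralZl//; apply: ae_le_Rintegral => //.
- exact: frob_integrable.
- exact: rintegrableZ.
- have {}H : {ae muP, forall x : mplane, Om x -> forall A, symm A ->
     frob (Ct x A) (Ct x A) <= k * frob A A} by [].
  apply: filterS H => x H Ux; apply: le_trans (H (UO _ Ux) _ (sM x)) _.
  by rewrite ler_wpM2r ?frob_ge0// ler_norm.
Qed.

End tensor_field.
End tensors.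

(** * Existence and bounds for the plate problem *)

Section plate_problem.
Variable R : realType.
Local Notation plane := (R * R)%type.
Local Notation mplane := (measurableTypeR R * measurableTypeR R)%type.
Local Notation muP := (mu2 R : {measure set mplane -> \bar R}).
Local Notation sqi := (@square_integrable _ mplane R (mu2 R)).
Local Notation dt := (@dot _ mplane R (mu2 R)).
Implicit Types (U : set plane) (M N : plane -> 'M[R]_2) (phi psi : plane -> R).

Definition test_hess phi : plane -> 'M[R]_2 :=
  fun x => \matrix_(i, j) pderiv i (pderiv j phi) x.

Lemma test_hess_symm phi x : smooth phi -> symm (test_hess phi x).
Proof.
move=> sp; apply/matrixP => i j; rewrite mxE mxE mxE.
exact: (congr1 (fun f => f x) (pderiv_comm j i sp)).
Qed.

Lemma test_hess_msqi U V phi : measurable (V : set mplane) -> test U phi ->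
  msqi V (test_hess phi).
Proof.
move=> mV tp i j.
apply: (square_integrable_ext mV _ (test_square_integrable mV (test_pderiv i (test_pderiv j tp)))).
by move=> x _; rewrite mxE.
Qed.

Lemma test_hess_lin phi k psi : smooth phi -> smooth psi ->
  test_hess (fun x => phi x + k * psi x) = fun x => test_hess phi x + k *: test_hess psi x.
Proof.
move=> sp sq; apply/funext => x; apply/matrixP => i j; rewrite !mxE.
have E1 := pderivsD [:: i; j] sp (smoothZ k sq).
have E2 := pderivsZ k [:: i; j] sq.
rewrite -[LHS]/(pderivs [:: i; j] (fun x => phi x + k * psi x) x).
by rewrite E1 E2.
Qed.

Lemma cvg_sum_ord2 (F : 'I_2 -> nat -> R) (l : 'I_2 -> R) :
  (forall i, F i @ \oo --> l i) -> (fun n => \sum_i F i n) @ \oo --> \sum_i l i.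
Proof.
move=> Fl; rewrite sum_ord2; under eq_fun do rewrite sum_ord2.
by apply: cvgD; exact: Fl.
Qed.

Lemma cvgL2_sqrnorm U (f_ : nat -> plane -> R) f : measurable (U : set mplane) ->
  (forall n, sqi U (f_ n)) -> sqi U f -> cvgL2 muP U f_ f ->
  (fun n => dt U (f_ n) (f_ n)) @ \oo --> dt U f f.
Proof.
move=> mU sf_ sf cf; have c1 := cvgL2_dot mU sf_ sf sf cf.
have E : (fun n => dt U (f_ n) (f_ n)) = fun n =>
   dt U (fun x => f_ n x - f x) (fun x => f_ n x - f x) + 2 * dt U (f_ n) f - dt U f f.
  by apply/funext => n; rewrite dot_sqrB//; ring.
have {}c1 : (fun n => 2 * dt U (f_ n) f) @ \oo --> 2 * dt U f f.
  by apply: cvgM => //; exact: cvg_cst.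
have c2 : (fun n => dt U (fun x => f_ n x - f x) (fun x => f_ n x - f x)
   + 2 * dt U (f_ n) f) @ \oo --> 0 + 2 * dt U f f by apply: cvgD.
have c3 : (fun n => dt U (fun x => f_ n x - f x) (fun x => f_ n x - f x)
   + 2 * dt U (f_ n) f - dt U f f) @ \oo --> 0 + 2 * dt U f f - dt U f f.
  by apply: cvgB => //; exact: cvg_cst.
by move: c3; rewrite E (_ : 0 + 2 * dt U f f - dt U f f = dt U f f)//; ring.
Qed.

(** The signs of the two [dpart] cancel; the derivatives come out in reverse order and are exchanged
    by equality of mixed derivatives. *)
Lemma div_divE U M phi : open U -> msqi U M -> test U phi ->
  div_div U M phi = tip U M (test_hess phi).
Proof.
move=> oU sM tp; have mU := open_measurable_plane oU.
rewrite (tipE mU sM (test_hess_msqi mU tp)).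
rewrite /div_div /distr_rowdiv /distr_div; apply: eq_bigr => i _.
rewrite /dpart -sumrN; apply: eq_bigr => j _; rewrite opprK.
rewrite /regular (pderiv_comm j i (test_smooth tp)).
by apply: eq_dot => x _ //; rewrite mxE.
Qed.

Variables (Om : set plane) (oOm : open Om) (Om_fin : (mu2 R Om < +oo)%E).
Let mOm : measurable (Om : set mplane) := open_measurable_plane oOm.
Let M0 := fine (mu2 R Om).

Lemma test_tip_poincare phi : test Om phi ->
  dt Om phi phi <= M0 ^+ 2 * tip Om (test_hess phi) (test_hess phi).
Proof.
move=> tp; apply: le_trans (test_poincare oOm Om_fin tp) _.
rewrite ler_wpM2l ?sqr_ge0//.
apply: le_trans (dot_entry_le_tip (inord 1) ord0 mOm (test_hess_msqi mOm tp)).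
rewrite le_eqVlt; apply/orP; left; apply/eqP; apply: eq_dot => x _; by rewrite mxE.
Qed.

Lemma cvg_tip_test (N_ : nat -> plane -> 'M[R]_2) N M :
  (forall n, msqi Om (N_ n)) -> msqi Om N -> msqi Om M ->
  (forall i j, cvgL2 muP Om (fun n x => N_ n x i j) (fun x => N x i j)) ->
  (fun n => tip Om (N_ n) M) @ \oo --> tip Om N M.
Proof.
move=> sN_ sN sM cN; rewrite (tipE mOm sN sM).
rewrite (_ : (fun n => _) = fun n => \sum_i \sum_j
  dt Om (fun x => N_ n x i j) (fun x => M x i j)); last first.
  by apply/funext => n; rewrite (tipE mOm (sN_ n) sM).
apply: cvg_sum_ord2 => i; apply: cvg_sum_ord2 => j.
by apply: cvgL2_dot => // n; exact: sN_.
Qed.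

Section approx.
Variables (phi : nat -> plane -> R) (w : plane -> R).
Hypothesis Hw : H20_approx Om phi w.

Lemma approx_test n : test Om (phi n).
Proof. by case: Hw. Qed.

Lemma approx_sqi : sqi Om w.
Proof. by case: Hw => _ _ []. Qed.

Lemma approx_cvg : cvgL2 muP Om phi w.
Proof. by case: Hw => _ _ []. Qed.

Lemma approx_hess_msqi : msqi Om (hess Om w).
Proof. by move=> i j; have [] := approx_hessian_rep oOm Hw i j oOm (fun x => id). Qed.

Lemma approx_hess_cvg i j :
  cvgL2 muP Om (fun n x => test_hess (phi n) x i j) (fun x => hess Om w x i j).
Proof.
have [_ + _] := approx_hessian_rep oOm Hw i j oOm (fun x => id).
rewrite (_ : (fun n x => test_hess (phi n) x i j) = fun n => pderiv i (pderiv j (phi n)))//.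
by apply/funext => n; apply/funext => x; rewrite mxE.
Qed.

Lemma approx_tip_cvg M : msqi Om M ->
  (fun n => tip Om (test_hess (phi n)) M) @ \oo --> tip Om (hess Om w) M.
Proof.
move=> sM; apply: cvg_tip_test => //; last exact: approx_hess_cvg.
  by move=> n; exact: test_hess_msqi (approx_test n).
exact: approx_hess_msqi.
Qed.

Lemma approx_ip_cvg f : sqi Om f -> (fun n => dt Om f (phi n)) @ \oo --> dt Om f w.
Proof.
move=> sf; rewrite dotC; under eq_fun do rewrite dotC.
apply: (cvgL2_dot mOm _ approx_sqi sf approx_cvg) => n.
exact: (test_square_integrable mOm (approx_test n)).
Qed.

(* For test functions this is the definition of the distribution div div M. *)
Lemma approx_green M : HdDiv Om M -> dt Om (divDiv Om M) w = tip Om M (hess Om w).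
Proof.
move=> [[LM _] [g Hg]]; have sM : msqi Om M by move=> i j; exact/(L2P _ mOm).
have [/(L2P _ mOm) sd Hd] := L2rep_spec Hg.
have c1 := approx_ip_cvg sd; have c2 := approx_tip_cvg sM.
have E : (fun n => dt Om (divDiv Om M) (phi n)) = fun n => tip Om (test_hess (phi n)) M.
  apply/funext => n; rewrite tipC -(div_divE oOm sM (approx_test n)).
  by rewrite (Hd _ (approx_test n)).
by rewrite E in c1; rewrite tipC -(cvg_lim _ c1)// -(cvg_lim _ c2).
Qed.

Lemma approx_poincare : dt Om w w <= M0 ^+ 2 * tip Om (hess Om w) (hess Om w).
Proof.
have sp n := test_square_integrable mOm (approx_test n).
have c1 := cvgL2_sqrnorm mOm sp approx_sqi approx_cvg.
have sh n i j : sqi Om (fun x => test_hess (phi n) x i j).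
  exact: (test_hess_msqi mOm (approx_test n)).
have c2 : (fun n => M0 ^+ 2 * tip Om (test_hess (phi n)) (test_hess (phi n))) @ \oo -->
    M0 ^+ 2 * tip Om (hess Om w) (hess Om w).
  apply: cvgM; first exact: cvg_cst.
  rewrite (tipE mOm approx_hess_msqi approx_hess_msqi).
  rewrite (_ : (fun n => _) = fun n => \sum_i \sum_j
    dt Om (fun x => test_hess (phi n) x i j) (fun x => test_hess (phi n) x i j)); last first.
    by apply/funext => n; rewrite (tipE mOm (sh n) (sh n)).
  apply: cvg_sum_ord2 => i; apply: cvg_sum_ord2 => j.
  by apply: (cvgL2_sqrnorm mOm _ (approx_hess_msqi i j) (approx_hess_cvg i j)) => n.
apply: (ler_cvg_to c1 c2); apply: nearW => n.
exact: test_tip_poincare (approx_test n).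
Qed.

End approx.

Variable Ct : plane -> {linear 'M[R]_2 -> 'M[R]_2}.
Hypothesis Ct_ok : tensor_field Om Ct.

Definition plate_form phi psi := tip Om (tapply Ct (test_hess phi)) (test_hess psi).

Lemma tapply_hess_msqi (phi : nat -> plane -> R) w : H20_approx Om phi w -> msqi Om (tapply Ct (hess Om w)).
Proof.
move=> Hw; apply: (tapply_square_integrable Ct_ok mOm) => //.
- by move=> x; exact: hess_symm.
- exact: approx_hess_msqi Hw.
Qed.

(** [minimizing_sequence] is applied to the space of test functions itself. Coercivity turns Cauchy
    in the energy into Cauchy Hessians, which is what [approx_of_cauchy] asks for. *)
Lemma plate_solution f : sqi Om f -> exists (phi : nat -> plane -> R) w, H20_approx Om phi w /\
  forall psi, test Om psi ->
    tip Om (tapply Ct (hess Om w)) (test_hess psi) = dt Om f psi.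
Proof.
move=> sf; have [al al0 coer] := tip_tapply_coercive Ct_ok.
have id' : Om `<=` Om by [].
have sH phi : test Om phi -> msqi Om (test_hess phi) by move=> tp; exact: test_hess_msqi tp.
have yH phi : test Om phi -> forall x, symm (test_hess phi x).
  by move=> tp x; apply: test_hess_symm; exact: test_smooth tp.
have sCH phi : test Om phi -> msqi Om (tapply Ct (test_hess phi)).
  move=> tp; apply: (tapply_square_integrable Ct_ok mOm) => //; first exact: yH.
  exact: sH.
have formE phi psi : test Om phi -> test Om psi ->
    plate_form phi psi = tip Om (test_hess phi) (tapply Ct (test_hess psi)).
  move=> tp tq.
  exact: (tip_tapplyC Ct_ok mOm mOm id' (yH _ tp) (yH _ tq) (sH _ tp) (sH _ tq)).
have symF phi psi : test Om phi -> test Om psi -> plate_form phi psi = plate_form psi phi.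
  by move=> tp tq; rewrite formE// tipC.
have coerF phi : test Om phi -> al * tip Om (test_hess phi) (test_hess phi) <= plate_form phi phi.
  by move=> tp; apply: coer => //; [exact: yH|exact: sH].
(* From (f, u)^2 <= ||f||^2 ||u||^2, the Poincare inequality and coercivity. *)
pose c := dt Om f f * M0 ^+ 2 / al.
have c0 : 0 <= c.
  by apply: divr_ge0; [apply: mulr_ge0; [exact: dot_ge0|exact: sqr_ge0]|exact: ltW].
have := @minimizing_sequence R plane (test Om) plate_form (dt Om f) c.
case.
- by exists (fun=> 0); exact: test0.
- by move=> u k v tu tv; apply: testD => //; exact: testZ.
- move=> u k v z tu tv tz; have tuv := testD tu (testZ k tv).
  rewrite (formE _ _ tuv tz) (formE _ _ tu tz) (formE _ _ tv tz).
  rewrite (test_hess_lin _ (test_smooth tu) (test_smooth tv)).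
  exact: (tip_linl k mOm (sH _ tu) (sH _ tv) (sCH _ tz)).
- exact: symF.
- move=> u tu; apply: le_trans (coerF _ tu); rewrite mulr_ge0 ?tip_ge0//; exact: ltW.
- move=> u k v tu tv; have su := test_square_integrable mOm tu.
  have sv := test_square_integrable mOm tv.
  rewrite (dotC _ _ f (fun x => u x + k * v x)) (dotC _ _ f u) (dotC _ _ f v).
  by rewrite (dotDl mOm su (square_integrableZ mOm k sv) sf) (dotZl mOm k sv sf).
- exact: c0.
- move=> u tu; have su := test_square_integrable mOm tu.
  apply: le_trans (cauchy_schwarz mOm sf su) _.
  have H := coerF _ tu; have P := test_tip_poincare tu.
  rewrite /c -(mulrA (dt Om f f)) -(mulrA (dt Om f f)).
  apply: ler_wpM2l; first exact: dot_ge0.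
  apply: (le_trans P); rewrite -mulrA; apply: ler_wpM2l; first exact: sqr_ge0.
  by rewrite mulrC ler_pdivlMr// mulrC.
move=> phi [tphi cauchy euler].
have [w Hw] : exists w, H20_approx Om phi w.
  apply: (approx_of_cauchy oOm Om_fin tphi) => i j e e0.
  have [|N HN] := cauchy (al * e); first by rewrite mulr_gt0.
  exists N => m n Nm Nn; have tmn := test_sub (tphi m) (tphi n).
  rewrite -(ltr_pM2l al0); apply: le_lt_trans (HN m n Nm Nn).
  apply: le_trans (coerF _ tmn); rewrite ler_pM2l//.
  apply: le_trans (dot_entry_le_tip i j mOm (sH _ tmn)).
  have E := pderivs_sub [:: i; j] (test_smooth (tphi m)) (test_smooth (tphi n)).
  rewrite le_eqVlt; apply/orP; left; apply/eqP; apply: eq_dot => x _;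
  by rewrite mxE; exact: (congr1 (fun f => f x) (esym E)).
exists phi, w; split=> // psi tpsi.
(* By symmetry the tensor acts on the fixed test function, so that only the convergence of the
   Hessians is used. *)
have c1 := approx_tip_cvg Hw (sCH _ tpsi); have c2 := euler psi tpsi.
have E : (fun n => plate_form (phi n) psi) =
    fun n => tip Om (test_hess (phi n)) (tapply Ct (test_hess psi)).
  by apply/funext => n; exact: formE.
rewrite (tip_tapplyC Ct_ok mOm mOm id' (hess_symm Om w) (yH _ tpsi) (approx_hess_msqi Hw) (sH _ tpsi)).
by rewrite E in c2; rewrite -(cvg_lim _ c1)// -(cvg_lim _ c2).
Qed.

(** In view of [div_divE], the Euler equation says literally that [f] represents div div of
    [C D^2 w]. *)
Lemma plate_HdDiv f (phi : nat -> plane -> R) w : sqi Om f -> H20_approx Om phi w ->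
  (forall psi, test Om psi ->
    tip Om (tapply Ct (hess Om w)) (test_hess psi) = dt Om f psi) ->
  HdDiv Om (tapply Ct (hess Om w)) /\
  {ae muP, forall x : mplane, Om x -> divDiv Om (tapply Ct (hess Om w)) x = f x}.
Proof.
move=> sf Hw eul; have sM := tapply_hess_msqi Hw.
have rep : is_L2rep Om (div_div Om (tapply Ct (hess Om w))) f.
  split; first exact/(L2P _ mOm).
  by move=> psi tp; rewrite (div_divE oOm sM tp); exact: eul.
split; last exact: is_L2rep_ae.
split; last by exists f.
split; first by move=> i j; exact/(L2P _ mOm).
by apply: (tapply_symm Ct_ok) => x; exact: hess_symm.
Qed.

(** The Euler equation is tested with [w] itself, which is legitimate in the limit. With t = ||D^2
    w||^2, coercivity, Cauchy--Schwarz and Poincare give (al t)^2 <= ||f||^2 |Om|^2 t, hence t <= q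
    ||f||^2. *)
Lemma plate_bounds : exists2 K : R, 0 < K & forall f (phi : nat -> plane -> R) w,
  sqi Om f -> H20_approx Om phi w ->
  (forall psi, test Om psi ->
    tip Om (tapply Ct (hess Om w)) (test_hess psi) = dt Om f psi) ->
  dt Om w w + tip Om (hess Om w) (hess Om w) <= K * dt Om f f /\
  tip Om (tapply Ct (hess Om w)) (tapply Ct (hess Om w)) <= K * dt Om f f.
Proof.
have [al al0 coer] := tip_tapply_coercive Ct_ok.
have [k k0 bd] := tip_tapply_bounded Ct_ok.
pose q := M0 ^+ 2 / al ^+ 2; have q0 : 0 <= q by rewrite divr_ge0 ?sqr_ge0.
(* The terms bound, in this order, the function, its Hessian and the tensor [C D^2 w]; the 1 makes
   [K] positive. *)
pose K := (M0 ^+ 2 * q + q) + k * q + 1.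
have M20 : 0 <= M0 ^+ 2 by exact: sqr_ge0.
have K1 : 0 <= k * q by exact: mulr_ge0.
have K2 : 0 <= M0 ^+ 2 * q by exact: mulr_ge0.
exists K; first by rewrite /K ltr_wpDl// !addr_ge0.
move=> f phi w sf Hw eul; have id' : Om `<=` Om by [].
have sM := tapply_hess_msqi Hw; have sH := approx_hess_msqi Hw.
have yH x : symm (hess Om w x) by exact: hess_symm.
have aww : tip Om (tapply Ct (hess Om w)) (hess Om w) = dt Om f w.
  have c1 := approx_tip_cvg Hw sM; have c2 := approx_ip_cvg Hw sf.
  have E : (fun n => dt Om f (phi n)) =
      fun n => tip Om (test_hess (phi n)) (tapply Ct (hess Om w)).
    by apply/funext => n; rewrite tipC eul//; exact: (approx_test Hw n).
  by rewrite E in c2; rewrite tipC -(cvg_lim _ c1)// -(cvg_lim _ c2).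
have := coer Om _ mOm mOm id' yH sH; rewrite aww.
have := cauchy_schwarz mOm sf (approx_sqi Hw).
have := approx_poincare Hw; have := bd Om _ mOm mOm id' yH sH.
have := dot_ge0 muP Om f; have := dot_ge0 muP Om w; have := tip_ge0 Om (hess Om w).
move: (tip Om (tapply _ _) _) (tip Om (hess Om w) _) (dt Om f f) (dt Om w w) (dt Om f w).
move=> c t ff ww fw t0 ww0 ff0 cb pw cs co.
have tq : t <= q * ff.
  have [->|tn0] := eqVneq t 0; first by rewrite mulr_ge0.
  have tpos : 0 < t by rewrite lt_def tn0.
  have at0 : 0 <= al * t by rewrite mulr_ge0// ltW.
  have h1 : (al * t) ^+ 2 <= ff * (M0 ^+ 2 * t).
    apply: le_trans (_ : fw ^+ 2 <= _); last by apply: le_trans cs _; rewrite ler_wpM2l.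
    by rewrite lerXn2r ?nnegrE// (le_trans at0).
  rewrite /q mulrAC ler_pdivlMr ?exprn_gt0//.
  rewrite -(ler_pM2r tpos).
  by apply: le_trans (_ : (al * t) ^+ 2 <= _); [|apply: le_trans h1 _];
    rewrite le_eqVlt; apply/orP; left; apply/eqP; ring.
have h2 : M0 ^+ 2 * t <= M0 ^+ 2 * q * ff by rewrite -mulrA ler_wpM2l.
have h3 : k * t <= k * q * ff by rewrite -mulrA ler_wpM2l.
have h4 : 0 <= M0 ^+ 2 * q * ff by rewrite mulr_ge0.
have h5 : 0 <= k * q * ff by rewrite mulr_ge0.
have h6 : 0 <= q * ff by rewrite mulr_ge0.
rewrite /K; clear -pw tq h2 h3 h4 h5 h6 ff0 cb.
by split; rewrite !mulrDl mul1r; lra.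
Qed.

End plate_problem.

(** * Triangles and meshes *)

Section mesh_geometry.
Variable R : realType.
Local Notation plane := (R * R)%type.
Local Notation mplane := (measurableTypeR R * measurableTypeR R)%type.
Local Notation muP := (mu2 R : {measure set mplane -> \bar R}).
Local Notation leb := (@lebesgue_measure R).
Implicit Types (U Om : set plane) (x y p q : plane) (T : triangle R).

Definition line (a b c : R) : set plane := [set x | a * x.1 + b * x.2 = c].

Lemma affine_continuous (a b c : R) : continuous (fun x : plane => a * x.1 + b * x.2 + c).
Proof.
move=> x; apply: cvgD; last exact: cvg_cst.
by apply: cvgD; apply: cvgM; [exact: cvg_cst|exact: cvg_fst|exact: cvg_cst|exact: cvg_snd].
Qed.

Lemma line_closed a b c : closed (line a b c).
Proof.
have -> : line a b c = (fun x : plane => a * x.1 + b * x.2 + - c) @^-1` [set 0].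
  apply/seteqP; split=> x /=; rewrite /line/=; first by move=> ->; rewrite subrr.
  by move=> /eqP; rewrite subr_eq0 => /eqP.
by apply: closed_comp => [x _|]; [exact: affine_continuous|exact: closed_eq].
Qed.

(** A vertical line is a product with a null factor; any other line has one-point vertical
    sections. *)
Lemma line_null (a b c : R) : (a, b) != (0, 0) -> muP (line a b c : set mplane) = 0%E.
Proof.
move=> ab; have mL := closed_measurable_plane (@line_closed a b c).
have [b0|bn0] := eqVneq b 0.
  have an0 : a != 0 by apply: contra ab => /eqP ->; rewrite b0.
  have -> : line a b c = [set c / a] `*` setT.
    apply/seteqP; split=> x; rewrite /line /setX/= b0 mul0r addr0.
      by move=> <-; rewrite mulrAC divff// mul1r.
    by move=> [-> _]; rewrite mulrCA divff// mulr1.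
  have e1 : leb [set c / a] = 0%E by exact: lebesgue_measure_set1.
  rewrite -[LHS]/((leb \x leb)%E _) product_measure1E//.
  by apply: etrans (congr1 (fun z => z * _)%E e1) _; rewrite mul0e.
rewrite -[LHS]/((leb \x leb)%E _) /product_measure1; apply: integral0_eq => s _ /=.
have -> : xsection (line a b c) s = [set (c - a * s) / b].
  apply/seteqP; split=> t; rewrite /xsection/= inE /line/=.
    by move=> <-; rewrite addrAC subrr add0r mulrAC divff// mul1r.
  by move=> ->; rewrite mulrCA divff// mulr1 addrC subrK.
exact: lebesgue_measure_set1.
Qed.

(** A small step along the normal (a, b) stays in [U] and leaves the line. *)
Lemma open_not_in_line U (a b c : R) : open U -> U !=set0 -> (a, b) != (0, 0) ->
  ~ (U `<=` line a b c).
Proof.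
move=> oU [x Ux] ab UL.
have n0 : 0 < a ^+ 2 + b ^+ 2.
  rewrite lt_def addr_ge0 ?sqr_ge0// andbT paddr_eq0 ?sqr_ge0// !sqrf_eq0.
  by move: ab; rewrite xpair_eqE.
have [r r0 rU] := open_rectangle oU Ux.
pose t := r / (`|a| + `|b| + 1).
have d0 : 0 < `|a| + `|b| + 1 by rewrite ltr_wpDl// addr_ge0.
have t0 : 0 < t by rewrite divr_gt0.
have small z : `|z| <= `|a| + `|b| -> `|z * t| < r.
  move=> zab; rewrite normrM (gtr0_norm t0) /t mulrA ltr_pdivrMr// mulrC ltr_pM2l//.
  by rewrite (le_lt_trans zab)// ltrDl.
have Uy : U (x.1 + a * t, x.2 + b * t).
  apply: rU => /=; rewrite addrAC subrr add0r; apply: small.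
    by rewrite lerDl.
  by rewrite lerDr.
have := UL _ Uy; have := UL _ Ux; rewrite /line/= => e1 e2.
have : t * (a ^+ 2 + b ^+ 2) = 0.
  by rewrite -[RHS](subrr c) -{1}e2 -e1; ring.
by apply/eqP; rewrite mulf_neq0// gt_eqF.
Qed.

Lemma segment_in_line p q : exists a b c, (a, b) != (0, 0) /\ segment p q `<=` line a b c.
Proof.
have [->|pq] := eqVneq p q.
  exists 1, 0, q.1; split; first by rewrite xpair_eqE oner_eq0.
  move=> _ [t _ <-]; rewrite /segpt subrr scaler0 addr0 /line/=; ring.
exists (q.2 - p.2), (p.1 - q.1), ((q.2 - p.2) * p.1 + (p.1 - q.1) * p.2); split.
  rewrite xpair_eqE !subr_eq0; apply: contra pq => /andP[/eqP e2 /eqP e1].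
  by apply/eqP; rewrite [p]surjective_pairing [q]surjective_pairing e1 e2.
by move=> _ [t _ <-]; rewrite /line /segpt/= /GRing.scale/=; ring.
Qed.

Lemma sum_ord3 (V : nmodType) (F : 'I_3 -> V) :
  \sum_i F i = F ord0 + (F (inord 1) + F (inord 2)).
Proof.
rewrite 2!big_ord_recl big_ord1; congr (_ + (F _ + F _)).
  by apply: val_inj; rewrite /= inordK.
by apply: val_inj; rewrite /= inordK.
Qed.

Lemma ord3_cases (k : 'I_3) : [\/ k = ord0, k = inord 1 | k = inord 2].
Proof.
by case: k => [[|[|[|//]]] ?]; [apply: Or31|apply: Or32|apply: Or33];
  apply: val_inj; rewrite //= inordK.
Qed.

Lemma inord12 : (inord 1 == inord 2 :> 'I_3) = false.
Proof. by rewrite -val_eqE/= !inordK. Qed.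

Lemma fst_sum (F : 'I_3 -> plane) : (\sum_k F k).1 = \sum_k (F k).1.
Proof. by rewrite !sum_ord3. Qed.

Lemma snd_sum (F : 'I_3 -> plane) : (\sum_k F k).2 = \sum_k (F k).2.
Proof. by rewrite !sum_ord3. Qed.

(** Cramer's rule: barycentric coordinates are affine functions of the point, with [D] twice the
    signed area. Their nonzero gradients put the edges on genuine lines. *)
Lemma barycentric T : Defs.nondegenerate T -> exists A B C : 'I_3 -> R,
  (forall k, (A k, B k) != (0, 0)) /\
  (forall x (l : 'I_3 -> R), (\sum_k l k = 1 /\ x = \sum_k l k *: T k) <->
     forall k, l k = A k * x.1 + B k * x.2 + C k).
Proof.
move=> nd.
have n10 : (inord 1 == ord0 :> 'I_3) = false by rewrite -val_eqE/= inordK.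
have n20 : (inord 2 == ord0 :> 'I_3) = false by rewrite -val_eqE/= inordK.
have n21 : (inord 2 == inord 1 :> 'I_3) = false by rewrite eq_sym; exact: inord12.
pose mk (a b c : R) := fun k : 'I_3 => if k == ord0 then a else if k == inord 1 then b else c.
have mk0 a b c : mk a b c ord0 = a by rewrite /mk eqxx.
have mk1 a b c : mk a b c (inord 1) = b by rewrite /mk n10 eqxx.
have mk2 a b c : mk a b c (inord 2) = c by rewrite /mk n20 n21.
move: nd; rewrite /Defs.nondegenerate.
have combE (l : 'I_3 -> R) : \sum_k l k *: T k =
    (l ord0 * (T ord0).1 + (l (inord 1) * (T (inord 1)).1 + l (inord 2) * (T (inord 2)).1),
     l ord0 * (T ord0).2 + (l (inord 1) * (T (inord 1)).2 + l (inord 2) * (T (inord 2)).2)).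
  by rewrite [LHS]surjective_pairing fst_sum snd_sum !sum_ord3.
set p1 := (T ord0).1 in combE *; set p2 := (T ord0).2 in combE *.
set q1 := (T (inord 1)).1 in combE *; set q2 := (T (inord 1)).2 in combE *.
set r1 := (T (inord 2)).1 in combE *; set r2 := (T (inord 2)).2 in combE *.
clearbody p1 p2 q1 q2 r1 r2; move=> nd.
have nd' (l1 l2 : R) : l1 * (q1 - p1) + l2 * (r1 - p1) = 0 ->
    l1 * (q2 - p2) + l2 * (r2 - p2) = 0 -> l1 = 0 /\ l2 = 0.
  move=> e1 e2; have := nd (mk (- l1 - l2) l1 l2).
  rewrite sum_ord3 combE !mk0 !mk1 !mk2 => H.
  have h0 : - l1 - l2 + (l1 + l2) = 0 by ring.
  have h1 : ((- l1 - l2) * p1 + (l1 * q1 + l2 * r1), (- l1 - l2) * p2 + (l1 * q2 + l2 * r2))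
     = 0 :> plane.
    by apply/pair_equal_spec; split; rewrite /=; [rewrite -[RHS]e1|rewrite -[RHS]e2]; ring.
  by split; [rewrite -(mk1 (- l1 - l2) l1 l2)|rewrite -(mk2 (- l1 - l2) l1 l2)]; exact: H.
pose D := (q1 - p1) * (r2 - p2) - (q2 - p2) * (r1 - p1).
(* If [D] vanished, its cofactors would be coefficients of linear relations between the edge
   vectors; so all coordinates of these vectors would be 0, and then (1, 0) would be a relation as
   well. *)
have Dn0 : D != 0.
  apply/eqP => D0.
  have [a1 a2] : r2 - p2 = 0 /\ - (q2 - p2) = 0.
    by apply: nd'; [rewrite -[RHS]D0 /D|]; ring.
  have [b1 b2] : r1 - p1 = 0 /\ - (q1 - p1) = 0.
    by apply: nd'; [|rewrite -[RHS]oppr0 -D0 /D]; ring.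
  have [/eqP] : (1 : R) = 0 /\ (0 : R) = 0.
    apply: nd'; rewrite mul1r mul0r addr0; apply: oppr_inj; rewrite oppr0; [exact: b2|exact: a2].
  by rewrite oner_eq0.
clear nd nd'.
pose A1 := (r2 - p2) / D; pose B1 := - (r1 - p1) / D.
pose C1 := - (p1 * (r2 - p2) - p2 * (r1 - p1)) / D.
pose A2 := - (q2 - p2) / D; pose B2 := (q1 - p1) / D.
pose C2 := - ((q1 - p1) * p2 - (q2 - p2) * p1) / D.
exists (mk (- A1 - A2) A1 A2), (mk (- B1 - B2) B1 B2), (mk (1 - C1 - C2) C1 C2); split.
  have D1 : A1 * (q1 - p1) + B1 * (q2 - p2) = 1 by rewrite /A1 /B1 /D; field.
  have D2 : A2 * (r1 - p1) + B2 * (r2 - p2) = 1 by rewrite /A2 /B2 /D; field.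
  have D3 : A2 * (q1 - p1) + B2 * (q2 - p2) = 0 by rewrite /A2 /B2 /D; field.
  have nz (a b c e : R) : a * c + b * e = 1 -> (a, b) != (0, 0).
    move=> E; apply/eqP => -[a0 b0]; move: E; rewrite a0 b0 !mul0r addr0 => /eqP.
    by rewrite eq_sym oner_eq0.
  move=> k; have [->|->|->] := ord3_cases k; rewrite ?mk0 ?mk1 ?mk2.
  - apply: (nz _ _ (p1 - q1) (p2 - q2)).
    by rewrite -D1 -[RHS]addr0 -D3; ring.
  - exact: nz D1.
  - exact: nz D2.
move=> [x1 x2] l; rewrite sum_ord3 combE /=; split.
  move=> [l1 [-> ->]]; have l0 : l ord0 = 1 - l (inord 1) - l (inord 2) by rewrite -l1; ring.
  move=> k; have [->|->|->] := ord3_cases k; rewrite ?mk0 ?mk1 ?mk2/= l0;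
    by rewrite /A1 /B1 /C1 /A2 /B2 /C2 /D; field.
move=> H; have := H ord0; have := H (inord 1); have := H (inord 2).
rewrite !mk0 !mk1 !mk2 => -> -> ->; split; first by ring.
by apply/pair_equal_spec; split;
  rewrite /A1 /B1 /C1 /A2 /B2 /C2 /D; field.
Qed.

Lemma otri_bary T (A B C : 'I_3 -> R) :
  (forall x (l : 'I_3 -> R), (\sum_k l k = 1 /\ x = \sum_k l k *: T k) <->
     forall k, l k = A k * x.1 + B k * x.2 + C k) ->
  (forall x, otri T x <-> forall k, 0 < A k * x.1 + B k * x.2 + C k) /\
  (forall x, ctri T x <-> forall k, 0 <= A k * x.1 + B k * x.2 + C k).
Proof.
move=> H; split=> x; split.
- by move=> [l [l0 l1 xl]] k; have /H/(_ k) <- : \sum_k l k = 1 /\ x = \sum_k l k *: T k by [].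
- move=> l0; have [l1 xl] := (H x (fun k => A k * x.1 + B k * x.2 + C k)).2 (fun k => erefl).
  by exists (fun k => A k * x.1 + B k * x.2 + C k).
- by move=> [l [l0 l1 xl]] k; have /H/(_ k) <- : \sum_k l k = 1 /\ x = \sum_k l k *: T k by [].
- move=> l0; have [l1 xl] := (H x (fun k => A k * x.1 + B k * x.2 + C k)).2 (fun k => erefl).
  by exists (fun k => A k * x.1 + B k * x.2 + C k).
Qed.

Lemma otri_ctri T : otri T `<=` ctri T.
Proof. by move=> x [l [l0 l1 xl]]; exists l; split=> // k; exact: ltW. Qed.

Lemma otri_open T : Defs.nondegenerate T -> open (otri T).
Proof.
move=> /barycentric[A [B [C [_ /otri_bary[HO _]]]]].
have -> : otri T = \bigcap_(k in [set: 'I_3]) [set x : plane | 0 < A k * x.1 + B k * x.2 + C k].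
  by apply/seteqP; split=> x; [move=> /HO H k _; exact: H|move=> H; apply/HO => k; exact: H].
have oK k : open [set x : plane | 0 < A k * x.1 + B k * x.2 + C k].
  have /continuousP cf := @affine_continuous (A k) (B k) (C k).
  exact: (cf _ (@open_gt R 0)).
have -> : \bigcap_(k in [set: 'I_3]) [set x : plane | 0 < A k * x.1 + B k * x.2 + C k] =
   [set x : plane | 0 < A ord0 * x.1 + B ord0 * x.2 + C ord0] `&`
   [set x : plane | 0 < A (inord 1) * x.1 + B (inord 1) * x.2 + C (inord 1)] `&`
   [set x : plane | 0 < A (inord 2) * x.1 + B (inord 2) * x.2 + C (inord 2)].
  apply/seteqP; split=> x; first by move=> H; split; [split|]; exact: H.
  by move=> [[h0 h1] h2] k _; have [->|->|->] := ord3_cases k.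
by do 2!apply: openI => //.
Qed.

(** The difference lies on the three lines where a barycentric coordinate vanishes. *)
Lemma ctri_ae_otri T : Defs.nondegenerate T ->
  {ae muP, forall x : mplane, ctri T x -> otri T x}.
Proof.
move=> /barycentric[A [B [C [ABn0 /otri_bary[HO HC]]]]].
have off k : {ae muP, forall x : mplane, ~ line (A k) (B k) (- C k) x}.
  exists (line (A k) (B k) (- C k)); split; last by move=> x /= /contrapT.
    exact: (closed_measurable_plane (@line_closed _ _ _)).
  exact: line_null.
apply: filterS3 (off ord0) (off (inord 1)) (off (inord 2)) => x h0 h1 h2 /HC cx.
apply/HO => k; rewrite lt_def cx andbT; apply/eqP => e.
have L : line (A k) (B k) (- C k) x by rewrite /line/=; apply/eqP; rewrite -subr_eq0 opprK e.
by move: L; have [->|->|->] := ord3_cases k.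
Qed.

(** The hypotheses say that the matrix with rows e, e' has orthonormal rows, whereas the expansion
    uses orthonormal columns; in coordinates: a^2 + c^2 = 1, b^2 + d^2 = 1 and a b + c d = 0. *)
Lemma orthonormal_decomposition (e e' z : plane) :
  dotp e e = 1 -> dotp e' e' = 1 -> dotp e e' = 0 ->
  z = dotp z e *: e + dotp z e' *: e'.
Proof.
have dE (u v : plane) : dotp u v = u.1 * v.1 + u.2 * v.2.
  by rewrite /dotp sum_ord2 coord0E coord1E.
rewrite !dE; case: e e' z => [a b] [c d] [y z] /= e1 e2 e3.
have ac : a * c = - (b * d) by apply/eqP; rewrite -addr_eq0 e3.
have a2 : a ^+ 2 = 1 - b ^+ 2 by rewrite -e1; ring.
have c2 : c ^+ 2 = 1 - d ^+ 2 by rewrite -e2; ring.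
have E : a ^+ 2 * c ^+ 2 = b ^+ 2 * d ^+ 2 by rewrite -!exprMn ac sqrrN.
have acE : a ^+ 2 + c ^+ 2 = 1.
  have : (1 - b ^+ 2) * (1 - d ^+ 2) = b ^+ 2 * d ^+ 2 by rewrite -a2 -c2.
  by rewrite a2 c2; move: (b ^+ 2) (d ^+ 2) => u v H; lra.
have bdE : b ^+ 2 + d ^+ 2 = 1 by move: acE; rewrite a2 c2 => H; lra.
have abcd : a * b + c * d = 0.
  apply/eqP; rewrite -sqrf_eq0; apply/eqP.
  have b2 : b ^+ 2 = c ^+ 2 by lra.
  have d2 : d ^+ 2 = a ^+ 2 by lra.
  have -> : (a * b + c * d) ^+ 2 = a ^+ 2 * b ^+ 2 + 2 * (a * c) * (b * d) + c ^+ 2 * d ^+ 2 by ring.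
  have bd : b * d = - (a * c) by rewrite ac opprK.
  by rewrite b2 d2 bd; ring.
apply/pair_equal_spec; split; rewrite /= /GRing.scale/=.
- by rewrite -[LHS]mulr1 -acE -[LHS]addr0 -(mulr0 z) -abcd; ring.
- by rewrite -[LHS]mulr1 -bdE -[LHS]addr0 -(mulr0 y) -abcd; ring.
Qed.

Lemma unit_coord_le1 (e : plane) : dotp e e = 1 -> `|e.1| <= 1 /\ `|e.2| <= 1.
Proof.
rewrite /dotp sum_ord2 coord0E coord1E /= -!expr2 => E.
by split; rewrite -(@ler_pXn2r _ 2)// ?nnegrE// expr1n real_normK ?num_real// -E;
  rewrite (lerDl, lerDr) sqr_ge0.
Qed.

Lemma dotp_le (z e : plane) (d : R) : dotp e e = 1 -> `|z.1| <= d -> `|z.2| <= d ->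
  `|dotp z e| <= d + d.
Proof.
move=> /unit_coord_le1[e1 e2] z1 z2; rewrite /dotp sum_ord2 coord0E coord1E /=.
apply: (le_trans (ler_normD _ _)); rewrite !normrM.
by apply: lerD; rewrite -[leRHS]mulr1; apply: ler_pM.
Qed.

(* Above the graph of the boundary there are points outside the closure, so a
   boundary point is never interior to the closure. *)
Lemma lipschitz_interior_closure Om U : open Om -> lipschitz_boundary Om ->
  open U -> U `<=` closure Om -> U `<=` Om.
Proof.
move=> oOm lip oU Ucl z Uz; apply: contrapT => nOz.
have bz : boundary Om z.
  by split; [exact: Ucl|move=> /interior_subset].
have [e [e' [r [h [k [g [[ee ee' eo] r0 h0 gl gO]]]]]]] := lip z bz.
(* Otherwise [z], the origin of the local coordinates, would lie below the graph and thus in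
   [Om]. *)
have g0 : g 0 <= 0.
  rewrite leNgt; apply/negP => g0; apply: nOz.
  by have := (gO 0 0); rewrite !normr0 !scale0r !addr0 => /(_ r0 h0)[_]; apply.
have [rho rho0 rhoU] := open_rectangle oU Uz.
pose t := Num.min rho (Num.min h r) / 4.
have m0 : 0 < Num.min rho (Num.min h r) by rewrite !lt_min rho0 h0 r0.
have t0 : 0 < t by rewrite divr_gt0.
have [tr [th tR]] : 4 * t <= rho /\ 4 * t <= h /\ 4 * t <= r.
  by rewrite /t mulrC divfK// !ge_min !lexx !orbT.
pose y0 := z + t *: e'; have [e1 e2] := unit_coord_le1 ee'.
have Uy0 : U y0.
  apply: rhoU; rewrite /y0/= addrAC subrr add0r normrM (gtr0_norm t0).
    by rewrite (le_lt_trans (ler_piMr (ltW t0) e1))//; lra.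
  by rewrite (le_lt_trans (ler_piMr (ltW t0) e2))//; lra.
pose k' := `|k|; have k0 : 0 <= k' by exact: normr_ge0.
have d4 : 0 < 4 * (1 + k') by rewrite mulr_gt0// ltr_wpDr.
(* This makes t = 4 d + 4 |k| d. A point within d of [y0] has local coordinates s and t + s' with
   |s|, |s'| <= 2 d, so its height exceeds 2 |k| d >= g s, and it cannot belong to [Om]. *)
pose d := t / (4 * (1 + k')); have d0 : 0 < d by rewrite divr_gt0.
have dt : 4 * (1 + k') * d = t by rewrite /d mulrC divfK// gt_eqF.
have kd : 0 <= k' * d by rewrite mulr_ge0// ltW.
have [y [Oy [/= y1 y2]]] := Ucl _ Uy0 _ (nbhsx_ballx y0 _ d0).
rewrite /ball/= distrC in y1; rewrite /ball/= distrC in y2.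
pose w := y - y0.
have w1 : `|w.1| <= d by exact: ltW.
have w2 : `|w.2| <= d by exact: ltW.
have se := dotp_le ee w1 w2; have te := dotp_le ee' w1 w2.
have yE : y = z + dotp w e *: e + (t + dotp w e') *: e'.
  rewrite scalerDl -addrACA -(orthonormal_decomposition w ee ee' eo).
  by rewrite -/y0 /w addrC subrK.
move: Oy; rewrite yE; move: (dotp w e) (dotp w e') se te => s s' se te.
have tE : t = 4 * d + 4 * (k' * d) by rewrite -dt; ring.
move: te; rewrite ler_norml => /andP[te1 te2].
have sr : `|s| < r by apply: le_lt_trans se _; lra.
have th' : `|t + s'| < h by rewrite ltr_norml; apply/andP; split; lra.
move=> /(gO _ _ sr th').
have gs : g s <= k' * (d + d).
  have := gl s 0; rewrite subr0 => H.
  have H1 : k * `|s| <= k' * (d + d).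
    by apply: (le_trans (ler_wpM2r (normr_ge0 s) (ler_norm k))); exact: ler_wpM2l.
  have := le_trans (ler_norm _) (le_trans H H1); rewrite lerBlDr => H2.
  by apply: (le_trans H2); rewrite -[leRHS]addr0 lerD2l.
rewrite mulrDr in gs; move=> H; lra.
Qed.

End mesh_geometry.

(** * Integration over the triangles of a mesh *)

Section mesh_integration.
Variable R : realType.
Local Notation plane := (R * R)%type.
Local Notation mplane := (measurableTypeR R * measurableTypeR R)%type.
Local Notation muP := (mu2 R : {measure set mplane -> \bar R}).
Local Notation rint := (@rintegrable _ mplane R (mu2 R)).
Local Notation sqi := (@square_integrable _ mplane R (mu2 R)).
Local Notation dt := (@dot _ mplane R (mu2 R)).
Implicit Types (U Om : set plane) (x y p q : plane).

Lemma Rintegral_sum_ord U n (F : 'I_n -> plane -> R) : measurable (U : set mplane) ->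
  (forall i, rint U (F i)) ->
  rint U (fun x => \sum_i F i x) /\
  \int[muP]_(x in (U : set mplane)) (\sum_i F i x) = \sum_i \int[muP]_(x in (U : set mplane)) F i x.
Proof.
move=> mU; elim: n F => [|n IH] F iF.
  split; last by rewrite big_ord0; under eq_Rintegral do rewrite big_ord0; rewrite Rintegral_cst// mul0r.
  rewrite /rintegrable (_ : _ \o _ = cst 0%E); first exact: integrable0.
  by apply/funext => x /=; rewrite big_ord0.
have [i1 e1] := IH (fun i => F (lift ord0 i)) (fun i => iF _).
split.
  by apply: eq_integrable (rintegrableD mU (iF ord0) i1) => // x _ /=; rewrite big_ord_recl.
rewrite big_ord_recl -e1 -(RintegralD mU (iF ord0) i1).
by apply: eq_Rintegral => x _; rewrite big_ord_recl.
Qed.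

Lemma bounded_measure_lty Om : open Om -> bounded_set Om -> (mu2 R Om < +oo)%E.
Proof.
move=> oOm [M [_ HM]]; apply: (@bounded_plane_lty _ _ (`|M| + 2)).
  exact: open_measurable_plane.
move=> x Ox; have /= := HM (`|M| + 1) ltac:(by have := ler_norm M; lra) x Ox.
by move=> H; apply: le_lt_trans H _; rewrite ltrD2l; lra.
Qed.

Section mesh.
Variables (Om : set plane) (N : nat) (T : 'I_N -> triangle R).
Hypothesis polygon : lipschitz_polygon Om.
Hypothesis mesh : regular_mesh Om T.
Local Notation O i := (otri (T i)).

Lemma mesh_open_domain : open Om.
Proof. by case: polygon. Qed.

Lemma mesh_otri_open i : open (O i).
Proof. by case: mesh => nd _ _; exact: otri_open. Qed.

(** The mesh only covers the closure of [Om], so this is a property of the boundary: a slit in [Om]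
    could run through a triangle. *)
Lemma mesh_otri_sub i : O i `<=` Om.
Proof.
have [_ _ _ _ [lip _]] := polygon; have [_ cl _] := mesh.
have sub : O i `<=` closure Om by move=> x Ox; rewrite cl; exists i => //; exact: otri_ctri.
move=> z; apply: lipschitz_interior_closure => //.
- exact: mesh_open_domain.
- exact: mesh_otri_open.
Qed.

(** The intersection of two open triangles is open, but by conformity it lies in a vertex or an
    edge, hence on a line. *)
Lemma mesh_otri_disjoint i j x : i != j -> O i x -> O j x -> False.
Proof.
move=> ij Oi Oj; have [_ _ /(_ _ _ ij) I] := mesh.
pose U := O i `&` O j; have oU : open U by apply: openI; exact: mesh_otri_open.
have U0 : U !=set0 by exists x.
have UI : U `<=` ctri (T i) `&` ctri (T j) by move=> y [? ?]; split; exact: otri_ctri.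
have [I0|[k [l [_ Ik]]]|[k [k' [l [l' [_ _ _ Ik]]]]]] := I.
- by have := UI x (conj Oi Oj); rewrite I0.
- have := @open_not_in_line _ U 1 0 (T i k).1 oU U0; apply.
    by rewrite xpair_eqE oner_eq0.
  by move=> y /UI; rewrite Ik => ->; rewrite /line/=; ring.
- have [a [b [c [ab sub]]]] := segment_in_line (T i k) (T i k').
  have UL y : U y -> line a b c y by move=> /UI; rewrite Ik => /sub.
  exact: (open_not_in_line oU U0 ab UL).
Qed.

Lemma mesh_ae_cover : {ae muP, forall x : mplane, Om x -> exists i, O i x}.
Proof.
have [nd cl _] := mesh.
pose P (n : nat) (x : mplane) := if insub n is Some i then ctri (T i) x -> O i x else True.
have : {ae muP, forall x : mplane, forall n, P n x}.
  apply: ae_foralln => n; rewrite /P; case: insubP => [i _ _|_]; last exact: aeW.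
  exact: ctri_ae_otri.
apply: filterS => x HP Ox; have : closure Om x by exact: subset_closure.
rewrite cl => -[i _ ci]; exists i.
by have := HP i; rewrite /P valK; exact.
Qed.

Let mOm := open_measurable_plane mesh_open_domain.
Let mO i := open_measurable_plane (@mesh_otri_open i).

Lemma restrict_otri_neq i j (g : plane -> R) x : O i x -> j != i -> (g \_ (O j)) x = 0.
Proof.
move=> Oi ji; rewrite patchE; case: ifPn => //; rewrite inE => Oj.
by case: (mesh_otri_disjoint ji Oj Oi).
Qed.

Lemma sum_restrict_otri (v : pwfun R N) i x : O i x ->
  \sum_j (v j \_ (O j)) x = v i x.
Proof.
move=> Oi; rewrite (bigD1 i)//= [X in X + _]patchE mem_set// big1 ?addr0// => j ji.
exact: restrict_otri_neq Oi ji.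
Qed.

Lemma rint_restrict i (g : plane -> R) : rint (O i) g -> rint Om (g \_ (O i)).
Proof.
move=> ig; rewrite /rintegrable -restrict_EFin.
have H := (@integrable_mkcond _ mplane R muP (O i) (EFin \o g) (mO i)).1 ig.
exact: (@integrableS _ mplane R muP _ _ _ measurableT mOm _ H).
Qed.

Lemma mesh_integral (g : plane -> R) : rint Om g ->
  \int[muP]_(x in (Om : set mplane)) g x = \sum_i \int[muP]_(x in (O i : set mplane)) g x.
Proof.
move=> ig.
have ii i : rint Om (g \_ (O i)).
  apply: rint_restrict; exact: (@integrableS _ mplane R muP _ _ _ mOm (mO i) (@mesh_otri_sub i) ig).
have [i1 e1] := Rintegral_sum_ord mOm ii.
transitivity (\int[muP]_(x in (Om : set mplane)) \sum_i (g \_ (O i)) x).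
  apply: ae_eq_Rintegral => //.
  - exact: rintegrable_measurable ig.
  - exact: rintegrable_measurable i1.
  - apply: filterS mesh_ae_cover => x H /H[i Oi].
    by rewrite (sum_restrict_otri (fun=> g) Oi).
rewrite e1; apply: eq_bigr => i _.
rewrite -Rintegral_mkcondr setIidr//; exact: mesh_otri_sub.
Qed.

Lemma mesh_dot (f g : plane -> R) : sqi Om f -> sqi Om g -> dt Om f g = \sum_i dt (O i) f g.
Proof. by move=> sf sg; apply: mesh_integral; exact: square_integrable_mul. Qed.

Lemma mesh_tip (M M' : plane -> 'M[R]_2) : msqi Om M -> msqi Om M' ->
  tip Om M M' = \sum_i tip (O i) M M'.
Proof. by move=> sM sM'; apply: mesh_integral; exact: frob_integrable. Qed.

(** Turns piecewise data into one function on [Om], so that a solution of the hybrid problem can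
    serve as right-hand side of the plate problem. *)
Lemma mesh_glue (v : pwfun R N) : (forall i, sqi (O i) (v i)) ->
  exists2 g, sqi Om g & forall i x, O i x -> g x = v i x.
Proof.
move=> sv; exists (fun x => \sum_j (v j \_ (O j)) x); last first.
  by move=> i x; exact: sum_restrict_otri.
apply: (square_integrable_sum mOm) => i; split.
  have := (measurable_restrictT (v i) (mO i)).1 (sv i).1.
  exact: measurable_funS.
have := rint_restrict (sv i).2; apply: eq_integrable => // x _ /=.
by rewrite !patchE; case: ifP => // _; rewrite expr0n.
Qed.

End mesh.
End mesh_integration.

(** * The hybrid problem *)

Section linearity.
Variable R : realType.
Local Notation plane := (R * R)%type.
Local Notation mplane := (measurableTypeR R * measurableTypeR R)%type.
Local Notation muP := (mu2 R : {measure set mplane -> \bar R}).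
Local Notation sqi := (@square_integrable _ mplane R (mu2 R)).
Local Notation dt := (@dot _ mplane R (mu2 R)).
Implicit Types (U Om : set plane) (u v : plane -> R) (M N : plane -> 'M[R]_2).

Lemma square_integrable_lin U u k v : measurable (U : set mplane) -> sqi U u -> sqi U v ->
  sqi U (fun x => u x + k * v x).
Proof. by move=> mU su sv; exact: (square_integrableD mU su (square_integrableZ mU k sv)). Qed.

Lemma dot_linl U u k v p : measurable (U : set mplane) -> sqi U u -> sqi U v -> sqi U p ->
  dt U (fun x => u x + k * v x) p = dt U u p + k * dt U v p.
Proof.
move=> mU su sv sp; have := dotDl mU su (square_integrableZ mU k sv) sp.
by rewrite (dotZl mU k sv sp).
Qed.

Lemma is_L2rep_lin U t t' s g k h : measurable (U : set mplane) ->
  (forall phi, test U phi -> s phi = t phi + k * t' phi) ->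
  is_L2rep U t g -> is_L2rep U t' h -> is_L2rep U s (fun x => g x + k * h x).
Proof.
move=> mU st [/(L2P _ mU) sg tg] [/(L2P _ mU) sh th].
split; first by apply/(L2P _ mU); exact: square_integrable_lin.
move=> phi tp; have sp := test_square_integrable mU tp.
by rewrite st// tg// th//; exact: esym (dot_linl k mU sg sh sp).
Qed.

Lemma regular_lin U u k v phi : measurable (U : set mplane) -> sqi U u -> sqi U v ->
  test U phi ->
  regular U (fun x => u x + k * v x) phi = regular U u phi + k * regular U v phi.
Proof.
move=> mU su sv tp; have sp := test_square_integrable mU tp.
exact: (dot_linl k mU su sv sp).
Qed.

Lemma H2_sqi U u : measurable (U : set mplane) -> H2 U u -> sqi U u.
Proof. by move=> mU [[/(L2P _ mU)]]. Qed.

Lemma H2_hess_msqi U u : measurable (U : set mplane) -> H2 U u -> msqi U (hess U u).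
Proof. by move=> mU [_ H] i j; apply/(L2P _ mU); case: (in_L2_hess H i j). Qed.

Lemma H2_lin U u k v : open U -> H2 U u -> H2 U v ->
  H2 U (fun x => u x + k * v x) /\
  {ae muP, forall x : mplane, U x ->
     hess U (fun x => u x + k * v x) x = hess U u x + k *: hess U v x}.
Proof.
move=> oU Hu Hv; have mU := open_measurable_plane oU.
have su := H2_sqi mU Hu; have sv := H2_sqi mU Hv.
have [[_ u1] u2] := Hu; have [[_ v1] v2] := Hv.
have rep2 i j : is_L2rep U (dpart i (dpart j (regular U (fun x => u x + k * v x))))
    (fun x => hess U u x i j + k * hess U v x i j).
  apply: (is_L2rep_lin mU _ (in_L2_hess u2 i j) (in_L2_hess v2 i j)) => phi tp.
  rewrite /dpart !opprK; apply: regular_lin => //.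
  by apply: test_pderiv; exact: test_pderiv.
split.
  split; last by move=> i j; eexists; exact: rep2.
  split.
    by apply/(L2P _ mU); exact: square_integrable_lin.
  move=> i; have [g ug] := u1 i; have [h vh] := v1 i; exists (fun x => g x + k * h x).
  apply: (is_L2rep_lin mU _ ug vh) => phi tp.
  rewrite /dpart regular_lin//; last exact: test_pderiv.
  by rewrite opprD mulrN.
apply: ae_eq_matrix => i j; apply: filterS (is_L2rep_ae oU (rep2 i j)) => x E Ux.
by rewrite mxE E// [RHS]mxE [X in _ = _ + X]mxE.
Qed.

(** Functions that agree almost everywhere define the same distribution on test functions, so by
    [L2rep_ext] the Hessians agree at every point. *)
Lemma hess_ae_ext U u v : measurable (U : set mplane) -> sqi U u -> sqi U v ->
  {ae muP, forall x : mplane, U x -> u x = v x} -> hess U u = hess U v.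
Proof.
move=> mU su sv uv; apply/funext => x; apply/matrixP => i j; rewrite !mxE.
rewrite (@L2rep_ext _ U _ (dpart i (dpart j (regular U v))))// => phi tp.
rewrite /dpart !opprK.
have sp := test_square_integrable mU (test_pderiv j (test_pderiv i tp)).
by apply: (ae_eq_dot mU su.1 sp.1 sv.1 sp.1 uv); exact: aeW.
Qed.

Lemma HdDiv_msqi U M : measurable (U : set mplane) -> HdDiv U M -> msqi U M.
Proof. by move=> mU [[H _] _] i j; apply/(L2P _ mU). Qed.

Lemma HdDiv_sqi U M : measurable (U : set mplane) -> HdDiv U M -> sqi U (divDiv U M).
Proof. by move=> mU [_ [g H]]; apply/(L2P _ mU); case: (L2rep_spec H). Qed.

Lemma HdDiv_lin U M k N : open U -> HdDiv U M -> HdDiv U N ->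
  HdDiv U (fun x => M x + k *: N x) /\
  {ae muP, forall x : mplane, U x ->
     divDiv U (fun x => M x + k *: N x) x = divDiv U M x + k * divDiv U N x}.
Proof.
move=> oU HM HN; have mU := open_measurable_plane oU.
have sM := HdDiv_msqi mU HM; have sN := HdDiv_msqi mU HN.
have [[_ yM] [g rM]] := HM; have [[_ yN] [h rN]] := HN.
have rep : is_L2rep U (div_div U (fun x => M x + k *: N x))
    (fun x => divDiv U M x + k * divDiv U N x).
  apply: (is_L2rep_lin mU _ (L2rep_spec rM) (L2rep_spec rN)) => phi tp.
  have sH := test_hess_msqi mU tp.
  rewrite !div_divE//; last exact: msqi_lin.
  exact: tip_linl.
split; last exact: is_L2rep_ae rep.
split; last by eexists; exact: rep.
split; first by move=> i j; apply/(L2P _ mU); exact: msqi_lin.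
have {}yM : {ae muP, forall x : mplane, U x -> symm (M x)} by exact: yM.
have {}yN : {ae muP, forall x : mplane, U x -> symm (N x)} by exact: yN.
suff : {ae muP, forall x : mplane, U x -> symm (M x + k *: N x)} by [].
apply: filterS2 yM yN => x a b Ux.
by rewrite /symm linearD linearZ/= (a Ux) (b Ux).
Qed.

Lemma point_value_lin (T : triangle R) u k v x c d :
  point_value T u x c -> point_value T v x d ->
  point_value T (fun x => u x + k * v x) x (c + k * d).
Proof.
move=> [a [ca ua <-]] [b [cb vb <-]]; exists (fun y => a y + k * b y); split=> //.
  move=> y; apply: cvgD; first exact: ca.
  by apply: cvgM; [exact: cvg_cst|exact: cb].
have {}ua : {ae muP, forall x : mplane, otri T x -> u x = a x} by exact: ua.
have {}vb : {ae muP, forall x : mplane, otri T x -> v x = b x} by exact: vb.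
suff : {ae muP, forall x : mplane, otri T x -> u x + k * v x = a x + k * b x} by [].
by apply: filterS2 ua vb => y A B Oy; rewrite A// B.
Qed.

End linearity.

(** * Conforming solution, uniqueness and a priori bound *)

Section hybrid.
Variable R : realType.
Local Notation plane := (R * R)%type.
Local Notation mplane := (measurableTypeR R * measurableTypeR R)%type.
Local Notation muP := (mu2 R : {measure set mplane -> \bar R}).
Local Notation sqi := (@square_integrable _ mplane R (mu2 R)).
Local Notation dt := (@dot _ mplane R (mu2 R)).
Variables (Om : set plane) (Ct : plane -> {linear 'M[R]_2 -> 'M[R]_2}).
Hypothesis polygon : lipschitz_polygon Om.
Hypothesis Ct_ok : tensor_field Om Ct.
Variables (N : nat) (T : 'I_N -> triangle R).
Hypothesis mesh : regular_mesh Om T.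
Implicit Types (u v : pwfun R N) (M : plane -> 'M[R]_2) (eta : functional R N).
Local Notation O i := (otri (T i)).

Let oOm : open Om := mesh_open_domain polygon.
Let oO i : open (O i). Proof. exact: mesh_otri_open mesh i. Qed.
Let OOm i : O i `<=` Om. Proof. exact: mesh_otri_sub polygon mesh i. Qed.
Let mOm : measurable (Om : set mplane) := open_measurable_plane oOm.
Let mO i : measurable (O i : set mplane) := open_measurable_plane (@oO i).

Definition pw_lin u k v : pwfun R N := fun i x => u i x + k * v i x.

Let sqi_sub i (g : plane -> R) : sqi Om g -> sqi (O i) g.
Proof. exact: square_integrable_subset (mO i) mOm (@OOm i). Qed.

Let msqi_sub i M : msqi Om M -> msqi (O i) M.
Proof. by move=> H j l; exact: sqi_sub. Qed.

Lemma H2N0_sqi v i : H2N0 Om T v -> sqi (O i) (v i).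
Proof. by case=> H _ _; exact: H2_sqi (mO i) (H i). Qed.

Lemma H2N0_msqi v i : H2N0 Om T v -> msqi (O i) (pw_hess T v i).
Proof. by case=> H _ _; exact: H2_hess_msqi (mO i) (H i). Qed.

Lemma H2N0_lin u k v : H2N0 Om T u -> H2N0 Om T v -> H2N0 Om T (pw_lin u k v).
Proof.
move=> [Hu cu bu] [Hv cv bv]; split.
- by move=> i; exact: (H2_lin k (@oO i) (Hu i) (Hv i)).1.
- move=> x Ox; have [c Hc] := cu x Ox; have [d Hd] := cv x Ox; exists (c + k * d).
  by move=> i l E; exact: point_value_lin (Hc i l E) (Hd i l E).
move=> x bx i l E; rewrite -[0](addr0 (0 : R)) -{2}(mulr0 k).
exact: point_value_lin (bu x bx i l E) (bv x bx i l E).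
Qed.

Lemma pw_hess_lin u k v i : H2N0 Om T u -> H2N0 Om T v ->
  {ae muP, forall x : mplane, O i x ->
    pw_hess T (pw_lin u k v) i x = pw_hess T u i x + k *: pw_hess T v i x}.
Proof. by move=> [Hu _ _] [Hv _ _]; exact: (H2_lin k (@oO i) (Hu i) (Hv i)).2. Qed.

Lemma tapply_pw_msqi v i : H2N0 Om T v -> msqi (O i) (tapply Ct (pw_hess T v i)).
Proof.
move=> Hv; exact: (tapply_square_integrable Ct_ok (mO i) (@OOm i)
  (hess_symm (O i) (v i)) (H2N0_msqi i Hv) mOm).
Qed.

Let tip_hess_lin u k v i P : H2N0 Om T u -> H2N0 Om T v -> msqi (O i) P ->
  tip (O i) (pw_hess T (pw_lin u k v) i) P =
  tip (O i) (pw_hess T u i) P + k * tip (O i) (pw_hess T v i) P.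
Proof.
move=> Hu Hv sP; have su := H2N0_msqi i Hu; have sv := H2N0_msqi i Hv.
rewrite -(tip_linl k (mO i) su sv sP).
apply: (ae_eq_tip (mO i) (H2N0_msqi i (H2N0_lin k Hu Hv)) sP _ sP).
- exact: msqi_lin.
- exact: pw_hess_lin.
- exact: aeW.
Qed.

Let tip_tapply_lin u k v i P : H2N0 Om T u -> H2N0 Om T v -> msqi (O i) P ->
  tip (O i) (tapply Ct (pw_hess T (pw_lin u k v) i)) P =
  tip (O i) (tapply Ct (pw_hess T u i)) P + k * tip (O i) (tapply Ct (pw_hess T v i)) P.
Proof.
move=> Hu Hv sP; have su := tapply_pw_msqi i Hu; have sv := tapply_pw_msqi i Hv.
rewrite -(tip_linl k (mO i) su sv sP).
apply: (ae_eq_tip (mO i) (tapply_pw_msqi i (H2N0_lin k Hu Hv)) sP _ sP).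
- exact: msqi_lin.
- apply: filterS (pw_hess_lin k i Hu Hv) => x H Ox.
  by rewrite /tapply H// linearD linearZ.
- exact: aeW.
Qed.

Lemma gamma_dDivE M v : gamma_dDiv Om T M v =
  \sum_i (dt (O i) (divDiv Om M) (v i) - tip (O i) M (pw_hess T v i)).
Proof. by rewrite sumrB. Qed.

Let sum_lin (F G H : 'I_N -> R) k : (forall i, F i = G i + k * H i) ->
  \sum_i F i = \sum_i G i + k * \sum_i H i.
Proof. by move=> E; rewrite mulr_sumr -big_split; apply: eq_bigr => i _. Qed.

Lemma gamma_lin_l M k P v : HdDiv Om M -> HdDiv Om P -> H2N0 Om T v ->
  gamma_dDiv Om T (fun x => M x + k *: P x) v =
  gamma_dDiv Om T M v + k * gamma_dDiv Om T P v.
Proof.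
move=> HM HP Hv; have [HMP E] := HdDiv_lin k oOm HM HP.
rewrite !gamma_dDivE; apply: sum_lin => i.
have sv := H2N0_sqi i Hv; have sH := H2N0_msqi i Hv.
rewrite (tip_linl k (mO i) (msqi_sub i (HdDiv_msqi mOm HM)) (msqi_sub i (HdDiv_msqi mOm HP)) sH).
have dM := sqi_sub i (HdDiv_sqi mOm HM); have dP := sqi_sub i (HdDiv_sqi mOm HP).
have -> : dt (O i) (divDiv Om (fun x => M x + k *: P x)) (v i) =
    dt (O i) (divDiv Om M) (v i) + k * dt (O i) (divDiv Om P) (v i).
  rewrite -(dot_linl k (mO i) dM dP sv).
  apply: (ae_eq_dot (mO i) (sqi_sub i (HdDiv_sqi mOm HMP)).1 sv.1 _ sv.1).
  - exact: (square_integrable_lin k (mO i) dM dP).1.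
  - by apply: filterS E => x H /OOm/H.
  - exact: aeW.
by rewrite mulrBr opprD addrACA.
Qed.

Lemma gamma_lin_r M u k v : HdDiv Om M -> H2N0 Om T u -> H2N0 Om T v ->
  gamma_dDiv Om T M (pw_lin u k v) = gamma_dDiv Om T M u + k * gamma_dDiv Om T M v.
Proof.
move=> HM Hu Hv.
rewrite !gamma_dDivE; apply: sum_lin => i.
have sM := msqi_sub i (HdDiv_msqi mOm HM).
have dM := sqi_sub i (HdDiv_sqi mOm HM).
have su := H2N0_sqi i Hu; have sv := H2N0_sqi i Hv.
rewrite !(tipC (O i) M) (tip_hess_lin k Hu Hv sM).
have -> : dt (O i) (divDiv Om M) (pw_lin u k v i) =
    dt (O i) (divDiv Om M) (u i) + k * dt (O i) (divDiv Om M) (v i).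
  have c (g : plane -> R) : dt (O i) (divDiv Om M) g = dt (O i) g (divDiv Om M) by exact: dotC.
  by rewrite !c; exact: (dot_linl k (mO i) su sv dM).
by rewrite mulrBr opprD addrACA.
Qed.

(** A [functional] is a bare function; an element of the trace space inherits linearity on [H2N0]
    from the trace of some tensor. *)
Lemma trace_space_linear eta u k v : trace_space Om T eta -> H2N0 Om T u -> H2N0 Om T v ->
  eta (pw_lin u k v) = eta u + k * eta v.
Proof.
move=> [M HM E] Hu Hv; rewrite -!E//; first exact: gamma_lin_r.
exact: H2N0_lin.
Qed.

Lemma trace_space_lin eta k eta' : trace_space Om T eta -> trace_space Om T eta' ->
  trace_space Om T (fun v => eta v + k * eta' v).
Proof.
move=> [M HM E] [M' HM' E']; exists (fun x => M x + k *: M' x).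
  exact: (HdDiv_lin k oOm HM HM').1.
by move=> v Hv; rewrite gamma_lin_l// E// E'.
Qed.

(** With k = -1 this serves both uniqueness and the continuous dependence on the datum. *)
Lemma hybrid_solution_lin f u eta k f' u' eta' : L2 Om f -> L2 Om f' ->
  hybrid_solution Om T Ct f u eta -> hybrid_solution Om T Ct f' u' eta' ->
  hybrid_solution Om T Ct (fun x => f x + k * f' x) (pw_lin u k u')
    (fun v => eta v + k * eta' v).
Proof.
move=> /(L2P _ mOm) sf /(L2P _ mOm) sf' [Hu te E1 E2] [Hu' te' E1' E2']; split.
- exact: H2N0_lin.
- exact: trace_space_lin.
- move=> v Hv; transitivity (pw_ip T f v + k * pw_ip T f' v); last first.
    apply/esym; apply: sum_lin => i.
    exact: (dot_linl k (mO i) (sqi_sub i sf) (sqi_sub i sf') (H2N0_sqi i Hv)).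
  rewrite -E1// -E1'// mulrDr addrACA; congr (_ + _).
  apply: sum_lin => i.
  exact: (tip_tapply_lin k Hu Hu' (H2N0_msqi i Hv)).
- by move=> d td; rewrite trace_space_linear// E2// E2'// mulr0 addr0.
Qed.

Section conforming.
Variables (f : plane -> R) (phi : nat -> plane -> R) (w : plane -> R).
Hypotheses (sf : sqi Om f) (Hw : H20_approx Om phi w).
Hypothesis euler : forall psi, test Om psi ->
  tip Om (tapply Ct (hess Om w)) (test_hess psi) = dt Om f psi.
Let M := tapply Ct (hess Om w).
Let HM : HdDiv Om M := (plate_HdDiv oOm Ct_ok sf Hw euler).1.

(** [w] is its own continuous representative on every triangle, so that its nodal values agree;
    boundary points lie outside the open set [Om], where [w] is 0. *)
Lemma conforming_H2N0 : H2N0 Om T (fun=> w).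
Proof.
have [_ [cw w0] _ _ _] := Hw.
have pv i x : point_value (T i) w x (w x).
  exists w; split=> //; first exact: continuous_subspaceT.
  suff : {ae muP, forall y : mplane, O i y -> w y = w y} by [].
  exact: aeW.
split.
- by move=> i; exact: (approx_H2 oOm Hw (@oO i) (@OOm i)).
- by move=> x _; exists (w x) => i k _; exact: pv.
- move=> x bx i k _; have /w0 <- : ~ Om x by exact: boundary_notin oOm _ bx.
  exact: pv.
Qed.

Lemma conforming_hess i :
  {ae muP, forall x : mplane, O i x -> pw_hess T (fun=> w) i x = hess Om w x}.
Proof. exact: (approx_hess_ae oOm Hw (@oO i) (@OOm i)). Qed.

(** The second equation for the candidate: Green's formula on [Om], split over the triangles, on
    each of which the Hessian of [w] is the restriction of the one on [Om]. *)
Lemma gamma_conforming P : HdDiv Om P -> gamma_dDiv Om T P (fun=> w) = 0.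
Proof.
move=> HP; have sP := HdDiv_msqi mOm HP; have sH := approx_hess_msqi oOm Hw.
rewrite /gamma_dDiv; apply/eqP; rewrite subr_eq0; apply/eqP.
transitivity (dt Om (divDiv Om P) w).
  exact: esym (mesh_dot polygon mesh (HdDiv_sqi mOm HP) (approx_sqi Hw)).
rewrite (approx_green oOm Hw HP) (mesh_tip polygon mesh sP sH).
apply: eq_bigr => i _; apply: (ae_eq_tip (mO i) (msqi_sub i sP) (msqi_sub i sH) (msqi_sub i sP)).
- exact: H2N0_msqi conforming_H2N0.
- exact: aeW.
- by apply: filterS (conforming_hess i) => x H Ox; rewrite H.
Qed.

(** In the first equation (C D^2 w, D^2 v) cancels against the same term in the trace of [M], which
    leaves (div div M, v) = (f, v). *)
Lemma conforming_solution : hybrid_solution Om T Ct f (fun=> w) (gamma_dDiv Om T M).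
Proof.
split.
- exact: conforming_H2N0.
- by exists M.
- move=> v Hv.
  have E1 : pw_tip T (fun i => tapply Ct (pw_hess T (fun=> w) i)) (pw_hess T v) =
      pw_tip T (fun=> M) (pw_hess T v).
    apply: eq_bigr => i _; have sv := H2N0_msqi i Hv.
    apply: (ae_eq_tip (mO i) (tapply_pw_msqi i conforming_H2N0) sv
      (msqi_sub i (HdDiv_msqi mOm HM)) sv); last exact: aeW.
    by apply: filterS (conforming_hess i) => x H Ox; rewrite /M /tapply H.
  have E2 : pw_ip T (divDiv Om M) v = pw_ip T f v.
    apply: eq_bigr => i _.
    have sv := H2N0_sqi i Hv; have dM := sqi_sub i (HdDiv_sqi mOm HM).
    apply: (ae_eq_dot (mO i) dM.1 sv.1 (sqi_sub i sf).1 sv.1); last exact: aeW.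
    by apply: filterS (plate_HdDiv oOm Ct_ok sf Hw euler).2 => x H /OOm/H.
  by rewrite E1 /gamma_dDiv E2 addrC subrK.
- by move=> d [P HP E]; rewrite -E; [exact: gamma_conforming|exact: conforming_H2N0].
Qed.

End conforming.

Let Om_fin : (mu2 R Om < +oo)%E.
Proof. by case: polygon => _ _ _ bOm _; exact: bounded_measure_lty. Qed.

Let sum_eq0 (F : 'I_N -> R) : (forall i, 0 <= F i) -> \sum_i F i = 0 -> forall i, F i = 0.
Proof. by move=> F0 /(psumr_eq0P (fun i _ => F0 i)) H i; exact: H. Qed.

Let tip_ae0l i P Q : msqi (O i) P -> msqi (O i) Q ->
  {ae muP, forall x : mplane, O i x -> P x = 0} -> tip (O i) P Q = 0.
Proof.
move=> sP sQ P0.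
have s0 : msqi (O i) (fun=> 0).
  move=> j l; have -> : (fun x : plane => (0 : 'M[R]_2) j l) = fun=> 0.
    by apply/funext => x; rewrite mxE.
  exact: square_integrable0.
have := ae_eq_tip (mO i) sP sQ s0 sQ P0 (aeW _ (fun _ _ => erefl)) => ->.
rewrite /tip; under eq_Rintegral do rewrite frobE !mxE !mul0r !addr0.
by rewrite Rintegral_cst// mul0r.
Qed.

(* Testing with d kills its Hessian. The plate problem with right-hand side d
   provides a tensor M with div div M = d, whose trace tested with d is then the
   squared norm of d. *)
Lemma hybrid_zero d eta : hybrid_solution Om T Ct (fun=> 0) d eta ->
  (forall i, {ae muP, forall x : mplane, O i x -> d i x = 0}) /\
  forall v, H2N0 Om T v -> eta v = 0.
Proof.
move=> [Hd te E1 E2]; have [al al0 coer] := tip_tapply_coercive Ct_ok.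
have ip0 v : pw_ip T (fun=> 0) v = 0.
  apply: big1 => i _; rewrite /ip; under eq_Rintegral do rewrite mul0r.
  by rewrite Rintegral_cst// ?mul0r//; exact: mO.
have c i := coer (O i) _ mOm (mO i) (@OOm i) (hess_symm (O i) (d i)) (H2N0_msqi i Hd).
have z : forall i, tip (O i) (tapply Ct (pw_hess T d i)) (pw_hess T d i) = 0.
  apply: sum_eq0 => [i|].
    apply: le_trans (c i); apply: mulr_ge0; [exact: ltW|exact: tip_ge0].
  (* [eta] is itself a trace, so the second equation removes [eta d] from the first one tested with
     [d]. *)
  by have := E1 d Hd; rewrite E2// addr0 ip0.
have h0 i : {ae muP, forall x : mplane, O i x -> pw_hess T d i x = 0}.
  apply: (tip_eq0 (mO i) (H2N0_msqi i Hd)); rewrite -(ler_pM2l al0) mulr0.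
  by rewrite -(z i); exact: c.
split; last first.
  move=> v Hv; have := E1 v Hv; rewrite ip0 [X in X + _]big1 ?add0r// => i _.
  apply: (tip_ae0l (tapply_pw_msqi i Hd) (H2N0_msqi i Hv)).
  by apply: filterS (h0 i) => x H Ox; rewrite /tapply H// linear0.
have [g sg gd] := mesh_glue polygon mesh (fun i => H2N0_sqi i Hd).
have [phi [w [Hw eul]]] := plate_solution oOm Om_fin Ct_ok sg.
have [HM Mg] := plate_HdDiv oOm Ct_ok sg Hw eul.
have sd i := H2N0_sqi i Hd.
have s0 : \sum_i dt (O i) (d i) (d i) = 0.
  have := E2 (gamma_dDiv Om T (tapply Ct (hess Om w))) (ex_intro2 _ _ _ HM (fun _ _ => erefl)).
  rewrite gamma_dDivE => Z; rewrite -[RHS]Z; apply: eq_bigr => i _.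
  have sM := msqi_sub i (HdDiv_msqi mOm HM).
  rewrite tipC (tip_ae0l (H2N0_msqi i Hd) sM (h0 i)) subr0.
  apply: (ae_eq_dot (mO i) (sd i).1 (sd i).1 (sqi_sub i (HdDiv_sqi mOm HM)).1 (sd i).1).
  - by apply: filterS Mg => x H Ox; rewrite (H (OOm Ox)) (gd i x Ox).
  - exact: aeW.
move=> i; apply: (dot_eq0 (mO i) (sd i)).
by apply: sum_eq0 s0 i => i; exact: dot_ge0.
Qed.

Lemma hybrid_unique f u eta u' eta' : sqi Om f ->
  hybrid_solution Om T Ct f u eta -> hybrid_solution Om T Ct f u' eta' ->
  (forall i, {ae muP, forall x : mplane, O i x -> u' i x = u i x}) /\
  forall v, H2N0 Om T v -> eta' v = eta v.
Proof.
move=> sf S S'; have Lf : L2 Om f by apply/(L2P _ mOm).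
have := hybrid_solution_lin (-1) Lf Lf S' S.
rewrite (_ : (fun x => f x + -1 * f x) = fun=> 0); last first.
  by apply/funext => x; rewrite mulN1r subrr.
move=> /hybrid_zero[d0 e0]; split=> [i|v /e0].
  by apply: filterS (d0 i) => x H /H; rewrite /pw_lin mulN1r => /subr0_eq.
by rewrite mulN1r => /subr0_eq.
Qed.

(** By uniqueness both norms are computed on the conforming solution. The trace norm is an infimum,
    bounded by the norm of the extension [C D^2 w], whose square is at most K ||f||^2 + ||f||^2;
    hence the [K + 1]. *)
Lemma hybrid_bound (K : R) f (phi : nat -> plane -> R) w u eta : 0 <= K -> sqi Om f ->
  H20_approx Om phi w ->
  (forall psi, test Om psi ->
    tip Om (tapply Ct (hess Om w)) (test_hess psi) = dt Om f psi) ->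
  dt Om w w + tip Om (hess Om w) (hess Om w) <= K * dt Om f f ->
  tip Om (tapply Ct (hess Om w)) (tapply Ct (hess Om w)) <= K * dt Om f f ->
  hybrid_solution Om T Ct f u eta ->
  norm2T T u + trace_norm Om T eta <= (Num.sqrt K + Num.sqrt (K + 1)) * L2norm Om f.
Proof.
move=> K0 sf Hw eul b1 b2 S; have C := conforming_solution sf Hw eul.
have [uw ew] := hybrid_unique sf C S; have [HM Mf] := plate_HdDiv oOm Ct_ok sf Hw eul.
have [Hu _ _ _] := S; have Hc := conforming_H2N0 Hw.
have n1 : \sum_i ip (O i) (u i) (u i) = dt Om w w.
  rewrite (mesh_dot polygon mesh (approx_sqi Hw) (approx_sqi Hw)); apply: eq_bigr => i _.
  have su := H2N0_sqi i Hu; have sw := H2N0_sqi i Hc.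
  exact: (ae_eq_dot (mO i) su.1 su.1 sw.1 sw.1 (uw i) (uw i)).
have n2 : pw_tip T (pw_hess T u) (pw_hess T u) = tip Om (hess Om w) (hess Om w).
  rewrite (mesh_tip polygon mesh (approx_hess_msqi oOm Hw) (approx_hess_msqi oOm Hw)).
  apply: eq_bigr => i _.
  have su := H2N0_msqi i Hu; have sw := msqi_sub i (approx_hess_msqi oOm Hw).
  have E : {ae muP, forall x : mplane, O i x -> pw_hess T u i x = hess Om w x}.
    have -> : pw_hess T u i = pw_hess T (fun=> w) i.
      exact: (hess_ae_ext (mO i) (H2N0_sqi i Hu) (H2N0_sqi i Hc) (uw i)).
    exact: conforming_hess Hw i.
  exact: (ae_eq_tip (mO i) su su sw sw E E).
have tn : trace_norm Om T eta <= dDiv_norm Om (tapply Ct (hess Om w)).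
  apply: ge_inf; first by exists 0 => _ [M _ <-]; exact: sqrtr_ge0.
  by exists (tapply Ct (hess Om w)) => //; split=> // v Hv; rewrite ew.
have d2 : ip Om (divDiv Om (tapply Ct (hess Om w))) (divDiv Om (tapply Ct (hess Om w))) =
    dt Om f f.
  have sM := HdDiv_sqi mOm HM; exact: (ae_eq_dot mOm sM.1 sM.1 sf.1 sf.1 Mf Mf).
rewrite mulrDl /norm2T n1 n2; apply: lerD.
  rewrite /L2norm -sqrtrM//; exact: ler_wsqrtr.
apply: (le_trans tn); rewrite /dDiv_norm d2 /L2norm -sqrtrM ?addr_ge0//; apply: ler_wsqrtr.
by rewrite mulrDl mul1r lerD2r.
Qed.

End hybrid.

Theorem theorem12 (R : realType) (Om : set (R * R))
  (Om_polygon : lipschitz_polygon Om) (Om_sc : simply_connected Om)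
  (Ct : R * R -> {linear 'M[R]_2 -> 'M[R]_2}) (Ct_ok : tensor_field Om Ct)
  (sigma : R) :
  exists2 K : R, 0 < K &
  forall (N : nat) (T : 'I_N -> triangle R),
    regular_mesh Om T -> (forall i, shape_regular sigma (T i)) ->
    [/\ (* existence and uniqueness *)
        (forall f, L2 Om f -> exists u eta,
           hybrid_solution Om T Ct f u eta /\
           forall u' eta', hybrid_solution Om T Ct f u' eta' ->
             eq_pw T u' u /\ eq_fctl Om T eta' eta),
        (* continuous dependence on the datum *)
        (forall f u eta, L2 Om f -> hybrid_solution Om T Ct f u eta ->
         forall eps : R, 0 < eps -> exists2 delta : R, 0 < delta &
         forall f' u' eta', L2 Om f' -> hybrid_solution Om T Ct f' u' eta' ->
           L2norm Om (fun x => f' x - f x) < delta ->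
           norm2T T (fun i x => u' i x - u i x) +
           trace_norm Om T (fun v => eta' v - eta v) < eps),
        (* a priori bound *)
        (forall f u eta, L2 Om f -> hybrid_solution Om T Ct f u eta ->
           norm2T T u + trace_norm Om T eta <= K * L2norm Om f)
      & (* conformity and the Kirchhoff-Love problem *)
        forall f u eta, L2 Om f -> hybrid_solution Om T Ct f u eta ->
          exists uOm : R * R -> R, let M := tapply Ct (hess Om uOm) in
          [/\ forall i, eq_ae (otri (T i)) uOm (u i),
              H20 Om uOm,
              HdDiv Om M,
              eq_fctl Om T eta (gamma_dDiv Om T M)
            & kirchhoff_love Om Ct f uOm M]].
Proof.
have oOm := mesh_open_domain Om_polygon; have mOm := open_measurable_plane oOm.
have Om_fin : (mu2 R Om < +oo)%E.
  by case: (Om_polygon) => _ _ _ bOm _; exact: bounded_measure_lty.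
have [K0 K0_gt0 bounds] := plate_bounds oOm Om_fin Ct_ok.
(* Fixed by [Om] and [Ct], before any mesh is introduced. *)
pose K := Num.sqrt K0 + Num.sqrt (K0 + 1).
have K_gt0 : 0 < K by rewrite addr_gt0// sqrtr_gt0// addr_gt0.
exists K => // N T mesh _.
have bound f u eta : L2 Om f -> hybrid_solution Om T Ct f u eta ->
    norm2T T u + trace_norm Om T eta <= K * L2norm Om f.
  move=> /(L2P _ mOm) sf S; have [phi [w [Hw eul]]] := plate_solution oOm Om_fin Ct_ok sf.
  have [b1 b2] := bounds f phi w sf Hw eul.
  exact: (hybrid_bound Om_polygon Ct_ok mesh (ltW K0_gt0) sf Hw eul b1 b2 S).
split=> //.
- move=> f /(L2P _ mOm) sf; have [phi [w [Hw eul]]] := plate_solution oOm Om_fin Ct_ok sf.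
  have C := conforming_solution Om_polygon Ct_ok mesh sf Hw eul.
  exists (fun=> w), (gamma_dDiv Om T (tapply Ct (hess Om w))); split=> // u' eta' S.
  exact: (hybrid_unique Om_polygon Ct_ok mesh sf C S).
(* The difference of two solutions solves the problem for the difference of the data, so the a
   priori bound gives Lipschitz dependence with constant [K]. *)
- move=> f u eta Lf S e e0; exists (e / K); first exact: divr_gt0.
  move=> f' u' eta' Lf' S' d.
  have D := hybrid_solution_lin Om_polygon Ct_ok mesh (-1) Lf' Lf S' S.
  have Lg : L2 Om (fun x => f' x + -1 * f x).
    by move: Lf Lf' => /(L2P _ mOm) sf /(L2P _ mOm) sf'; apply/(L2P _ mOm); exact: square_integrable_lin.
  have := bound _ _ _ Lg D; rewrite /pw_lin.
  have -> : (fun x => f' x + -1 * f x) = fun x => f' x - f x.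
    by apply/funext => x; rewrite mulN1r.
  have -> : (fun (i : 'I_N) x => u' i x + -1 * u i x) = fun i x => u' i x - u i x.
    by apply/funext => i; apply/funext => x; rewrite mulN1r.
  have -> : (fun v => eta' v + -1 * eta v) = fun v => eta' v - eta v.
    by apply/funext => v; rewrite mulN1r.
  by move=> H; apply: (le_lt_trans H); rewrite mulrC -ltr_pdivlMr.
- move=> f u eta /(L2P _ mOm) sf S.
  have [phi [w [Hw eul]]] := plate_solution oOm Om_fin Ct_ok sf.
  have C := conforming_solution Om_polygon Ct_ok mesh sf Hw eul.
  (* Conformity is known for the constructed solution; uniqueness transfers it to the given one. *)
  have [uw ew] := hybrid_unique Om_polygon Ct_ok mesh sf S C.
  have [HM Mf] := plate_HdDiv oOm Ct_ok sf Hw eul; have w20 := approx_H20 oOm Hw.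
  have [H2w tr nd] := w20.
  exists w => M; split=> //.
  + by move=> v Hv; rewrite ew.
  + split=> //.
    suff : {ae (mu2 R : {measure set (measurableTypeR R * measurableTypeR R) -> \bar R}),
        forall x, Om x -> M x = tapply Ct (hess Om w) x} by [].
    exact: aeW.
Qed.
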